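(* Let $d$ be a positive integer and $1\le p\le\infty$. Let $v\in L^\infty([0,1]^d)$ be of the form $v(x)=\prod_{i=1}^d v_i(x_i)$ for $x=(x_1,\dots,x_d)$, where $v_i\in\mathcal{P}$ for all $i\in\{1,\dots,d\}$ and $\mathcal{P}$ is the class of generalized polynomials on $[0,1]$. Let $\tau$ be a bijective ergodic transformation of $[0,1]^d$ of the form $\tau(x)=(\tau_1(x_1),\dots,\tau_d(x_d))$. Let $D_{i,n}$ denote the discrepancy associated to $\tau_i$, and assume that for some $\epsilon>0$ $$\sup_{1\le i\le d}D_{i,n}=O\left(\frac{1}{\ln^{3+\epsilon}n}\right)\quad(n\to\infty).$$ Then the operator $T:L^p([0,1]^d)\to L^p([0,1]^d)$, $Tf=v\,(f\circ\tau)$, has a nontrivial hyperinvariant subspace.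
   Context: $[0,1]^d$ carries Lebesgue measure, and $L^p$ spaces are spaces of complex-valued functions. An ergodic transformation is understood to be measurable and Lebesgue-measure preserving. Class $\mathcal{P}\subset L^\infty([0,1])$ (''generalized polynomials''): $u\in\mathcal{P}$ if there exist positive constants $s_0,\dots,s_l$, a nonzero constant $C$, points $y_0,\dots,y_l\in[0,1]$ and maps $\sigma_0,\dots,\sigma_l$, each of the form $\sigma_j(y)=y$ or $\sigma_j(y)=|y|$, such that $u(y)=C\prod_{j=0}^{l}(\sigma_j(y-y_j))^{s_j}$ for $y\in[0,1]$ (the absolute value is used where needed, for certain powers $s_j$, so that $u$ is defined on $[0,1]$). Discrepancy: for a sequence $\omega=(y_n)_{n\ge1}$ of numbers in the unit interval and a subset $E$, let $A(N,E,\omega)$ be the number of $n$ with $1\le n\le N$ and $y_n\in E$, and $D_N(\omega)=\sup_{0\le\alpha<\beta\le1}\left|\frac{A(N,[\alpha,\beta),\omega)}{N}-(\beta-\alpha)\right|$. The discrepancy associated to a map $\tau_i:[0,1]\to[0,1]$ is $D_{i,N}=\sup_{y\in[0,1)}D_N((\tau_i^n(y))_{n\ge1})$. A (nontrivial) hyperinvariant subspace of a bounded operator $T$ on a Banach space $X$ is a closed linear subspace $M$ with $\{0\}\ne M\ne X$ such that $SM\subset M$ for every bounded operator $S$ on $X$ with $ST=TS$. *)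

(* Defs.v *)
(* MathComp-Analysis development over an arbitrary R : realType. *)
From HB Require Import structures.
From mathcomp Require Import all_boot all_order all_algebra.
From mathcomp Require Import all_classical all_reals all_analysis.
From mathcomp Require Import measurable_realfun ess_sup_inf.
From mathcomp Require Import complex generic_quotient ring_quotient.

Set Implicit Arguments.
Unset Strict Implicit.
Unset Printing Implicit Defensive.
Import Order.TTheory GRing.Theory Num.Theory.
Import numFieldNormedType.Exports.

Local Open Scope classical_set_scope.
Local Open Scope ring_scope.

Definition unit_interval (R : realType) : Type := {i01 R}.

Definition I01val (R : realType) (y : unit_interval R) : R :=
  (y : {i01 R})%:num.

(* [0,1] carries the trace of the Borel sigma-algebra of R and the trace of
   Lebesgue measure. *)
Section UnitInterval.
Context (R : realType).

HB.instance Definition _ := Choice.on (unit_interval R).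
HB.instance Definition _ :=
  isPointed.Build (unit_interval R) (0%:i01 : {i01 R}).

Let I01_set0 : preimage_set_system setT (@I01val R) measurable set0.
Proof. by exists set0 => //; rewrite preimage_set0 setI0. Qed.

Let I01_setC A : preimage_set_system setT (@I01val R) measurable A ->
  preimage_set_system setT (@I01val R) measurable (~` A).
Proof.
move=> [B mB <-]; exists (~` B); first exact: measurableC.
by rewrite !setTI preimage_setC.
Qed.

Let I01_bigcup (F : (set (unit_interval R))^nat) :
  (forall i, preimage_set_system setT (@I01val R) measurable (F i)) ->
  preimage_set_system setT (@I01val R) measurable (\bigcup_i F i).
Proof.
move=> /(_ _)/cid2-/all_sig2[G mG GF].
exists (\bigcup_i G i); first exact: bigcup_measurable.
by rewrite setTI preimage_bigcup; apply: eq_bigcupr => i _; rewrite -GF setTI.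
Qed.

HB.instance Definition _ := @isMeasurable.Build default_measure_display
  (unit_interval R) (preimage_set_system setT (@I01val R) measurable)
  I01_set0 I01_setC I01_bigcup.

Lemma measurable_I01val : measurable_fun setT (@I01val R).
Proof. by move=> _ B mB; exists B. Qed.

Lemma I01val_inj : injective (@I01val R).
Proof. exact: val_inj. Qed.

Lemma I01val_ge0 (y : unit_interval R) : 0 <= I01val y.
Proof. by rewrite /I01val. Qed.

Lemma I01val_le1 (y : unit_interval R) : I01val y <= 1.
Proof. by rewrite /I01val. Qed.

Lemma image_I01val (B : set R) :
  @I01val R @` (@I01val R @^-1` B) = B `&` `[0, 1]%classic.
Proof.
apply/seteqP; split=> [_ [y By <-]|x [Bx]].
  by split => //=; rewrite in_itv/= I01val_ge0 I01val_le1.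
rewrite /= in_itv/= => /andP[x0 x1].
by exists (Itv01 x0 x1 : {i01 R}).
Qed.

Lemma measurable_image_I01val (A : set (unit_interval R)) :
  measurable A -> measurable (@I01val R @` A).
Proof.
by move=> [B mB <-]; rewrite setTI image_I01val; apply: measurableI.
Qed.

Definition interval_measure (A : set (unit_interval R)) : \bar R :=
  lebesgue_measure (@I01val R @` A).

Let interval_measure0 : interval_measure set0 = 0%E.
Proof. by rewrite /interval_measure image_set0 measure0. Qed.

Let interval_measure_ge0 A : (0 <= interval_measure A)%E.
Proof. exact: measure_ge0. Qed.

Let interval_measure_sigma_additive : semi_sigma_additive interval_measure.
Proof.
move=> F mF tF mUF; rewrite /interval_measure image_bigcup.
apply: measure_semi_sigma_additive.
- by move=> n; exact: measurable_image_I01val.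
- apply/trivIsetP => i j _ _ ij; apply/seteqP; split => // _ [[y Fy <-]].
  move=> [z Fz /I01val_inj zy]; rewrite zy in Fz.
  by move/trivIsetP : tF => /(_ i j I I ij) /seteqP[/(_ y) h _]; apply: h.
- by rewrite -image_bigcup; exact: measurable_image_I01val.
Qed.

HB.instance Definition _ := isMeasure.Build _ _ _ interval_measure
  interval_measure0 interval_measure_ge0 interval_measure_sigma_additive.

Let interval_measure_setT : interval_measure setT = 1%E.
Proof.
rewrite /interval_measure -(preimage_setT (@I01val R)) image_I01val setTI.
by rewrite lebesgue_measure_itv/= lte01 oppr0 adde0.
Qed.

HB.instance Definition _ := Measure_isProbability.Build _ _ _
  interval_measure interval_measure_setT.
End UnitInterval.

Section CubeMeasure.
Context (R : realType).

Definition tuple_cons n (x : unit_interval R * n.-tuple (unit_interval R)) :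
  n.+1.-tuple (unit_interval R) := [the n.+1.-tuple _ of x.1 :: x.2].

Lemma measurable_tuple_cons n : measurable_fun setT (@tuple_cons n).
Proof. exact: measurable_cons. Qed.

HB.instance Definition _ n :=
  isMeasurableFun.Build _ _ _ _ (@tuple_cons n) (@measurable_tuple_cons n).

(* The d-fold product of [interval_measure], on the product (Borel)
   sigma-algebra. *)
Fixpoint box_measure d : probability (d.-tuple (unit_interval R)) R :=
  match d with
  | 0%N => \d_([tuple] : 0.-tuple (unit_interval R))
  | n.+1 => distribution (@interval_measure R \x box_measure n)%E
              (@tuple_cons n)
  end.

Lemma box_measureE d (B : 'I_d -> set (unit_interval R)) :
  (forall i, measurable (B i)) ->
  box_measure d [set x | forall i, B i (tnth x i)] =
  (\prod_(i < d) interval_measure (B i))%E.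
Proof.
elim: d B => [|n IH] B mB /=.
  by rewrite big_ord0 diracE mem_set//= => -[].
rewrite /distribution/= /pushforward/=.
rewrite (_ : _ @^-1` _ = B ord0 `*`
    [set x : n.-tuple _ | forall i, B (lift ord0 i) (tnth x i)]); last first.
  apply/seteqP; split => [[y x] /= h|[y x] /= [h0 h] i].
    split; first by have := h ord0; rewrite /tuple_cons/= tnth0.
    by move=> i; have := h (lift ord0 i); rewrite /tuple_cons/= tnthS.
  case: (unliftP ord0 i) => [j ->|->]; first by rewrite /tuple_cons/= tnthS.
  by rewrite /tuple_cons/= tnth0.
rewrite product_measure1E//; last first.
  rewrite (_ : mkset _ = \bigcap_(i in [set: 'I_n])
    ((fun x : n.-tuple (unit_interval R) => tnth x i) @^-1` B (lift ord0 i))).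
    apply: fin_bigcap_measurable => //= i _.
    by rewrite -[X in measurable X]setTI; exact: measurable_tnth.
  by apply/seteqP; split => [x h i _|x h i]; [exact: h|exact: (h i)].
rewrite big_ord_recl; congr (_ * _)%E.
by apply: (IH (fun i => B (lift ord0 i))) => i; exact: mB.
Qed.

(* [0,1]^d with its Lebesgue sigma-algebra: the Caratheodory-measurable sets of
   the outer measure generated by [box_measure]. The measure [cube_measure] is
   thus the completion of the product measure; see [cube_measureE] for its value
   on boxes. *)
Definition cube d : Type :=
  caratheodory_type (mu_ext (box_measure d)).

HB.instance Definition _ d := Measurable.on (cube d).

Definition cube_measure d : set (cube d) -> \bar R :=
  @completed_measure_extension _ _ _ (box_measure d).

HB.instance Definition _ d := Measure.on (@cube_measure d).

Definition cube_coord d (x : cube d) (i : 'I_d) : unit_interval R := tnth x i.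

Lemma cube_measureE d (B : 'I_d -> set (unit_interval R)) :
  (forall i, measurable (B i)) ->
  cube_measure [set x : cube d | forall i, B i (cube_coord x i)] =
  (\prod_(i < d) interval_measure (B i))%E.
Proof.
move=> mB; rewrite -box_measureE//; apply: measurable_mu_extE.
rewrite (_ : mkset _ = \bigcap_(i in [set: 'I_d])
  ((fun x : d.-tuple (unit_interval R) => tnth x i) @^-1` B i)).
  apply: fin_bigcap_measurable => //= i _.
  by rewrite -[X in measurable X]setTI; exact: measurable_tnth.
by apply/seteqP; split => [x h i _|x h i]; [exact: h|exact: (h i)].
Qed.

End CubeMeasure.
Arguments cube_measure : clear implicits.

Section ComplexLp.
Context d (T : measurableType d) (R : realType).
Variables (mu : {measure set T -> \bar R}) (p : \bar R).
Implicit Types f g : T -> R[i].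

Definition complex_measurable (f : T -> R[i]) :=
  measurable_fun setT (fun x => complex.Re (f x)) /\
  measurable_fun setT (fun x => complex.Im (f x)).

Definition cabs (z : R[i]) : R := Normc.normc z.

(* 'N[mu]_p[_] is the integral norm for p finite and the essential supremum norm
   for p = +oo. *)
Definition Lpnorm (f : T -> R[i]) : \bar R :=
  ('N[mu]_p[EFin \o (cabs \o f)])%E.

Definition in_Lp (f : T -> R[i]) :=
  complex_measurable f /\ (Lpnorm f < +oo)%E.

Lemma cabs_ge0 z : 0 <= cabs z.
Proof. by case: z => a b; exact: sqrtr_ge0. Qed.

Lemma cabsD z w : cabs (z + w) <= cabs z + cabs w.
Proof. exact: le_normcD. Qed.

Lemma cabsM z w : cabs (z * w) = cabs z * cabs w.
Proof. exact: Normc.normcM. Qed.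

Lemma normC_cabs (z : R[i]) : `|z| = (cabs z)%:C%C.
Proof. by case: z. Qed.

Lemma measurable_cabs f : complex_measurable f ->
  measurable_fun setT (cabs \o f).
Proof.
move=> [mR mI].
rewrite (_ : _ \o _ = Num.sqrt \o (fun x => complex.Re (f x) ^+ 2 + complex.Im (f x) ^+ 2)).
  apply: (@measurableT_comp _ _ _ _ _ _ (@Num.sqrt R)).
    by apply: continuous_measurable_fun; exact: sqrt_continuous.
  by apply: measurable_funD; exact: measurable_funX.
by apply/funext => x/=; case: (f x).
Qed.

Lemma complex_measurableD f g : complex_measurable f -> complex_measurable g ->
  complex_measurable (f + g).
Proof.
move=> [fR fI] [gR gI]; split.
  rewrite (_ : (fun _ => _) = (fun x => complex.Re (f x) + complex.Re (g x))).
    exact: measurable_funD.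
  by apply/funext => x; rewrite /= raddfD.
rewrite (_ : (fun _ => _) = (fun x => complex.Im (f x) + complex.Im (g x))).
  exact: measurable_funD.
by apply/funext => x; rewrite /= raddfD.
Qed.

Lemma complex_measurableM f g : complex_measurable f -> complex_measurable g ->
  complex_measurable (fun x => f x * g x).
Proof.
move=> [fR fI] [gR gI]; split.
  rewrite (_ : (fun _ => _) =
    (fun x => complex.Re (f x) * complex.Re (g x) - complex.Im (f x) * complex.Im (g x))).
    by apply: measurable_funB; exact: measurable_funM.
  by apply/funext => x; case: (f x) (g x) => a b [].
rewrite (_ : (fun _ => _) =
  (fun x => complex.Re (f x) * complex.Im (g x) + complex.Im (f x) * complex.Re (g x))).
  by apply: measurable_funD; exact: measurable_funM.
by apply/funext => x; case: (f x) (g x) => a b [].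
Qed.

Lemma complex_measurable_cst (c : R[i]) : complex_measurable (fun=> c).
Proof. by split; exact: measurable_cst. Qed.

Lemma Lpnorm_ge0 f : (0 <= Lpnorm f)%E.
Proof. exact: Lnorm_ge0. Qed.

Hypothesis p1 : (1 <= p)%E.

Lemma le_Lpnorm f g : complex_measurable f -> complex_measurable g ->
  (\forall x \ae mu, cabs (f x) <= cabs (g x)) -> (Lpnorm f <= Lpnorm g)%E.
Proof.
move=> /measurable_cabs mf /measurable_cabs mg fg.
rewrite /Lpnorm unlock; move: p1; case: p => [r|_|//].
  rewrite lee_fin => r1.
  rewrite gt0_ler_poweR ?invr_ge0 ?(le_trans ler01)//.
  - by rewrite in_itv/= leey integral_ge0// => x _; exact: poweR_ge0.
  - by rewrite in_itv/= leey integral_ge0// => x _; exact: poweR_ge0.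
  - apply: ae_ge0_le_integral => //.
    + by move=> x _; exact: poweR_ge0.
    + under eq_fun do rewrite /=.
      apply/measurable_EFinP/(measurableT_comp (measurable_powR _)) => //.
      exact/measurableT_comp.
    + by move=> x _; exact: poweR_ge0.
    + under eq_fun do rewrite /=.
      apply/measurable_EFinP/(measurableT_comp (measurable_powR _)) => //.
      exact/measurableT_comp.
    + apply: filterS fg => x fgx _ /=.
      rewrite lee_fin ge0_ler_powR ?nnegrE//; first exact: le_trans ler01 r1.
      by rewrite !ger0_norm ?cabs_ge0.
case: ifPn => // _; apply: le_ess_sup; apply: filterS fg => x fgx/=.
by rewrite lee_fin !ger0_norm ?cabs_ge0.
Qed.

Lemma Lpnorm0 : Lpnorm 0 = 0%E.
Proof.
rewrite /Lpnorm -(@Lnorm0 _ _ _ mu p) ?gt_eqF ?(lt_le_trans _ p1)//.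
by apply: eq_Lnorm => x; congr EFin; exact: Normc.normc0.
Qed.

Lemma LpnormD f g : complex_measurable f -> complex_measurable g ->
  (Lpnorm (f + g)%R <= Lpnorm f + Lpnorm g)%E.
Proof.
move=> mf mg.
apply: (@le_trans _ _ ('N[mu]_p[EFin \o ((cabs \o f) \+ (cabs \o g))%R])%E).
  have mh : complex_measurable (fun x => (cabs (f x) + cabs (g x))%:C%C).
    split => /=; last exact: measurable_cst.
    by apply: measurable_funD; exact: measurable_cabs.
  have habs x : cabs (cabs (f x) + cabs (g x))%:C%C = cabs (f x) + cabs (g x).
    by rewrite /= expr0n/= addr0 sqrtr_sqr ger0_norm// addr_ge0 ?cabs_ge0.
  apply: (le_trans (le_Lpnorm (complex_measurableD mf mg) mh _)).
    by apply: nearW => x; rewrite habs; exact: cabsD.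
  rewrite le_eqVlt; apply/orP; left; apply/eqP; rewrite /Lpnorm.
  apply: eq_Lnorm => x.
  by rewrite [RHS]/= -habs.
by apply: eminkowski => //; exact: measurable_cabs.
Qed.

Lemma LpnormZ f a : in_Lp f ->
  (Lpnorm (a *: f)%R = (cabs a)%:E * Lpnorm f)%E.
Proof.
move=> [/measurable_cabs mf nf].
have fL : (cabs \o f) \in @Lfun _ T R mu p by rewrite !inE; apply/andP; split; rewrite inE.
transitivity ('N[mu]_p[EFin \o (cabs a \*: (cabs \o f))])%E.
  by apply: eq_Lnorm => x/=; rewrite cabsM.
have := LnormZ (Lfun_Sub p1 fL) (cabs a).
by rewrite ger0_norm ?cabs_ge0.
Qed.

Lemma Lpnorm_eq0 f : complex_measurable f ->
  Lpnorm f = 0%E -> \forall x \ae mu, f x = 0.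
Proof.
move=> /measurable_cabs/measurable_EFinP mf /Lnorm_eq0_eq0.
move=> /(_ mf (lt_le_trans lte01 p1)).
by apply: filterS => x /(_ I)[] /(@Normc.eq0_normc R).
Qed.

Lemma in_Lp_submod_closed :
  submod_closed (fun f : T -> R[i] => `[< in_Lp f >]).
Proof.
split.
  apply/asboolP; split; first exact: complex_measurable_cst.
  by rewrite Lpnorm0.
move=> a f g /asboolP fL /asboolP gL; apply/asboolP.
have mf : complex_measurable (a *: f).
  by apply: complex_measurableM; [exact: complex_measurable_cst|exact: fL.1].
split; first exact: complex_measurableD mf gL.1.
rewrite (le_lt_trans (LpnormD mf gL.1))// lte_add_pinfty//; last exact: gL.2.
rewrite LpnormZ// lte_mul_pinfty// ?lee_fin ?cabs_ge0//; exact: fL.2.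
Qed.

End ComplexLp.

Section LpSpace.
Context d (T : measurableType d) (R : realType).
Variables (mu : {measure set T -> \bar R}) (p : \bar R) (p1 : (1 <= p)%E).

(* The proof of 1 <= p is an argument so that closure under addition can be
   attached to the predicate as a canonical structure. *)
Definition Lp_pred of (1 <= p)%E : {pred (T -> R[i])} :=
  fun f => `[< in_Lp mu p f >].

HB.instance Definition _ := GRing.isSubmodClosed.Build _ _ (Lp_pred p1)
  (in_Lp_submod_closed mu p1).

Record Lp_fun := LpFun {
  Lp_val :> T -> R[i] ;
  Lp_valP : Lp_val \in Lp_pred p1 }.

HB.instance Definition _ := [isSub for Lp_val].
HB.instance Definition _ := [Choice of Lp_fun by <:].
HB.instance Definition _ := [SubChoice_isSubLmodule of Lp_fun by <:].

Definition Lp_null : {pred Lp_fun} :=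
  fun f => `[< \forall x \ae mu, f x = 0 >].

Lemma Lp_null_zmod_closed : zmod_closed Lp_null.
Proof.
split; first by apply/asboolP/nearW.
move=> f g /asboolP f0 /asboolP g0; apply/asboolP.
apply: filterS2 f0 g0 => x /= fx gx.
by rewrite -[LHS]/(f x - g x) fx gx subr0.
Qed.

HB.instance Definition _ := GRing.isZmodClosed.Build _ Lp_null
  Lp_null_zmod_closed.

(* L^p(mu): functions of finite p-norm modulo functions vanishing a.e. It is
   equipped below with its normedModType R[i] structure. *)
Definition Lp_space : Type := Quotient.quot Lp_null.
HB.instance Definition _ := GRing.Zmodule.on Lp_space.
HB.instance Definition _ := EqQuotient.on Lp_space.

Local Open Scope quotient_scope.

Lemma Lp_piP (f g : Lp_fun) :
  \pi_Lp_space f = \pi_Lp_space g <-> \forall x \ae mu, f x = g x.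
Proof.
split=> [/eqmodP/asboolP|fg].
  by apply: filterS => x; rewrite -[LHS]/(f x - g x) => /eqP; rewrite subr_eq0 => /eqP.
apply/eqmodP/asboolP; apply: filterS fg => x fgx.
by rewrite -[LHS]/(f x - g x) fgx subrr.
Qed.

Lemma Lp_repr_pi (f : Lp_fun) :
  \forall x \ae mu, repr (\pi_Lp_space f) x = f x.
Proof. by apply/Lp_piP; rewrite reprK. Qed.

Definition Lp_scale (a : R[i]) (f : Lp_space) : Lp_space :=
  \pi_Lp_space (a *: repr f).

Lemma pi_Lp_scale a (f : Lp_fun) :
  Lp_scale a (\pi_Lp_space f) = \pi_Lp_space (a *: f).
Proof.
apply/Lp_piP; apply: filterS (Lp_repr_pi f) => x fx.
exact: (congr1 ( *%R a) fx).
Qed.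

Lemma pi_LpD (f g : Lp_fun) :
  \pi_Lp_space (f + g) = \pi_Lp_space f + \pi_Lp_space g.
Proof. exact: pi_addr. Qed.

Let Lp_scaleA a b f : Lp_scale a (Lp_scale b f) = Lp_scale (a * b) f.
Proof.
by elim/quotW: f => f; rewrite (pi_Lp_scale b) !pi_Lp_scale scalerA.
Qed.

Let Lp_scale1 : left_id 1 Lp_scale.
Proof. by elim/quotW => f; rewrite pi_Lp_scale scale1r. Qed.

Let Lp_scaleDr : right_distributive Lp_scale +%R.
Proof.
move=> a; elim/quotW => f; elim/quotW => g.
rewrite -pi_LpD !pi_Lp_scale scalerDr.
exact: pi_LpD.
Qed.

Let Lp_scaleDl f : {morph Lp_scale^~ f : a b / a + b}.
Proof.
by elim/quotW: f => f a b; rewrite !pi_Lp_scale scalerDl pi_LpD.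
Qed.

HB.instance Definition _ := GRing.Zmodule_isLmodule.Build R[i] Lp_space
  Lp_scaleA Lp_scale1 Lp_scaleDr Lp_scaleDl.

Lemma Lp_fun_in_Lp (f : Lp_fun) : in_Lp mu p f.
Proof. exact/asboolP/(Lp_valP f). Qed.

Lemma Lpnorm_fine (f : Lp_fun) :
  (fine (Lpnorm mu p f))%:E = Lpnorm mu p f.
Proof.
rewrite fineK// fin_numElt (lt_le_trans ltNy0) ?Lpnorm_ge0//=.
by case: (Lp_fun_in_Lp f).
Qed.

Lemma ae_eq_Lpnorm (f g : T -> R[i]) :
  complex_measurable f -> complex_measurable g ->
  (\forall x \ae mu, f x = g x) -> Lpnorm mu p f = Lpnorm mu p g.
Proof.
by move=> mf mg fg; apply/eqP; rewrite eq_le; apply/andP; split;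
  apply: le_Lpnorm => //; apply: filterS fg => x ->.
Qed.

Definition Lp_norm (f : Lp_space) : R[i] :=
  (fine (Lpnorm mu p (repr f)))%:C%C.

Lemma pi_Lp_norm (f : Lp_fun) :
  Lp_norm (\pi_Lp_space f) = (fine (Lpnorm mu p f))%:C%C.
Proof.
rewrite /Lp_norm; congr (fine _)%:C%C; apply: ae_eq_Lpnorm.
- by case: (Lp_fun_in_Lp (repr (\pi_Lp_space f))).
- by case: (Lp_fun_in_Lp f).
- exact: Lp_repr_pi.
Qed.

Let Lp_normD f g : Lp_norm (f + g) <= Lp_norm f + Lp_norm g.
Proof.
elim/quotW: f => f; elim/quotW: g => g.
rewrite -pi_LpD !pi_Lp_norm -rmorphD/= lecR.
rewrite -lee_fin EFinD (Lpnorm_fine f) (Lpnorm_fine g) (Lpnorm_fine (f + g)).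
exact: (LpnormD mu p1 (Lp_fun_in_Lp f).1 (Lp_fun_in_Lp g).1).
Qed.

Let Lp_normZ a f : Lp_norm (a *: f) = `|a| * Lp_norm f.
Proof.
elim/quotW: f => f; rewrite -[_ *: _]/(Lp_scale _ _) pi_Lp_scale !pi_Lp_norm.
rewrite normC_cabs -rmorphM/=; congr (_)%:C%C; apply: EFin_inj.
rewrite EFinM (Lpnorm_fine f) (Lpnorm_fine (a *: f)).
exact: (LpnormZ p1 a (Lp_fun_in_Lp f)).
Qed.

Let Lp_norm_eq0 f : Lp_norm f = 0 -> f = 0.
Proof.
elim/quotW: f => f; rewrite pi_Lp_norm => -[] f0.
have mf : complex_measurable f by case: (Lp_fun_in_Lp f).
rewrite -[RHS]pi_zeror; apply/Lp_piP; apply: (Lpnorm_eq0 p1 mf).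
by rewrite -Lpnorm_fine f0.
Qed.

HB.instance Definition _ := @Lmodule_isNormed.Build R[i] Lp_space
  Lp_norm Lp_normD Lp_normZ Lp_norm_eq0.

(* The class of f in L^p(mu), and the junk value 0 when f is not in L^p(mu). *)
Definition Lp_class (f : T -> R[i]) : Lp_space :=
  \pi_Lp_space (insubd (0 : Lp_fun) f).

Definition Lp_repr (f : Lp_space) : T -> R[i] := Lp_val (repr f).

End LpSpace.

Section HyperinvariantSubspace.
Context (K : numFieldType) (X : normedModType K).

Definition bounded_operator (S : X -> X) : Prop :=
  linear S /\ exists c : K, forall x, `|S x| <= c * `|x|.

Definition closed_subspace (M : set X) : Prop :=
  [/\ closed M, M 0 & forall (a : K) x y, M x -> M y -> M (a *: x + y)].

Definition nontrivial_hyperinvariant_subspace (T : X -> X) (M : set X) : Prop :=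
  [/\ closed_subspace M, M <> [set 0], M <> setT &
      forall S, bounded_operator S -> S \o T = T \o S -> S @` M `<=` M].

End HyperinvariantSubspace.

Section WeightedComposition.
Context d (T : measurableType d) (R : realType).
Variable mu : {measure set T -> \bar R}.

Definition measure_preserving (tau : T -> T) : Prop :=
  measurable_fun setT tau /\
  forall A, measurable A -> mu (tau @^-1` A) = mu A.

Definition ergodic (tau : T -> T) : Prop :=
  measure_preserving tau /\
  forall A, measurable A -> tau @^-1` A = A -> mu A = 0 \/ mu (~` A) = 0.

Variables (p : \bar R) (p1 : (1 <= p)%E).

(* f |-> v (f \o tau). For v in L^oo and tau measure preserving, the function is
   in L^p, the junk value of [Lp_class] is never taken and the operator is
   bounded: see [weighted_compositionE] and [weighted_composition_bounded]. *)
Definition weighted_composition (v : T -> R[i]) (tau : T -> T)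
    (f : Lp_space mu p1) : Lp_space mu p1 :=
  Lp_class mu p1 (fun x => v x * Lp_repr f (tau x)).

Local Open Scope quotient_scope.

Lemma Lp_repr_in_Lp (f : Lp_space mu p1) : in_Lp mu p (Lp_repr f).
Proof. exact: (Lp_fun_in_Lp (repr f)). Qed.

Lemma Lp_classE (f : T -> R[i]) : in_Lp mu p f ->
  \forall x \ae mu, Lp_repr (Lp_class mu p1 f) x = f x.
Proof.
move=> fL; rewrite /Lp_repr /Lp_class.
apply: filterS (Lp_repr_pi (insubd (0 : Lp_fun mu p1) f)) => x ->.
have fP : f \in Lp_pred mu p1 by apply/asboolP.
by rewrite -[LHS]/(val (insubd (0 : Lp_fun mu p1) f) x) insubdK.
Qed.

Lemma Lp_eqP (f g : Lp_space mu p1) :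
  f = g <-> \forall x \ae mu, Lp_repr f x = Lp_repr g x.
Proof. by rewrite -[f in f = g]reprK -[g in _ = g]reprK; exact: Lp_piP. Qed.

Lemma Lp_normE (f : Lp_space mu p1) :
  `|f| = (fine (Lpnorm mu p (Lp_repr f)))%:C%C.
Proof. by []. Qed.

Lemma Lp_reprZD a (f g : Lp_space mu p1) : \forall x \ae mu,
  Lp_repr (a *: f + g) x = a * Lp_repr f x + Lp_repr g x.
Proof.
have -> : a *: f + g = \pi_(Lp_space mu p1) (a *: repr f + repr g).
  rewrite pi_LpD -pi_Lp_scale !reprK; congr (_ + _).
by apply: filterS (Lp_repr_pi (a *: repr f + repr g)) => x; exact.
Qed.

Lemma ae_preserving tau (P : T -> Prop) : measure_preserving tau ->
  (\forall x \ae mu, P x) -> \forall x \ae mu, P (tau x).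
Proof.
move=> [mtau tauP] [N [mN N0 PN]]; exists (tau @^-1` N); split.
- by rewrite -[X in measurable X]setTI; exact: mtau.
- by rewrite tauP.
- by move=> x /= Px; exact: PN.
Qed.

Lemma Linfty_ae v : in_Lp mu +oo v ->
  \forall x \ae mu, cabs (v x) <= fine (Lpnorm mu +oo v).
Proof.
move=> [mv]; rewrite /Lpnorm unlock /=; case: ifPn => [mu0|mu0 _].
  set s := (ess_sup _ _) => sy.
  have s0 : (0 <= s)%E.
    apply: ess_sup_gee => //; apply: nearW => x /=.
    by rewrite lee_fin normr_ge0.
  have : \forall x \ae mu, ((abse \o (EFin \o (@cabs R \o v))) x <= s)%E.
    exact: ess_sup_ge.
  apply: filterS => x /=; rewrite ger0_norm ?cabs_ge0// => /le_trans h.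
  by rewrite -lee_fin fineK ?h// ge0_fin_numE.
exists setT; split => //; apply/eqP; rewrite eq_le measure_ge0 andbT.
by rewrite leNgt.
Qed.

Lemma complex_measurable_comp (f : T -> R[i]) (tau : T -> T) : measurable_fun setT tau ->
  complex_measurable f -> complex_measurable (f \o tau).
Proof.
by move=> mtau [fR fI]; split;
  [exact: (measurableT_comp fR mtau)|exact: (measurableT_comp fI mtau)].
Qed.

Lemma Lpnorm_comp f tau : measure_preserving tau -> complex_measurable f ->
  (Lpnorm mu p (f \o tau) <= Lpnorm mu p f)%E.
Proof.
move=> mp mf; have [mtau tauP] := mp.
rewrite /Lpnorm unlock; move: p1; case: p => [r|_|//].
  rewrite lee_fin => r1; rewrite le_eqVlt; apply/orP; left; apply/eqP.
  congr (_ `^ _)%E.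
  pose g x := (`|(cabs (f x))%:E| `^ r)%E.
  have mg : measurable_fun setT g.
    rewrite /g; under eq_fun do rewrite /=.
    apply/measurable_EFinP/(measurableT_comp (measurable_powR _)) => //.
    exact/measurableT_comp/measurable_cabs.
  transitivity (\int[pushforward mu tau]_y g y)%E.
    rewrite ge0_integral_pushforward//; last by move=> y _; exact: poweR_ge0.
  apply: eq_measure_integral => A mA _; exact: tauP.
case: ifPn => // mu0; apply/ess_supP.
apply: (ae_preserving (P := fun x => (abse \o (EFin \o (@cabs R \o f))) x <= _)%E) => //.
exact: ess_sup_ge.
Qed.

Section bounded.
Variables (v : T -> R[i]) (tau : T -> T).
Hypotheses (vL : in_Lp mu +oo v) (tauP : measure_preserving tau).
Let c := fine (Lpnorm mu +oo v).

Let c_ge0 : 0 <= c.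
Proof. by rewrite fine_ge0// Lpnorm_ge0. Qed.

Lemma weighted_composition_le f : in_Lp mu p f ->
  (Lpnorm mu p (fun x => v x * f (tau x))%R <= c%:E * Lpnorm mu p f)%E.
Proof.
move=> fL.
have mc : complex_measurable (c%:C%C *: f : T -> R[i]).
  by apply: complex_measurableM; [exact: complex_measurable_cst|exact: fL.1].
have mft := complex_measurable_comp tauP.1 fL.1.
have cE : cabs (c%:C%C) = c.
  by rewrite /= expr0n/= addr0 sqrtr_sqr ger0_norm.
apply: (@le_trans _ _ (Lpnorm mu p ((c%:C%C *: f : T -> R[i]) \o tau))).
  apply: le_Lpnorm => //.
  - by apply: complex_measurableM => //; exact: vL.1.
  - exact: complex_measurable_comp tauP.1 mc.
  - apply: filterS (Linfty_ae vL) => x vx.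
    rewrite -[((_ \o _) x)]/(c%:C%C * f (tau x)) !cabsM cE.
    by rewrite ler_wpM2r// cabs_ge0.
rewrite (le_trans (Lpnorm_comp tauP mc))//.
by rewrite (LpnormZ p1 c%:C%C fL) cE.
Qed.

Lemma weighted_composition_in_Lp f : in_Lp mu p f ->
  in_Lp mu p (fun x => v x * f (tau x)).
Proof.
move=> fL; split.
  apply: complex_measurableM; first exact: vL.1.
  exact: complex_measurable_comp tauP.1 fL.1.
rewrite (le_lt_trans (weighted_composition_le fL))//.
by rewrite lte_mul_pinfty// ?lee_fin//; exact: fL.2.
Qed.

Lemma weighted_compositionE f : \forall x \ae mu,
  Lp_repr (weighted_composition v tau f) x = v x * Lp_repr f (tau x).
Proof. by apply/Lp_classE/weighted_composition_in_Lp/Lp_repr_in_Lp. Qed.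

Lemma weighted_composition_bounded :
  bounded_operator (weighted_composition v tau).
Proof.
split=> [a f g|].
  apply/Lp_eqP.
  near=> x.
  have -> : Lp_repr (weighted_composition v tau (a *: f + g)) x =
            v x * Lp_repr (a *: f + g) (tau x).
    by near: x; exact: weighted_compositionE.
  have -> : Lp_repr (a *: f + g) (tau x) =
            a * Lp_repr f (tau x) + Lp_repr g (tau x).
    by near: x; exact: ae_preserving tauP (Lp_reprZD a f g).
  have -> : Lp_repr (a *: weighted_composition v tau f +
                     weighted_composition v tau g) x =
     a * Lp_repr (weighted_composition v tau f) x +
     Lp_repr (weighted_composition v tau g) x.
    by near: x; exact: Lp_reprZD.
  have -> : Lp_repr (weighted_composition v tau f) x = v x * Lp_repr f (tau x).
    by near: x; exact: weighted_compositionE.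
  have -> : Lp_repr (weighted_composition v tau g) x = v x * Lp_repr g (tau x).
    by near: x; exact: weighted_compositionE.
  by rewrite mulrDr mulrCA.
exists c%:C%C => f; rewrite !Lp_normE -rmorphM/= lecR -lee_fin EFinM.
have fin (h : Lp_space mu p1) : (fine (Lpnorm mu p (Lp_repr h)))%:E =
    Lpnorm mu p (Lp_repr h).
  exact: (Lpnorm_fine (repr h)).
rewrite !fin (le_trans _ (weighted_composition_le (Lp_repr_in_Lp f)))//.
apply: le_Lpnorm => //.
- by case: (Lp_repr_in_Lp (weighted_composition v tau f)).
- by case: (weighted_composition_in_Lp (Lp_repr_in_Lp f)).
- by apply: filterS (weighted_compositionE f) => x ->.
Unshelve. all: by end_near. Qed.

End bounded.
End WeightedComposition.

Section GeneralizedPolynomial.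
Context (R : realType).

(* w is the real value of t ^ s (s > 0). When t < 0 this value exists only for
   some exponents, namely the s = m / n with n odd, for which it is the real
   n-th root of t ^ m. *)
Definition real_power (t s w : R) : Prop :=
  (0 <= t /\ w = t `^ s) \/
  (t < 0 /\ exists m n : nat,
     [/\ odd n, s = m%:R / n%:R & w ^+ n = t ^+ m]).

(* Requiring [real_power] of every factor is what forces the absolute value to
   be used where it is needed. *)
Definition generalized_polynomial (u : unit_interval R -> R[i]) : Prop :=
  exists (l : nat) (s : 'I_l.+1 -> R) (C : R[i])
    (y : 'I_l.+1 -> unit_interval R) (sigma : 'I_l.+1 -> R -> R),
  [/\ forall j, 0 < s j, C != 0,
      forall j, sigma j = id \/ sigma j = Num.norm &
      forall t, exists w : 'I_l.+1 -> R,
        (forall j, real_power (sigma j (I01val t - I01val (y j))) (s j) (w j)) /\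
        u t = C * \prod_(j < l.+1) (w j)%:C%C].

End GeneralizedPolynomial.

Section Discrepancy.
Context (R : realType).

Definition count_in (N : nat) (E : set R) (w : nat -> R) : nat :=
  (\sum_(1 <= n < N.+1) (w n \in E))%N.

Definition seq_discrepancy (N : nat) (w : nat -> R) : R :=
  sup [set r | exists a b : R, [/\ 0 <= a, a < b, b <= 1 &
    r = `|(count_in N `[a, b[ w)%:R / N%:R - (b - a)|]].

Definition discrepancy (tau : unit_interval R -> unit_interval R) (N : nat) : R :=
  sup [set seq_discrepancy N (fun n => I01val (iter n tau y)) |
       y in [set y | I01val y < 1]].
End Discrepancy.

(* Main.v *)
Require Import Defs.
From mathcomp Require Import all_boot all_order all_algebra.
From mathcomp Require Import all_classical all_reals all_analysis.
From mathcomp Require Import measurable_realfun ess_sup_inf complex.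
From mathcomp Require Import zify ring lra.

Import Order.TTheory GRing.Theory Num.Theory.
Import numFieldNormedType.Exports.
Local Open Scope classical_set_scope.
Local Open Scope ring_scope.

(** Write v_n for the product of v o tau^k over k < n and
    kappa = exp (mean of ln |v|).

    Growth.  Up to a constant, ln |v| is a combination of functions
    ln |x_i - y|, so ln |v_n / kappa^n| at tau x is a sum of errors in the
    approximation of integrals of logarithms by averages over coordinate
    orbits.  As long as the orbit keeps a distance delta_n from the
    singularities, this error is bounded in terms of the discrepancy D_n
    ([koksma_log], [log_birkhoff]): it is at most r_n = O(n D_n |ln delta_n| + 1).
    With delta_n of order n^-3, the sets of points for which the bound fails
    have summable measure, and the hypothesis on D_n turns into
    r_n = o(n / ln^2 n) ([radius_cvg]).

    Non-quasianalyticity.  The condition r_n = o(n / ln^2 n) leaves room for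
    two sequences a, b on the integers with a_0 = b_0 = 1, with a * b = 0, and
    with a_n exp(r_|n|) and b_n exp(r_|n|) summable ([annihilating_pair],
    [cvgn_decay_expR]).  They play the role of the Fourier coefficients of two
    bump functions with disjoint supports.

    Orbits.  If T does not have dense range, the closure of its range is
    hyperinvariant ([hyperinvariant_closure_range]).  If it has, every bounded
    measurable function is of the form G o tau almost everywhere ([comp_surj]).
    Hence, for a set E of positive measure on which all the v_n / kappa^n are
    controlled, in the past as well as in the future, the indicator function of
    E lies on a two-sided orbit T x_n = kappa x_(n+1) with
    |x_n| <= exp(r_|n|), and dually there are functionals with
    y_n o T = kappa y_(n+1) and |y_n| <= 2 exp(r_|n|).

    Conclusion.  If S commutes with T, then y_m (S x_n) depends on n + m only,
    so that the sum of a_n b_m y_m (S x_n) over all n and m is a pairing with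
    a * b and vanishes.  Therefore w = sum of a_n x_n belongs to the closed
    subspace M of the h such that the sum of b_m y_m (S h) is 0 for all S
    commuting with T, and M is hyperinvariant ([hyperinvariant_of_orbits]).
    Coordinate orbits are aperiodic, since they are uniformly distributed, so E
    may be chosen disjoint from tau^-n E for 0 < n <= N_0.  Then y_0 x_n
    vanishes for 0 < |n| <= N_0, and the terms with n = 0 dominate the sums of
    a_n y_0 x_n and of b_n y_0 x_n, which gives w <> 0 and shows that x_0 is not
    in M ([hyperinvariant_of_returning_orbits]). *)

Set Implicit Arguments.
Unset Strict Implicit.
Unset Printing Implicit Defensive.

(** * The modulus of a complex number and the real norm *)

Section ComplexAbs.
Context {R : realType}.
Implicit Types z w : R[i].

Lemma cabs0 : cabs (0 : R[i]) = 0. Proof. exact: Normc.normc0. Qed.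

Lemma cabs1 : cabs (1 : R[i]) = 1. Proof. exact: Normc.normc1. Qed.

Lemma cabs_real (x : R) : cabs (x%:C)%C = `|x|.
Proof. by rewrite /cabs /= expr0n /= addr0 sqrtr_sqr. Qed.

Lemma cabsN z : cabs (- z) = cabs z. Proof. by case: z => x y; rewrite /cabs /= !sqrrN. Qed.

Lemma cabsV z : cabs z^-1 = (cabs z)^-1.
Proof.
have [->|z0] := eqVneq z 0; first by rewrite invr0 cabs0 invr0.
have zz0 : cabs z != 0 by apply: contra z0 => /eqP/(@Normc.eq0_normc R) ->.
by apply: (mulfI zz0); rewrite -cabsM !divff // cabs1.
Qed.

Lemma cabsX z n : cabs (z ^+ n) = cabs z ^+ n.
Proof. by elim: n => [|n IH]; rewrite ?expr0 ?cabs1// !exprS cabsM IH. Qed.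

Lemma cabs_eq0 z : (cabs z == 0) = (z == 0).
Proof.
by apply/eqP/eqP => [/(@Normc.eq0_normc R)//|->]; rewrite cabs0.
Qed.

Lemma cabs_gt0 z : (0 < cabs z) = (z != 0).
Proof. by rewrite lt_neqAle cabs_ge0 andbT eq_sym cabs_eq0. Qed.

Lemma cabs_sum I (r : seq I) (P : pred I) (F : I -> R[i]) :
  cabs (\sum_(i <- r | P i) F i) <= \sum_(i <- r | P i) cabs (F i).
Proof.
apply: (big_ind2 (fun z x => cabs z <= x)) => // [|z x w y zx wy].
  by rewrite cabs0.
exact: le_trans (cabsD z w) (lerD zx wy).
Qed.

Lemma cabs_prod I (r : seq I) (P : pred I) (F : I -> R[i]) :
  cabs (\prod_(i <- r | P i) F i) = \prod_(i <- r | P i) cabs (F i).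
Proof. by rewrite (big_morph _ (@cabsM R) cabs1). Qed.

Lemma cabsB_ge z w : cabs z - cabs w <= cabs (z + w).
Proof.
rewrite lerBlDr -{1}[z](addrK w); apply: le_trans (cabsD _ _) _.
by rewrite cabsN.
Qed.

Lemma cabs_Re z : `|complex.Re z| <= cabs z.
Proof.
case: z => x y; rewrite /cabs /= -sqrtr_sqr ler_wsqrtr// lerDl; exact: sqr_ge0.
Qed.

Lemma cabs_Im z : `|complex.Im z| <= cabs z.
Proof.
case: z => x y; rewrite /cabs /= -sqrtr_sqr ler_wsqrtr// lerDr; exact: sqr_ge0.
Qed.

Lemma cabs_le_ReIm z : cabs z <= `|complex.Re z| + `|complex.Im z|.
Proof.
case: z => x y; rewrite /cabs /= -(ger0_norm (addr_ge0 (normr_ge0 x) (normr_ge0 y))).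
rewrite -sqrtr_sqr ler_wsqrtr// sqrrD !real_normK ?num_real// lerD2r lerDl.
by rewrite mulrn_wge0// mulr_ge0.
Qed.

End ComplexAbs.

Arguments cabs : simpl never.

Section RealNorm.
Context {R : realType} {X : normedModType R[i]}.
Implicit Types x y : X.

(** The norm of a normed module over R[i] takes its values in R[i]; this is the
    same number as an element of R. *)
Definition rnorm x : R := complex.Re `|x|.

Lemma normE x : `|x| = (rnorm x)%:C%C.
Proof.
rewrite /rnorm (@RRe_real R `|x|)//; apply: ger0_real; exact: normr_ge0.
Qed.

Lemma rnorm_ge0 x : 0 <= rnorm x.
Proof. by rewrite -lecR -normE; exact: normr_ge0. Qed.

Lemma rnormD x y : rnorm (x + y) <= rnorm x + rnorm y.
Proof. by rewrite -lecR rmorphD /= -!normE ler_normD. Qed.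

Lemma rnormN x : rnorm (- x) = rnorm x.
Proof. by rewrite /rnorm normrN. Qed.

Lemma rnormZ (a : R[i]) x : rnorm (a *: x) = cabs a * rnorm x.
Proof.
by have /eqP := normrZ a x; rewrite !normE normC_cabs -rmorphM => /eqP[].
Qed.

Lemma rnorm0 : rnorm 0 = 0. Proof. by rewrite /rnorm normr0. Qed.

Lemma bounded_rnorm (S : X -> X) : bounded_operator S ->
  exists2 c : R, 0 <= c & forall x, rnorm (S x) <= c * rnorm x.
Proof.
move=> [_ [c cP]]; exists (cabs c) => [|x]; first exact: cabs_ge0.
have := cP x; rewrite !normE.
case: c {cP} => c1 c2; rewrite lecE /= => /andP[_].
rewrite mulr0 subr0 => /le_trans; apply.
apply: ler_wpM2r; first exact: rnorm_ge0.
by apply: le_trans (cabs_Re (c1 +i* c2)%C); rewrite ler_norm.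
Qed.

Lemma closed_rnorm (A : set X) :
  (forall x, (forall e : R, 0 < e -> exists2 y, A y & rnorm (x - y) < e) -> A x) ->
  closed A.
Proof.
move=> AP x clx; apply: AP => e e0.
have [|y [Ay]] := clx (ball x e%:C%C); first by apply: nbhsx_ballx; rewrite (ltcR 0 e).
rewrite -ball_normE /= normE ltcR => xy; by exists y.
Qed.

End RealNorm.

Lemma cvg_sumr {T : Type} (F : set_system T) {FF : Filter F}
    (V : numFieldType) I (r : seq I) (P : pred I) (f : I -> T -> V) (l : I -> V) :
  (forall i, f i t @[t --> F] --> l i) ->
  \sum_(i <- r | P i) f i t @[t --> F] --> \sum_(i <- r | P i) l i.
Proof.
move=> fl; elim: r => [|i r IH].
  by rewrite big_nil; under eq_fun do rewrite big_nil; exact: cvg_cst.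
rewrite big_cons; under eq_fun do rewrite big_cons.
case: (P i) => //; apply: cvgD => //; exact: fl.
Qed.

(** * Sums over boxes of integers *)

Section IntBox.

Definition zbox (N : nat) : seq int :=
  [seq i%:Z - N%:Z | i <- iota 0 N.*2.+1].

Lemma mem_zbox N n : (n \in zbox N) = (`|n| <= N)%N.
Proof.
apply/mapP/idP => [[i iN ->] | nN].
  by move: iN; rewrite mem_iota; lia.
exists (absz (n + N%:Z)); last by lia.
by rewrite mem_iota; lia.
Qed.

Lemma zbox_uniq N : uniq (zbox N).
Proof. by rewrite map_inj_uniq ?iota_uniq// => i j /addIr; case. Qed.

Lemma zbox_restrict (V : nmodType) (F : int -> V) N N' : (N <= N')%N ->
  \sum_(n <- zbox N) F n = \sum_(n <- zbox N' | (`|n| <= N)%N) F n.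
Proof.
move=> NN'; rewrite -[RHS]big_filter; apply: perm_big; apply: uniq_perm.
- exact: zbox_uniq.
- by rewrite filter_uniq// zbox_uniq.
by move=> n; rewrite mem_filter !mem_zbox; lia.
Qed.

Lemma zbox_split (V : nmodType) (F : int -> V) N N' : (N <= N')%N ->
  \sum_(n <- zbox N') F n =
  \sum_(n <- zbox N) F n + \sum_(n <- zbox N' | ~~ (`|n| <= N)%N) F n.
Proof. by move=> NN'; rewrite (zbox_restrict F NN') [LHS](bigID (fun n => (`|n| <= N)%N)). Qed.

Lemma zbox0 (V : nmodType) (F : int -> V) : \sum_(n <- zbox 0) F n = F 0.
Proof. by rewrite /zbox /= big_seq1 subrr. Qed.

Lemma ler_zbox (R : numDomainType) (F : int -> R) N N' : (N <= N')%N ->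
  (forall n, 0 <= F n) -> \sum_(n <- zbox N) F n <= \sum_(n <- zbox N') F n.
Proof. by move=> NN' F0; rewrite (zbox_split F NN') lerDl sumr_ge0. Qed.

End IntBox.

Section Annihilation.
Context {R : realType} (a b c : int -> R[i]) (al : nat -> R).
(** The convolution is handled through its finite sections, which avoids double
    series. *)
Definition box_conv (a b : int -> R[i]) (N : nat) (k : int) : R[i] :=
  \sum_(n <- zbox N) \sum_(m <- zbox N | n + m == k) a n * b m.

Hypothesis al_ge0 : forall n, 0 <= al n.
Variable K : R.
Hypothesis abc : forall n m, cabs (a n * b m * c (n + m)) <= K * (al `|n|%N * al `|m|%N).
Hypothesis al_cvg : cvgn (fun N => \sum_(n <- zbox N) al `|n|%N).
Hypothesis ab0 : forall k, (fun N => cabs (box_conv a b N k)) @ \oo --> (0 : R).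

Let A N := \sum_(n <- zbox N) al `|n|%N.

Let sumK N N' : (N <= N')%N ->
  \sum_(n <- zbox N') \sum_(m <- zbox N')
     (if (`|n| <= N)%N && (`|m| <= N)%N then 0 else K * (al `|n|%N * al `|m|%N))
  = K * (A N' ^+ 2 - A N ^+ 2).
Proof.
move=> NN'.
transitivity (\sum_(n <- zbox N') \sum_(m <- zbox N') K * (al `|n|%N * al `|m|%N)
   - \sum_(n <- zbox N) \sum_(m <- zbox N) K * (al `|n|%N * al `|m|%N)).
  apply/esym/eqP; rewrite subr_eq eq_sym addrC; apply/eqP.
  rewrite (zbox_restrict _ NN') [X in X + _]big_mkcond -big_split /=.
  apply: eq_bigr => n _.
  case: ifPn => nN /=.
    rewrite (zbox_restrict _ NN') [X in X + _]big_mkcond -big_split /=.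
    by apply: eq_bigr => m _; case: ifPn => _; rewrite ?addr0 ?add0r.
  by rewrite add0r.
have sq M : \sum_(n <- zbox M) \sum_(m <- zbox M) K * (al `|n|%N * al `|m|%N) = K * A M ^+ 2.
  rewrite expr2 {1}/A mulr_suml mulr_sumr; apply: eq_bigr => n _.
  by rewrite /A !mulr_sumr.
by rewrite !sq mulrBr.
Qed.

(** The square |n|, |m| <= N is compared with a larger square N', on which the
    sum over |n + m| <= 2 N is a finite combination of the convolutions at k, and
    so tends to 0 with N'.  The two sums differ by at most a tail of the
    convergent product series. *)
Lemma box_annihilation :
  (fun N => cabs (\sum_(n <- zbox N) \sum_(m <- zbox N) a n * b m * c (n + m))) @ \oo --> (0 : R).
Proof.
pose l := limn A.
have Al : A @ \oo --> l by exact: al_cvg.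
have Amono : {homo A : x y / (x <= y)%N >-> x <= y}.
  by move=> x y xy; apply: ler_zbox.
have Ale N : A N <= l by apply: nondecreasing_cvgn_le; [exact: Amono|exact: al_cvg].
have A0 N : 0 <= A N by apply: sumr_ge0.
have bound N : cabs (\sum_(n <- zbox N) \sum_(m <- zbox N) a n * b m * c (n + m))
    <= K * (l ^+ 2 - A N ^+ 2).
  apply/ler_addgt0Pr => e e0.
  have : (fun N' => \sum_(k <- zbox (N + N)) cabs (c k) * cabs (box_conv a b N' k)) @ \oo --> (0 : R).
    rewrite [X in _ --> X](_ : 0 = \sum_(k <- zbox (N + N)) cabs (c k) * 0).
      by apply: cvg_sumr => k; apply: cvgM; [exact: cvg_cst | exact: ab0].
    by rewrite big1// => k _; rewrite mulr0.
  move=> /cvgrPdist_lt /(_ _ e0) [N1 _ /(_ (maxn N N1))].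
  rewrite /= leq_maxr sub0r normrN => /(_ isT) /ltW.
  rewrite ger0_norm; last by apply: sumr_ge0 => k _; rewrite mulr_ge0 ?cabs_ge0.
  set N' := maxn N N1 => small.
  have NN' : (N <= N')%N by rewrite leq_maxl.
  pose G := \sum_(k <- zbox (N + N)) c k * box_conv a b N' k.
  have GE : G = \sum_(n <- zbox N') \sum_(m <- zbox N' | (absz (n + m)%R <= N + N)%N) a n * b m * c (n + m).
    rewrite /G /box_conv.
    under eq_bigr do rewrite mulr_sumr.
    rewrite exchange_big /=; apply: eq_bigr => n _.
    under eq_bigr do rewrite mulr_sumr.
    rewrite (exchange_big_dep xpredT) //= [RHS]big_mkcond /=; apply: eq_bigr => m _.
    rewrite -big_filter; case: ifPn => nm.
      rewrite (_ : [seq _ <- _ | _] = [:: n + m]) ?big_seq1 1?mulrC//.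
      apply: perm_small_eq => //; apply: uniq_perm => //.
        by rewrite filter_uniq// zbox_uniq.
      move=> k; rewrite mem_filter mem_zbox mem_seq1 -[X in X && _]/(n + m == k).
      by rewrite eq_sym; have [->|//] := eqVneq k (n + m); rewrite nm.
    rewrite big_filter big1_seq// => k /andP[/eqP <-]; rewrite mem_zbox.
    by rewrite (negbTE nm).
  have GF : cabs (\sum_(n <- zbox N) \sum_(m <- zbox N) a n * b m * c (n + m) - G)
      <= K * (A N' ^+ 2 - A N ^+ 2).
    rewrite -(sumK NN') GE.
    rewrite (zbox_restrict _ NN') [X in X - _]big_mkcond -sumrB.
    apply: le_trans (cabs_sum _ _ _) _; apply: ler_sum => n _.
    rewrite [X in _ - X]big_mkcond /=.
    have -> : (if (`|n| <= N)%N then \sum_(m <- zbox N) a n * b m * c (n + m) else 0)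
       = \sum_(m <- zbox N') (if (`|n| <= N)%N && (`|m| <= N)%N then a n * b m * c (n + m) else 0).
      case: ifPn => nN /=; last by rewrite big1.
      by rewrite (zbox_restrict _ NN') [LHS]big_mkcond.
    rewrite -sumrB; apply: le_trans (cabs_sum _ _ _) _; apply: ler_sum => m _.
    case: ifPn => [/andP[nN mN]|_].
      rewrite ifT ?subrr ?cabs0//; lia.
    rewrite sub0r cabsN; case: ifPn => _; first exact: abc.
    by rewrite cabs0 (le_trans _ (abc n m))// cabs_ge0.
  have Gs : cabs G <= e.
    apply: le_trans (cabs_sum _ _ _) _; under eq_bigr do rewrite cabsM; exact: small.
  have -> : \sum_(n <- zbox N) \sum_(m <- zbox N) a n * b m * c (n + m) =
    (\sum_(n <- zbox N) \sum_(m <- zbox N) a n * b m * c (n + m) - G) + G by rewrite subrK.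
  apply: le_trans (cabsD _ _) _; apply: lerD => //.
  apply: le_trans GF _.
  have [K0|K0] := leP 0 K.
    by rewrite ler_wpM2l// lerD2r ler_sqr ?nnegrE// (le_trans (A0 0%N)).
  have al0 n : al n = 0.
    have := le_trans (cabs_ge0 _) (abc n%:Z n%:Z); rewrite /= nmulr_rge0// => h.
    apply/eqP; rewrite -sqrf_eq0 expr2 eq_le h /=.
    by rewrite mulr_ge0.
  have Az M : A M = 0 by rewrite /A big1.
  have -> : l = 0 by rewrite /l (_ : A = (fun=> 0)) ?lim_cst//; apply/funext.
  by rewrite !Az.
apply: (@squeeze_cvgr _ _ _ _ (fun=> 0) (fun N => K * (l ^+ 2 - A N ^+ 2))).
- by apply: nearW => N; rewrite cabs_ge0 bound.
- exact: cvg_cst.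
- rewrite -[X in _ --> X](mulr0 K) -[X in _ * X](subrr (l ^+ 2)).
  apply: cvgM; first exact: cvg_cst.
  apply: cvgB; first exact: cvg_cst.
  by rewrite expr2; under eq_fun do rewrite expr2; apply: cvgM.
Qed.

End Annihilation.

(** * From two-sided orbits to hyperinvariant subspaces *)

Lemma linear_at0 (R : nzRingType) (U V : lmodType R) (S : U -> V) :
  linear S -> S 0 = 0.
Proof.
move=> Slin; have := Slin (-1) 0 0.
by rewrite scaler0 addr0 scaleN1r addNr.
Qed.

Lemma linear_scale (R : nzRingType) (U V : lmodType R) (S : U -> V) c x :
  linear S -> S (c *: x) = c *: S x.
Proof. by move=> Slin; have := Slin c x 0; rewrite (linear_at0 Slin) !addr0. Qed.

Lemma linear_sum (R : nzRingType) (U V : lmodType R) (S : U -> V) I (r : seq I)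
    (a : I -> R) (x : I -> U) : linear S ->
  S (\sum_(i <- r) a i *: x i) = \sum_(i <- r) a i *: S (x i).
Proof.
move=> Slin; elim: r => [|i r IH]; last by rewrite !big_cons Slin IH.
by rewrite !big_nil (linear_at0 Slin).
Qed.

(** A shift of the orbit can be moved to the functionals through S, because S
    commutes with T. *)
Lemma orbit_pairing (R : realType) (X : normedModType R[i])
    (T : X -> X) (kappa : R[i]) (x : int -> X) (y : int -> X -> R[i]) (S : X -> X) :
  kappa != 0 -> (forall m, linear (y m : X -> R[i]^o)) ->
  (forall n, T (x n) = kappa *: x (n + 1)) ->
  (forall m h, y m (T h) = kappa * y (m + 1) h) ->
  linear S -> S \o T = T \o S ->
  forall m n, y m (S (x n)) = y 0 (S (x (n + m))).
Proof.
move=> kappa0 ylin Tx yT Slin ST.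
have step m n : y m (S (x (n + 1))) = y (m + 1) (S (x n)).
  apply: (mulfI kappa0); rewrite -yT -[T (S _)]/((T \o S) _) -ST /= Tx.
  by rewrite (linear_scale _ _ Slin) (linear_scale _ _ (ylin m)).
have pos k n : y k%:Z (S (x n)) = y 0 (S (x (n + k%:Z))).
  elim: k n => [|k IH] n; first by rewrite addr0.
  by rewrite -addn1 PoszD -step IH; congr (y _ (S (x _))); ring.
have neg k n : y (- k%:Z) (S (x n)) = y 0 (S (x (n - k%:Z))).
  elim: k n => [|k IH] n; first by rewrite subr0.
  rewrite -{1}[n](subrK 1) step.
  rewrite (_ : - k.+1%:Z + 1 = - k%:Z); last by rewrite -addn1 PoszD; ring.
  by rewrite IH; congr (y _ (S (x _))); rewrite -addn1 PoszD; ring.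
by case=> k n; [exact: pos|rewrite NegzE; exact: neg].
Qed.

(** The subspace consists of the h for which the pairing of S h with the series
    of b_m y_m vanishes, for all S in the commutant.  It contains w by
    [box_annihilation] applied to c_k = y_0 (S x_k); the hypotheses on w and on u
    say that it is a nonzero proper subspace. *)
Lemma hyperinvariant_of_orbits (R : realType) (X : normedModType R[i])
    (T : X -> X) (kappa : R[i]) (x : int -> X) (y : int -> X -> R[i])
    (a b : int -> R[i]) (rho al : nat -> R) (K : R) (w u : X) :
  kappa != 0 ->
  (forall m, linear (y m : X -> R[i]^o)) ->
  (forall n, T (x n) = kappa *: x (n + 1)) ->
  (forall m h, y m (T h) = kappa * y (m + 1) h) ->
  (forall n, rnorm (x n) <= rho `|n|%N) ->
  (forall m h, cabs (y m h) <= K * rho `|m|%N * rnorm h) ->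
  0 <= K -> (forall n, 0 <= rho n) -> (forall n, 0 <= al n) ->
  (forall n, cabs (a n) * rho `|n|%N <= al `|n|%N) ->
  (forall n, cabs (b n) * rho `|n|%N <= al `|n|%N) ->
  cvgn (fun N => \sum_(n <- zbox N) al `|n|%N) ->
  (forall k, (fun N => cabs (box_conv a b N k)) @ \oo --> (0 : R)) ->
  (fun N => rnorm (w - \sum_(n <- zbox N) a n *: x n)) @ \oo --> (0 : R) ->
  w != 0 ->
  ~ (fun N => cabs (\sum_(m <- zbox N) b m * y m u)) @ \oo --> (0 : R) ->
  exists M, nontrivial_hyperinvariant_subspace T M.
Proof.
move=> kappa0 ylin Tx yT xle yle K0 rho0 al0 ale ble al_cvg ab0 wlim w0 uNlim.
pose A N := \sum_(n <- zbox N) al `|n|%N.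
have Amono : {homo A : N N' / (N <= N')%N >-> N <= N'}.
  by move=> N N' NN'; apply: ler_zbox.
pose l := limn A.
have Ale N : A N <= l by apply: nondecreasing_cvgn_le; [exact: Amono|exact: al_cvg].
have l0 : 0 <= l by apply: le_trans (Ale 0%N); apply: sumr_ge0.
pose Psi N h := \sum_(m <- zbox N) b m * y m h.
have PsiD N c h h' : Psi N (c *: h + h') = c * Psi N h + Psi N h'.
  rewrite /Psi mulr_sumr -big_split /=; apply: eq_bigr => m _.
  by rewrite ylin mulrDr mulrCA.
have PsiB N h h' : Psi N (h - h') = Psi N h - Psi N h'.
  by rewrite addrC -scaleN1r PsiD mulN1r addrC.
have Psi_le N h : cabs (Psi N h) <= K * l * rnorm h.
  apply: le_trans (cabs_sum _ _ _) _.
  apply: (@le_trans _ _ (K * A N * rnorm h)); last first.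
    by rewrite ler_wpM2r ?rnorm_ge0// ler_wpM2l.
  rewrite /A mulr_sumr mulr_suml; apply: ler_sum => m _; rewrite cabsM.
  apply: le_trans (ler_wpM2l (cabs_ge0 _) (yle _ _)) _.
  rewrite mulrA; apply: ler_wpM2r; first exact: rnorm_ge0.
  by rewrite mulrCA ler_wpM2l.
pose M : set X := [set h | forall S, bounded_operator S -> S \o T = T \o S ->
  (fun N => cabs (Psi N (S h))) @ \oo --> (0 : R)].
have yS S : bounded_operator S -> S \o T = T \o S ->
    forall m n, y m (S (x n)) = y 0 (S (x (n + m))).
  by move=> [Slin _] ST; exact: orbit_pairing kappa0 ylin Tx yT Slin ST.
have Mw : M w.
  move=> S Sb ST; have [c c0 Sc] := bounded_rnorm Sb.
  pose wN N := \sum_(n <- zbox N) a n *: x n.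
  pose cS k := y 0 (S (x k)).
  have PsiE N : Psi N (S (wN N)) =
      \sum_(n <- zbox N) \sum_(m <- zbox N) a n * b m * cS (n + m).
    rewrite /Psi /wN (linear_sum _ _ _ Sb.1) exchange_big /=.
    apply: eq_bigr => m _; rewrite (linear_sum _ _ _ (ylin m)) mulr_sumr.
    apply: eq_bigr => n _; rewrite /cS -yS// -[_ *: _]/(_ * _).
    by rewrite mulrCA mulrA.
  have lim1 : (fun N => cabs (Psi N (S (wN N)))) @ \oo --> (0 : R).
    under eq_fun do rewrite PsiE.
    apply: (@box_annihilation R a b cS al al0 (K * c)) => // n m.
    rewrite /cS -yS// !cabsM.
    have h1 : cabs (y m (S (x n))) <= K * rho `|m|%N * (c * rho `|n|%N).
      apply: le_trans (yle _ _) _; rewrite ler_wpM2l ?mulr_ge0//.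
      by apply: le_trans (Sc _) _; rewrite ler_wpM2l.
    apply: le_trans (ler_wpM2l _ h1) _; first by rewrite mulr_ge0// cabs_ge0.
    rewrite [leLHS](_ : _ = K * c * ((cabs (a n) * rho `|n|%N) * (cabs (b m) * rho `|m|%N))); last by ring.
    by rewrite ler_wpM2l ?mulr_ge0// ler_pM// mulr_ge0// cabs_ge0.
  apply: (@squeeze_cvgr _ _ _ _ (fun=> 0)
    (fun N => cabs (Psi N (S (wN N))) + K * l * c * rnorm (w - wN N))).
  - apply: nearW => N; rewrite cabs_ge0 /=.
    rewrite -{1}[w](subrK (wN N)) -[w - wN N]scale1r Sb.1 scale1r.
    rewrite -[S (w - _)]scale1r PsiD mul1r addrC.
    apply: le_trans (cabsD _ _) _; rewrite lerD2l.
    rewrite scale1r; apply: le_trans (Psi_le _ _) _.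
    by rewrite -[leRHS]mulrA ler_wpM2l ?mulr_ge0.
  - exact: cvg_cst.
  - rewrite -[X in _ --> X](addr0 0); apply: cvgD => //.
    rewrite [X in _ --> X](_ : 0 = K * l * c * 0); last by rewrite mulr0.
    by apply: cvgM => //; exact: cvg_cst.
have Msub : closed_subspace M.
  split.
  - apply: closed_rnorm => h hM S Sb ST; have [c c0 Sc] := bounded_rnorm Sb.
    apply/cvgrPdist_le => e e0.
    have e'0 : 0 < e / 2 / (K * l * c + 1).
      by rewrite !divr_gt0// ltr_wpDl// !mulr_ge0.
    have [g Mg hg] := hM _ e'0.
    have : 0 < e / 2 by rewrite divr_gt0.
    have /cvgrPdist_le Mg' := Mg S Sb ST; move/Mg'; apply: filterS => N.
    rewrite !sub0r !normrN !ger0_norm ?cabs_ge0// => gN.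
    have -> : S h = 1 *: S (h - g) + S g.
      by rewrite -Sb.1 scale1r subrK.
    rewrite PsiD mul1r; apply: le_trans (cabsD _ _) _.
    rewrite [leRHS](splitr e); apply: lerD => //.
    apply: le_trans (Psi_le _ _) _.
    apply: (@le_trans _ _ ((K * l * c + 1) * rnorm (h - g))).
      apply: (@le_trans _ _ (K * l * c * rnorm (h - g))).
        by rewrite -[leRHS]mulrA ler_wpM2l ?mulr_ge0.
      by rewrite ler_wpM2r ?rnorm_ge0// lerDl.
    have k0 : 0 < K * l * c + 1 by rewrite ltr_wpDl// !mulr_ge0.
    by rewrite mulrC -ler_pdivlMr// ltW.
  - move=> S Sb ST; rewrite (linear_at0 Sb.1).
    have P0 N : Psi N 0 = 0 by rewrite -[X in Psi _ X](subrr 0) PsiB subrr.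
    under eq_fun do rewrite P0 cabs0.
    exact: cvg_cst.
  - move=> c h g Mh Mg S Sb ST.
    apply: (@squeeze_cvgr _ _ _ _ (fun=> 0)
      (fun N => cabs c * cabs (Psi N (S h)) + cabs (Psi N (S g)))).
    + apply: nearW => N; rewrite cabs_ge0 /= Sb.1 PsiD -cabsM; exact: cabsD.
    + exact: cvg_cst.
    + rewrite [X in _ --> X](_ : 0 = cabs c * 0 + 0); last by rewrite mulr0 addr0.
      apply: cvgD; last exact: Mg.
      by apply: cvgM; [exact: cvg_cst|exact: Mh].
exists M; split => //.
- by move=> ME; move: Mw; rewrite ME => /= /eqP; rewrite (negbTE w0).
- move=> ME; apply: uNlim.
  have Mu : M u by rewrite ME.
  apply: (Mu id) => //; split; first by move=> ? ? ?.
  by exists 1 => h; rewrite mul1r.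
- move=> S Sb ST _ [h Mh <-] S' S'b S'T.
  apply: (Mh (S' \o S)).
  + split; first by move=> c g g' /=; rewrite Sb.1 S'b.1.
    have [c c0 Sc] := bounded_rnorm Sb; have [c' c'0 S'c] := bounded_rnorm S'b.
    exists ((c' * c)%:C%C) => g; rewrite !normE /= -rmorphM /= lecR.
    by apply: le_trans (S'c _) _; rewrite -mulrA ler_wpM2l.
  + apply/funext => g /=.
    have e1 := congr1 (fun f => f g) ST; have e2 := congr1 (fun f => f (S g)) S'T.
    by rewrite /= in e1 e2; rewrite e1 e2.
Qed.

(** Non-triviality in [hyperinvariant_of_orbits] follows from a
    diagonal-dominance argument: among the numbers y_0 x_n, the one for n = 0 is
    gam and the next ones are 0 up to |n| = N0, beyond which the tails of the
    series are at most gam / 2. *)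
Lemma hyperinvariant_of_returning_orbits (R : realType) (X : normedModType R[i])
    (T : X -> X) (kappa : R[i]) (x : int -> X) (y : int -> X -> R[i])
    (a b : int -> R[i]) (rho al : nat -> R) (K gam : R) (w : X) (N0 : nat) :
  kappa != 0 ->
  (forall m, linear (y m : X -> R[i]^o)) ->
  (forall n, T (x n) = kappa *: x (n + 1)) ->
  (forall m h, y m (T h) = kappa * y (m + 1) h) ->
  (forall n, rnorm (x n) <= rho `|n|%N) ->
  (forall m h, cabs (y m h) <= K * rho `|m|%N * rnorm h) ->
  0 <= K -> (forall n, 0 <= rho n) -> (forall n, 0 <= al n) ->
  a 0 = 1 -> b 0 = 1 ->
  (forall n, cabs (a n) * rho `|n|%N <= al `|n|%N) ->
  (forall n, cabs (b n) * rho `|n|%N <= al `|n|%N) ->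
  cvgn (fun N => \sum_(n <- zbox N) al `|n|%N) ->
  (forall k, (fun N => cabs (box_conv a b N k)) @ \oo --> (0 : R)) ->
  (fun N => rnorm (w - \sum_(n <- zbox N) a n *: x n)) @ \oo --> (0 : R) ->
  (forall N, (N0 <= N)%N ->
    \sum_(n <- zbox N) al `|n|%N - \sum_(n <- zbox N0) al `|n|%N <= 4^-1) ->
  0 < gam -> cabs (y 0 (x 0)) = gam ->
  (forall n, (0 < `|n|)%N -> (`|n| <= N0)%N -> y 0 (x n) = 0) ->
  (forall n, cabs (y 0 (x n)) <= 2 * gam * rho `|n|%N) ->
  exists M, nontrivial_hyperinvariant_subspace T M.
Proof.
move=> kappa0 ylin Tx yT xle yle K0 rho0 al0 a0 b0 ale ble al_cvg ab0 wlim tail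
  gam0 c0 cret cle.
have low (s : int -> R[i]) : s 0 = 1 ->
    (forall n, cabs (s n) * rho `|n|%N <= al `|n|%N) ->
    forall N, (N0 <= N)%N -> gam / 2 <= cabs (\sum_(n <- zbox N) s n * y 0 (x n)).
  move=> s0 sle N NN.
  rewrite (zbox_split _ NN) (bigD1_seq 0) ?zbox_uniq ?mem_zbox//=.
  rewrite [X in _ + X + _]big1_seq ?addr0; last first.
    move=> n /andP[n0]; rewrite mem_zbox => nN; rewrite cret ?mulr0//.
    by rewrite absz_gt0.
  rewrite s0 mul1r; apply: le_trans (cabsB_ge _ _); rewrite c0 lerBrDl -lerBrDr.
  have -> : gam - gam / 2 = 2 * gam * 4^-1 by field.
  apply: le_trans (cabs_sum _ _ _) _.
  apply: (@le_trans _ _ (2 * gam * \sum_(n <- zbox N | ~~ (`|n| <= N0)%N) al `|n|%N)).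
    rewrite mulr_sumr; apply: ler_sum => n _; rewrite cabsM.
    apply: le_trans (ler_wpM2l (cabs_ge0 _) (cle n)) _.
    by rewrite mulrCA ler_wpM2l// mulr_ge0// ltW.
  rewrite ler_wpM2l ?mulr_ge0 ?(ltW gam0)//.
  by apply: le_trans (tail N NN); rewrite (zbox_split _ NN) addrC addKr.
have g2 : 0 < gam / 2 by rewrite divr_gt0.
apply: (@hyperinvariant_of_orbits R X T kappa x y a b rho al K w (x 0)) => //.
- apply/negP => /eqP w0; move: wlim; rewrite w0 => wlim.
  have K1 : 0 < K * rho 0 + 1 by rewrite ltr_wpDl// mulr_ge0.
  have /cvgrPdist_lt/(_ _ (divr_gt0 g2 K1)) := wlim.
  move=> /(filterI (nbhs_infty_ge N0))/filter_ex[N [NN]].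
  rewrite !sub0r normrN rnormN ger0_norm ?rnorm_ge0// ltr_pdivlMr//.
  apply/negP; rewrite -leNgt; apply: le_trans (low a a0 ale N NN) _.
  have -> : \sum_(n <- zbox N) a n * y 0 (x n) = y 0 (\sum_(n <- zbox N) a n *: x n).
    by rewrite (linear_sum _ _ _ (ylin 0)).
  apply: le_trans (yle 0 _) _; rewrite mulrC ler_wpM2l ?rnorm_ge0//.
  by rewrite lerDl.
- move=> /cvgrPdist_lt/(_ _ g2)/(filterI (nbhs_infty_ge N0))/filter_ex[N [NN]].
  rewrite sub0r normrN ger0_norm ?cabs_ge0//; apply/negP; rewrite -leNgt.
  have yx m : y m (x 0) = y 0 (x m).
    have := @orbit_pairing R X T kappa x y id kappa0 ylin Tx yT _ erefl m 0.
    by rewrite add0r; apply.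
  by under eq_bigr do rewrite yx; exact: low.
Qed.

(** * Polynomials that are small at roots of unity *)

Section RootsOfUnity.
Context {R : realType}.

Definition expi (x : R) : R[i] := (cos x +i* sin x)%C.

Lemma expi0 : expi 0 = 1. Proof. by rewrite /expi cos0 sin0. Qed.

Lemma expiD x y : expi (x + y) = expi x * expi y.
Proof. by rewrite /expi cosD sinD; congr (_ +i* _)%C; rewrite addrC. Qed.

Lemma cabs_expi x : cabs (expi x) = 1.
Proof. by rewrite /cabs /= cos2Dsin2 sqrtr1. Qed.

Lemma expi2pi : expi (pi *+ 2) = 1.
Proof. by rewrite /expi cos2pi sin2pi. Qed.

(** The n-th power of the primitive root of unity of order 2 ^ q. *)
Definition root_pow (q : nat) (n : int) : R[i] :=
  expi (pi *+ 2 * n%:~R / (2 ^ q)%N%:R).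

Lemma root_powD q n m : root_pow q (n + m) = root_pow q n * root_pow q m.
Proof. by rewrite /root_pow -expiD -mulrDl -mulrDr intrD. Qed.

Lemma root_pow0 q : root_pow q 0 = 1.
Proof. by rewrite /root_pow mulr0 mul0r expi0. Qed.

Lemma cabs_root_pow q n : cabs (root_pow q n) = 1.
Proof. exact: cabs_expi. Qed.

Lemma root_pow_neq0 q n : root_pow q n != 0.
Proof. by rewrite -cabs_gt0 cabs_root_pow. Qed.

Lemma root_powN q n : root_pow q (- n) = (root_pow q n)^-1.
Proof.
apply: (mulfI (root_pow_neq0 q n)).
by rewrite -root_powD subrr root_pow0 divff// root_pow_neq0.
Qed.

Lemma root_powX q n k : root_pow q n ^+ k = root_pow q (n * k%:Z).
Proof.
elim: k => [|k IH]; first by rewrite mulr0 root_pow0.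
by rewrite exprS IH -root_powD -addn1 PoszD; congr root_pow; ring.
Qed.

Lemma root_pow_period q n : root_pow q (n * (2 ^ q)%N%:Z) = 1.
Proof.
have R1 : root_pow q (2 ^ q)%N%:Z = 1.
  have q0 : (2 ^ q)%N%:R != 0 :> R by rewrite pnatr_eq0 expn_eq0.
  by rewrite /root_pow -[(_%:Z)%:~R]/((2 ^ q)%N%:R) mulfK// expi2pi.
have pos k : root_pow q (k%:Z * (2 ^ q)%N%:Z) = 1.
  by rewrite mulrC -root_powX R1 expr1n.
case: n => k; first exact: pos.
by rewrite NegzE mulNr root_powN pos invr1.
Qed.

(** For z the root in question and k maximal with k n <= 2 ^ q, the argument of
    z ^+ k lies between pi / 2 and pi, whence 1 <= |1 - z ^+ k| <= k |1 - z|. *)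
Lemma cabs_1Broot_pow q (n : int) : (0 < `|n|)%N -> (`|n| <= 2 ^ q)%N ->
  (`|n|)%:R <= (2 ^ q)%N%:R * cabs (1 - root_pow q.+1 n).
Proof.
wlog: n / exists k : nat, n = k%:Z.
  move=> W; case: n => k; first by apply: W; exists k.
  move=> k0 kq; have := W k.+1%:Z (ex_intro _ k.+1 erefl) k0 kq.
  rewrite NegzE root_powN => /le_trans; apply; rewrite ler_wpM2l//.
  have z0 := root_pow_neq0 q.+1 k.+1%:Z.
  have -> : 1 - (root_pow q.+1 k.+1)^-1 =
      - ((root_pow q.+1 k.+1)^-1 * (1 - root_pow q.+1 k.+1)).
    by rewrite mulrBr mulr1 mulVf// opprB.
  by rewrite cabsN cabsM cabsV cabs_root_pow invr1 mul1r.
move=> [m ->] /= m0 mq.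
set z := root_pow _ _.
pose k := (2 ^ q %/ m)%N.
have k0 : (0 < k)%N by rewrite divn_gt0.
have kmq : (k * m <= 2 ^ q)%N by exact: leq_trunc_div.
have kmq2 : (2 ^ q < 2 * (k * m))%N.
  have := ltn_ceil (2 ^ q) m0; rewrite -/k => h.
  by apply: leq_trans h _; rewrite mulSn mul2n -addnn leq_add2r leq_pmull.
have up : cabs (1 - z ^+ k) <= k%:R * cabs (1 - z).
  rewrite -opprB cabsN subrX1 -opprB mulNr cabsN cabsM mulrC.
  rewrite ler_wpM2r ?cabs_ge0//.
  apply: le_trans (cabs_sum _ _ _) _.
  rewrite (eq_bigr (fun=> 1)); last by move=> i _; rewrite cabsX cabs_root_pow expr1n.
  by rewrite sumr_const card_ord.
have low : 1 <= cabs (1 - z ^+ k).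
  apply: le_trans (cabs_Re _); rewrite root_powX.
  apply: le_trans (ler_norm _).
  rewrite raddfB /= lerBrDr gerDl /root_pow /=.
  set x := _ / _.
  have -> : x = (x - pi / 2) + pi / 2 by rewrite subrK.
  rewrite cosDpihalf oppr_le0; apply: sin_ge0_pi.
  have q0 : (0 : R) < (2 ^ q)%N%:R by rewrite ltr0n expn_gt0.
  have -> : x = pi * ((k * m)%:R / (2 ^ q)%N%:R).
    rewrite /x expnS -PoszM -[(_%:Z)%:~R]/((m * k)%:R) mulnC !natrM.
    by field; rewrite gt_eqF.
  have h1 : (k * m)%:R / (2 ^ q)%N%:R <= 1 :> R.
    by rewrite ler_pdivrMr// mul1r ler_nat.
  have h2 : 1 / 2 <= (k * m)%:R / (2 ^ q)%N%:R :> R.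
    rewrite ler_pdivlMr// mulrAC ler_pdivrMr// mul1r -natrM ler_nat mulnC; exact: ltnW.
  have p0 := pi_ge0 R.
  by apply/andP; split; nra.
have h := le_trans low up.
have : m%:R * 1 <= m%:R * (k%:R * cabs (1 - z)) by rewrite ler_wpM2l.
rewrite mulr1 => /le_trans; apply; rewrite mulrA -natrM ler_wpM2r ?cabs_ge0//.
by rewrite ler_nat mulnC.
Qed.

Lemma sum_root_pow q (t : int) : (0 < `|t|)%N -> (`|t| < 2 ^ q.+1)%N ->
  \sum_(i < 2 ^ q.+1) root_pow q.+1 ((i%:Z - (2 ^ q)%N%:Z) * t) = 0.
Proof.
move=> t0 tq; set z := root_pow q.+1 t.
have z1 : z != 1.
  rewrite eq_sym -subr_eq0 -cabs_gt0.
  have [tq'|tq'] := leqP `|t| (2 ^ q).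
    have := cabs_1Broot_pow t0 tq'; rewrite -/z => h.
    have : (0 : R) < (2 ^ q)%N%:R * cabs (1 - z).
      by apply: lt_le_trans h; rewrite ltr0n.
    by rewrite pmulr_rgt0// ltr0n expn_gt0.
  have [s [s0 sq zs]] : exists s : int, [/\ (0 < `|s|)%N, (`|s| <= 2 ^ q)%N & z = root_pow q.+1 s].
    have P1 : root_pow q.+1 (2 ^ q.+1)%N%:Z = 1 :> R[i].
      by have := root_pow_period q.+1 1; rewrite mul1r.
    move: tq tq' P1; rewrite expnS => tq tq' P1.
    have [tpos|tneg] := leP 0 t.
      exists (t - (2 ^ q.+1)%N%:Z); rewrite expnS; split; [lia|lia|].
      by rewrite root_powD root_powN P1 invr1 mulr1.
    exists (t + (2 ^ q.+1)%N%:Z); rewrite expnS; split; [lia|lia|].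
    by rewrite root_powD P1 mulr1.
  have := cabs_1Broot_pow s0 sq; rewrite -zs => h.
  have : (0 : R) < (2 ^ q)%N%:R * cabs (1 - z).
    by apply: lt_le_trans h; rewrite ltr0n.
  by rewrite pmulr_rgt0// ltr0n expn_gt0.
have : (z - 1) * \sum_(i < 2 ^ q.+1) z ^+ i = 0.
  by rewrite -subrX1 root_powX root_pow_period subrr.
move=> /eqP; rewrite mulf_eq0 subr_eq0 (negbTE z1) /= => /eqP sz.
transitivity (root_pow q.+1 (- (2 ^ q)%N%:Z * t) * \sum_(i < 2 ^ q.+1) z ^+ i).
  rewrite mulr_sumr; apply: eq_bigr => i _.
  by rewrite root_powX -root_powD; congr root_pow; ring.
by rewrite sz mulr0.
Qed.

End RootsOfUnity.

Section Bump.
Context {R : realType}.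

(** The multiplicities grow almost like 2 ^ j, to make [bump] small, but the sum of
    2 ^ - j * mult j stays below 1 / 2, to keep the degree of bump q below
    2 ^ (q - 1) for q > 0; the factor j (j + 1) comes from a telescoping series. *)
Definition mult (j : nat) : nat := 2 ^ j %/ (2 * (j * j.+1)).

(** The average of 1, 'X, ..., 'X^(m - 1): it is 1 at 1, and at z <> 1 on the unit
    circle it is at most 2 / (m |1 - z|). *)
Definition avg_poly (m : nat) : {poly R[i]} := \poly_(i < m) m%:R^-1.

(** A finite version of the Fourier transform of a non-quasianalytic bump
    function, which is an infinite convolution of indicator functions of
    intervals of decreasing lengths. *)
Definition bump (q : nat) : {poly R[i]} :=
  \prod_(1 <= j < q.+1) avg_poly (2 ^ (q - j)) ^+ mult j.

Lemma sum_mult q k : (k <= q)%N ->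
  (2 * k.+1 * \sum_(1 <= j < k.+1) 2 ^ (q - j) * mult j <= 2 ^ q * k)%N.
Proof.
elim: k => [|k IH] kq; first by rewrite big_geq.
rewrite big_nat_recr //=; have {}IH := IH (ltnW kq).
set S := (\sum_(_ <= _ < _) _)%N in IH *; set t := (2 ^ _ * _)%N.
have tle : (t * (2 * (k.+1 * k.+2)) <= 2 ^ q)%N.
  rewrite /t /mult -mulnA -[in leqRHS](subnKC kq) addnC expnD.
  by rewrite leq_mul2l leq_trunc_div orbT.
rewrite -(leq_pmul2l (ltn0Sn k)); nia.
Qed.

Lemma size_bump q : (size (bump q.+1) <= 2 ^ q)%N.
Proof.
have S : (size (bump q.+1) <= (\sum_(1 <= j < q.+2) 2 ^ (q.+1 - j) * mult j).+1)%N.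
  rewrite /bump; elim: (index_iota _ _) => [|j r IH].
    by rewrite !big_nil size_polyC oner_eq0.
  rewrite !big_cons; apply: leq_trans (size_polyMleq _ _) _.
  have := size_poly_exp_leq (avg_poly (2 ^ (q.+1 - j))) (mult j).
  have : ((size (avg_poly (2 ^ (q.+1 - j)))).-1 * mult j <= 2 ^ (q.+1 - j) * mult j)%N.
    by rewrite leq_mul2r (leq_trans (leq_pred _) (size_poly _ _)) orbT.
  move: IH; lia.
apply: leq_trans S _; have := sum_mult (leqnn q.+1); rewrite expnS.
have : (0 < 2 ^ q)%N by rewrite expn_gt0.
nia.
Qed.

Lemma avg_poly1 m : (0 < m)%N -> (avg_poly m).[1] = 1.
Proof.
move=> m0; rewrite /avg_poly horner_poly.
rewrite (eq_bigr (fun=> m%:R^-1)); last by move=> i _; rewrite expr1n mulr1.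
by rewrite sumr_const card_ord -[_ *+ m]mulr_natl divff// pnatr_eq0 -lt0n.
Qed.

Lemma bump1 q : (bump q).[1] = 1.
Proof.
rewrite /bump horner_prod big_nat big1// => j jq.
by rewrite horner_exp avg_poly1 ?expr1n// expn_gt0.
Qed.

Lemma cabs_natr (m : nat) : cabs (m%:R : R[i]) = m%:R.
Proof. by rewrite -[m%:R](rmorph_nat (real_complex R)) cabs_real ger0_norm. Qed.

Lemma cabs_avg_poly m z : (0 < m)%N -> cabs z = 1 -> cabs (avg_poly m).[z] <= 1.
Proof.
move=> m0 z1; rewrite /avg_poly horner_poly; apply: le_trans (cabs_sum _ _ _) _.
rewrite (eq_bigr (fun=> m%:R^-1)); last first.
  by move=> i _; rewrite cabsM cabsX z1 expr1n mulr1 cabsV cabs_natr.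
by rewrite sumr_const card_ord -[_ *+ m]mulr_natl divff// pnatr_eq0 -lt0n.
Qed.

(** At distance at least 2 ^ (j + 2) / 2 ^ q from 1, the average of 2 ^ (q + 1 - j)
    powers is at most 2 / 8. *)
Lemma cabs_avg_poly_root q j (n : int) : (j <= q.+1)%N ->
  (2 ^ j.+2 <= `|n|)%N -> (`|n| <= 2 ^ q)%N ->
  cabs (avg_poly (2 ^ (q.+1 - j))).[root_pow q.+1 n] <= 4^-1.
Proof.
move=> jq jn nq; set z := root_pow _ _; set m := (2 ^ _)%N.
have m0 : (0 < m)%N by rewrite expn_gt0.
have n0 : (0 < `|n|)%N by apply: leq_trans jn; rewrite expn_gt0.
have h := cabs_1Broot_pow (R := R) n0 nq; rewrite -/z in h.
set d := cabs (1 - z) in h.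
have q0 : (0 : R) < (2 ^ q)%N%:R by rewrite ltr0n expn_gt0.
have d0 : 0 < d.
  have : 0 < (2 ^ q)%N%:R * d by apply: lt_le_trans h; rewrite ltr0n.
  by rewrite pmulr_rgt0.
have mR0 : (0 : R) < m%:R by rewrite ltr0n.
have key : m%:R * d * cabs (avg_poly m).[z] <= 2.
  have -> : m%:R * d * cabs (avg_poly m).[z] = cabs (1 - z ^+ m).
    rewrite /avg_poly horner_poly -mulr_sumr cabsM cabsV cabs_natr mulrACA divff ?gt_eqF//.
    by rewrite mul1r -cabsM -opprB mulNr -subrX1 opprB.
  apply: le_trans (cabsD _ _) _; rewrite cabsN cabsX cabs1 cabs_root_pow expr1n; lra.
have md : 8 <= m%:R * d.
  have : (m%:R * (2 ^ j.+2)%N%:R : R) <= m%:R * ((2 ^ q)%N%:R * d).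
    by rewrite ler_wpM2l// (le_trans _ h)// ler_nat.
  rewrite -natrM /m -expnD (_ : (q.+1 - j + j.+2)%N = q.+3); last by lia.
  by rewrite mulrCA !expnS -/m !natrM => hh; rewrite -(ler_pM2l q0); lra.
have c0 := cabs_ge0 (avg_poly m).[z].
nra.
Qed.

Lemma cabs_bump q (n : int) : cabs (bump q).[root_pow q n] <= 1.
Proof.
rewrite /bump horner_prod cabs_prod; apply: prodr_ile1 => j _.
rewrite cabs_ge0 /= horner_exp cabsX exprn_ile1 ?cabs_ge0// cabs_avg_poly//.
  by rewrite expn_gt0.
exact: cabs_root_pow.
Qed.

(** The bound for the values of [bump] at the n-th power of a root of unity of
    large order: it is of the form exp (- c n / ln^2 n). *)
Definition decay (n : nat) : R :=
  if (n < 8)%N then 1 else 4^-1 ^+ mult (trunc_log 2 n - 2).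

Lemma decay_ge0 n : 0 <= decay n.
Proof. by rewrite /decay; case: ifP => // _; rewrite exprn_ge0. Qed.

Lemma cabs_bump_decay q (n : int) : (`|n| <= 2 ^ q)%N ->
  cabs (bump q.+1).[root_pow q.+1 n] <= decay `|n|%N.
Proof.
rewrite /decay; case: ifPn => [_ _|]; first exact: cabs_bump.
rewrite -leqNgt => n8 nq; set j := (_ - 2)%N.
have n0 : (0 < `|n|)%N by lia.
have tl3 : (3 <= trunc_log 2 `|n|)%N by apply: trunc_log_max.
have jE : (j.+2 = trunc_log 2 `|n|)%N by rewrite /j; lia.
have jn : (2 ^ j.+2 <= `|n|)%N by rewrite jE trunc_logP.
have jq : (j.+2 <= q)%N.
  by rewrite jE -(@trunc_expnK 2 q)// leq_trunc_log.
rewrite /bump horner_prod cabs_prod.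
rewrite (bigD1_seq j) ?iota_uniq//=; last by rewrite mem_index_iota; lia.
rewrite -[leRHS]mulr1; apply: ler_pM => //.
- exact: cabs_ge0.
- by apply: prodr_ge0 => i _; exact: cabs_ge0.
- rewrite horner_exp cabsX lerXn2r ?nnegrE ?cabs_ge0 ?invr_ge0//.
  by apply: cabs_avg_poly_root => //; lia.
- apply: prodr_ile1 => i _.
  rewrite cabs_ge0 /= horner_exp cabsX exprn_ile1 ?cabs_ge0// cabs_avg_poly//.
    by rewrite expn_gt0.
  exact: cabs_root_pow.
Qed.

(** Fourier coefficients, on the cyclic group of order 2 ^ (q + 1), of the
    coefficient sequence of [bump] and of its translate by half a period. *)
Definition coef_a q (n : int) : R[i] := (bump q.+1).[root_pow q.+1 n].
Definition coef_b q (n : int) : R[i] :=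
  root_pow q.+1 (n * (2 ^ q)%N%:Z) * coef_a q n.

(** The product of the two coefficient sequences is zero: the degree of [bump] is
    less than 2 ^ q, so that a translation by 2 ^ q makes the supports
    disjoint. *)
Lemma cyclic_conv0 q k :
  \sum_(i < 2 ^ q.+1) coef_a q (i%:Z - (2 ^ q)%N%:Z) *
    coef_b q (k - (i%:Z - (2 ^ q)%N%:Z)) = 0.
Proof.
rewrite /coef_b /coef_a; set P := bump q.+1; set H := (2 ^ q)%N.
have PE n : P.[root_pow q.+1 n] = \sum_(i < H) P`_i * root_pow q.+1 (n * i%:Z).
  rewrite (horner_coef_wide _ (size_bump q)); apply: eq_bigr => i _.
  by rewrite root_powX.
pose F (n : int) (i j : 'I_H) : R[i] := P`_i * P`_j *
  (root_pow q.+1 (k * (H%:Z + j%:Z)) * root_pow q.+1 (n * (i%:Z - j%:Z - H%:Z))).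
transitivity (\sum_(s < 2 ^ q.+1) \sum_(i < H) \sum_(j < H) F (s%:Z - H%:Z) i j).
  apply: eq_bigr => s _; set n := (s%:Z - H%:Z); rewrite !PE.
  rewrite mulr_suml; apply: eq_bigr => i _.
  rewrite !mulr_sumr; apply: eq_bigr => j _.
  rewrite /F -root_powD.
  rewrite (_ : k * (H%:Z + j%:Z) + n * (i%:Z - j%:Z - H%:Z) =
    n * i%:Z + ((k - n) * H%:Z + (k - n) * j%:Z)); last by ring.
  by rewrite !root_powD; ring.
rewrite exchange_big big1// => i _; rewrite exchange_big big1// => j _.
rewrite -mulr_sumr -mulr_sumr sum_root_pow ?mulr0//.
  have := ltn_ord i; have := ltn_ord j; rewrite /H; lia.
have := ltn_ord i; have := ltn_ord j; rewrite /H expnS; lia.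
Qed.

End Bump.

(** * Summability of the decay against subexponential growth *)

Section Growth.
Context {R : realType}.

Lemma zboxS (V : nmodType) (F : int -> V) N :
  \sum_(n <- zbox N.+1) F n =
  F N.+1%:Z + F (- N.+1%:Z) + \sum_(n <- zbox N) F n.
Proof.
move: (zbox_uniq N) (@mem_zbox N); move: (zbox N) => z uz mz.
transitivity (\sum_(n <- [:: N.+1%:Z, - N.+1%:Z & z]) F n).
  apply: perm_big; apply: uniq_perm; first exact: zbox_uniq.
    by rewrite !cons_uniq uz in_cons !mz andbT; apply/andP; split; lia.
  by move=> n; rewrite mem_zbox !in_cons mz; lia.
by rewrite !big_cons addrA.
Qed.

Lemma zbox_telescope N :
  \sum_(n <- zbox N) ((`|n|%N.+1)%:R * (`|n|%N.+2)%:R)^-1 <= 2 - 2 / N.+2%:R :> R.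
Proof.
elim: N => [|N IH].
  by rewrite zbox0 /=; lra.
rewrite zboxS abszN absz_nat.
apply: le_trans (lerD (lexx _) IH) _.
have h2 : (0 : R) < N.+2%:R by rewrite ltr0n.
have -> : N.+3%:R = N.+2%:R + 1 :> R by rewrite -[N.+3]addn1 natrD.
rewrite -lerBrDr le_eqVlt; apply/orP; left; apply/eqP.
by field; rewrite !gt_eqF// addr_gt0.
Qed.

Lemma expR1_ge2 : 2 <= expR 1 :> R.
Proof. by have := expR_ge1Dx (1 : R); lra. Qed.

Lemma expRN1_ge : 4^-1 <= expR (- 1) :> R.
Proof.
have h := expR_ge1Dx (- (1 / 2) : R).
have -> : - 1 = - (1 / 2) + - (1 / 2) :> R by lra.
rewrite expRD; nra.
Qed.

Lemma ln2_ge : 1 / 2 <= ln 2 :> R.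
Proof.
rewrite -ler_expR lnK ?posrE//.
have h := expR_ge1Dx (- (1 / 2) : R); rewrite expRN in h.
have e0 := expR_gt0 (1 / 2 : R).
have : expR (1 / 2) * (1 + - (1 / 2)) <= expR (1 / 2) * (expR (1 / 2))^-1 :> R.
  by rewrite ler_pM2l.
rewrite mulfV ?gt_eqF//; lra.
Qed.

(** In [decay_expR_le] the exponent 2 ^ t / (16 t ^ 2) has to exceed 2 t + 5. *)
Lemma exp_cubic k : 16 * (k + 20)%:R ^+ 2 * (2 * (k + 20)%:R + 5) <= 2 ^+ (k + 20) :> R.
Proof.
elim: k => [|k IH].
  have -> : 2 ^+ (0 + 20) = 1024 * 1024 :> R.
    by rewrite add0n (_ : 20 = 10 + 10)%N// exprD -natrX.
  rewrite add0n; lra.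
rewrite addSn [leRHS]exprS; apply: le_trans (_ : 2 * (16 * (k + 20)%:R ^+ 2 * (2 * (k + 20)%:R + 5)) <= _).
  rewrite -[(k + 20).+1]addn1 [(k + 20 + 1)%:R]natrD.
  have : 20 <= (k + 20)%:R :> R by rewrite ler_nat leq_addl.
  set x := (k + 20)%:R => x20; nra.
by rewrite ler_pM2l.
Qed.

(** The bound 2 ^ t / (8 t ^ 2) - 1 replaces j (j + 1) by t ^ 2, for j = t - 2. *)
Lemma mult_ge t : (3 <= t)%N ->
  2 ^+ t / (8 * t%:R ^+ 2) - 1 <= (mult (t - 2))%:R :> R.
Proof.
move=> t3; set j := (t - 2)%N.
have tE : t = (j + 2)%N by rewrite /j; lia.
have j1 : (1 <= j)%N by rewrite /j; lia.
have d0 : (0 < 2 * (j * j.+1))%N by rewrite !muln_gt0 j1.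
have := ltn_ceil (2 ^ j) d0; rewrite -/(mult j) -(ltr_nat R) !natrM natrX.
rewrite -[(mult j).+1]addn1 natrD -[j.+1]addn1 natrD => h.
have jR : 1 <= j%:R :> R by rewrite ler1n.
have p0 : 0 < j%:R :> R by rewrite ltr0n.
have p1 : 0 < j%:R + 1 :> R by rewrite addr_gt0.
have p2 : 0 < j%:R + 2 :> R by rewrite addr_gt0.
have h' : 2 ^+ j / (2 * (j%:R * (j%:R + 1))) < (mult j)%:R + 1 :> R.
  by rewrite ltr_pdivrMr ?h// !mulr_gt0.
rewrite lerBlDr; apply: le_trans (ltW h').
rewrite tE exprD natrD.
have e0 : 0 < 2 ^+ j :> R by rewrite exprn_gt0.
have -> : 2 ^+ j * 2 ^+ 2 / (8 * (j%:R + 2) ^+ 2) = 2 ^+ j / (2 * (j%:R + 2) ^+ 2) :> R.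
  by field; rewrite gt_eqF.
rewrite ler_pM2l// lef_pV2 ?posrE; last 2 first.
- by rewrite mulr_gt0// exprn_gt0.
- by rewrite !mulr_gt0.
by rewrite ler_pM2l//; clear -jR; nra.
Qed.

(** With t the integer part of the binary logarithm of n, decay n is at most
    exp (- 2 ^ t / (8 t ^ 2) + 1), and r n is eventually at most half the leading
    term of the exponent. *)
Lemma decay_expR_le (r : nat -> R) :
  (forall n, 0 <= r n) ->
  (fun n => r n * (ln n%:R) ^+ 2 / n%:R) @ \oo --> (0 : R) ->
  \forall n \near \oo, decay n * expR (r n) <= (n.+1%:R * n.+2%:R)^-1.
Proof.
(* As ln n >= t / 2 and n <= 2 ^ (t + 1), the constant 1 / 128 leads to
   r n <= 2 ^ t / (16 t ^ 2). *)
move=> r0 /cvgrPdist_lt/(_ (128^-1)) []; first by rewrite invr_gt0.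
move=> n0 _ n0P.
(* The bound of [exp_cubic] starts at t = 20; the power of 2 is abstracted so that
   conversion never evaluates it. *)
have [P PE] : exists P, P = (2 ^ 20)%N by exact: ex_intro _ _ erefl.
exists (maxn n0 P) => // n /=.
rewrite geq_max => /andP[n0n Pn].
have n8 : (8 <= n)%N.
  by apply: leq_trans Pn; rewrite PE -[8%N]/(2 ^ 3)%N leq_exp2l.
have n_gt0 : (0 < n)%N by exact: leq_trans n8.
set t := trunc_log 2 n.
have t20 : (20 <= t)%N by apply: trunc_log_max => //; rewrite -PE.
clear PE Pn.
have tn : (2 ^ t <= n)%N by exact: trunc_logP.
have nt : (n < 2 ^ t.+1)%N by exact: trunc_log_ltn.
have tR : 20 <= t%:R :> R by rewrite ler_nat.
have tnR : 2 ^+ t <= n%:R :> R by rewrite -natrX ler_nat.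
have ntR : n%:R <= 2 * 2 ^+ t :> R by rewrite -exprS -natrX ler_nat ltnW.
have e0 : 0 < 2 ^+ t :> R by rewrite exprn_gt0.
have nR : (0 : R) < n%:R by rewrite ltr0n.
have lnn : t%:R / 2 <= ln n%:R :> R.
  apply: (@le_trans _ _ (ln (2 ^+ t))); last by rewrite ler_ln ?posrE.
  rewrite lnXn// -[leRHS]mulr_natl; apply: ler_wpM2l => //.
  by have := ln2_ge; lra.
have rn : r n <= 2 ^+ t / (16 * t%:R ^+ 2).
  have := n0P n n0n; rewrite sub0r normrN => /ltW.
  rewrite ger0_norm; last by rewrite divr_ge0// mulr_ge0// sqr_ge0.
  rewrite ler_pdivrMr// => h.
  have t2 : 0 < 16 * t%:R ^+ 2 :> R by rewrite mulr_gt0// exprn_gt0//; lra.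
  rewrite ler_pdivlMr//.
  have : r n * (t%:R / 2) ^+ 2 <= r n * ln n%:R ^+ 2.
    by rewrite ler_wpM2l// lerXn2r ?nnegrE//; lra.
  have -> : r n * (t%:R / 2) ^+ 2 = r n * (16 * t%:R ^+ 2) / 64 by field.
  lra.
have mt : r n + 2 * t%:R + 4 <= (mult (t - 2))%:R.
  apply: le_trans (mult_ge (leq_trans _ t20)) => //.
  have := exp_cubic (t - 20); rewrite subnK// => h.
  have t2 : 0 < 16 * t%:R ^+ 2 :> R by rewrite mulr_gt0// exprn_gt0//; lra.
  have h' : 2 * t%:R + 5 <= 2 ^+ t / (16 * t%:R ^+ 2) :> R.
    by rewrite ler_pdivlMr// mulrC.
  have -> : 2 ^+ t / (8 * t%:R ^+ 2) = 2 ^+ t / (16 * t%:R ^+ 2) + 2 ^+ t / (16 * t%:R ^+ 2) :> R.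
    by field; rewrite gt_eqF//; lra.
  lra.
rewrite /decay ltnNge n8 /= -/t.
have d1 : 4^-1 ^+ mult (t - 2) <= expR (- (mult (t - 2))%:R) :> R.
  apply: (@le_trans _ _ (expR (- 1) ^+ mult (t - 2))).
    by rewrite lerXn2r ?nnegrE ?expR_ge0 ?invr_ge0// expRN1_ge.
  by rewrite -expRM_natl mulrN1 lexx.
apply: le_trans (ler_wpM2r (expR_ge0 _) d1) _; rewrite -expRD.
apply: (@le_trans _ _ (expR (- (2 * t%:R + 4)))); first by rewrite ler_expR; lra.
rewrite expRN lef_pV2 ?posrE ?expR_gt0 ?mulr_gt0 ?ltr0n//.
have b : n.+2%:R <= expR (t%:R + 2) :> R.
  apply: (@le_trans _ _ (2 ^+ (t + 2))).
    rewrite -natrX ler_nat; move: nt; rewrite addn2 !expnS.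
    have : (2 ^ 1 <= 2 ^ t)%N by rewrite leq_exp2l//; lia.
    rewrite expn1; lia.
  have -> : t%:R + 2 = (t + 2)%:R * 1 :> R by rewrite natrD mulr1.
  by rewrite expRM_natl lerXn2r ?nnegrE ?expR_ge0 ?expR1_ge2.
have -> : 2 * t%:R + 4 = (t%:R + 2) + (t%:R + 2) :> R by lra.
by rewrite expRD ler_pM// (le_trans _ b)// ler_nat.
Qed.

Lemma cvgn_decay_expR (r : nat -> R) :
  (forall n, 0 <= r n) ->
  (fun n => r n * (ln n%:R) ^+ 2 / n%:R) @ \oo --> (0 : R) ->
  cvgn (fun N => \sum_(n <- zbox N) decay `|n|%N * expR (r `|n|%N)).
Proof.
move=> r0 /(decay_expR_le r0)[n0 _ n0P].
set F := fun n : int => decay `|n|%N * expR (r `|n|%N).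
have F0 n : 0 <= F n by rewrite mulr_ge0 ?decay_ge0 ?expR_ge0.
apply: nondecreasing_is_cvgn; first by move=> x y xy; apply: ler_zbox.
exists (\sum_(n <- zbox n0) F n + 2) => _ [N _ <-].
apply: le_trans (ler_zbox (leq_maxr n0 N) F0) _.
rewrite (zbox_split _ (leq_maxl n0 N)) lerD2l.
apply: (@le_trans _ _ (\sum_(n <- zbox (maxn n0 N)) ((`|n|%N.+1)%:R * (`|n|%N.+2)%:R)^-1)).
  rewrite big_mkcond; apply: ler_sum => n _; case: ifPn => [|_].
    by rewrite -ltnNge => /ltnW /n0P.
  by rewrite invr_ge0 mulr_ge0.
apply: le_trans (zbox_telescope _) _.
by rewrite gerBl divr_ge0.
Qed.

End Growth.

(** * A pair of sequences with vanishing convolution *)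

(** The topology of R[i] is the one that it carries as a numeric field. *)
Definition complexField (R : realType) : numFieldType := R[i].

Section ComplexLimits.
Context {R : realType}.
Local Notation C := (complexField R).

Lemma cvg_cabs {T : Type} (F : set_system T) {FF : Filter F} (f : T -> C) (l : C) :
  f @ F --> l <-> (fun t => cabs (f t - l)) @ F --> (0 : R).
Proof.
split=> [/cvgrPdist_lt fl|/cvgrPdist_lt fl].
  apply/cvgrPdist_lt => e e0; have e0' : 0 < (e%:C)%C by rewrite (ltcR 0 e).
  apply: filterS (fl _ e0') => t.
  rewrite normC_cabs ltcR sub0r normrN ger0_norm ?cabs_ge0//.
  by rewrite -opprB cabsN.
apply/cvgrPdist_lt => -[e e'] ee0.
have [e'0 e0] : e' = 0 /\ 0 < e.
  by move: ee0; rewrite ltcE /= => /andP[/eqP].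
rewrite e'0 in ee0 *; apply: filterS (fl _ e0) => t.
rewrite sub0r normrN ger0_norm ?cabs_ge0// -opprB cabsN => h.
by rewrite normC_cabs (ltcR _ e).
Qed.

Lemma ultra_segment_cvg (U : set_system nat) (f : nat -> R) :
  UltraFilter U -> (forall q, `|f q| <= 1) -> exists l : R, f @ U --> l.
Proof.
move=> UU f1.
have FU : (f @ U) `[-1, 1]%classic.
  by apply: nearW => q; rewrite /= in_itv /= -ler_norml f1.
have [l [_ fl]] := @segment_compact R (-1) 1 (f @ U) _ FU.
exists l => B Bl; have [//|UB] := in_ultra_setVsetC (f @^-1` B) UU.
by have [x [nBx Bx]] := fl (~` B) B UB Bl.
Qed.

Lemma ultra_cvg (U : set_system nat) (f : nat -> C) :
  UltraFilter U -> (forall q, cabs (f q) <= 1) -> exists l : C, f @ U --> l.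
Proof.
move=> UU f1.
have [x fx] := @ultra_segment_cvg U (fun q => complex.Re (f q)) UU
  (fun q => le_trans (cabs_Re _) (f1 q)).
have [y fy] := @ultra_segment_cvg U (fun q => complex.Im (f q)) UU
  (fun q => le_trans (cabs_Im _) (f1 q)).
exists (x +i* y)%C; apply/cvg_cabs.
apply: (@squeeze_cvgr _ _ _ _ (fun=> 0)
  (fun q => `|complex.Re (f q) - x| + `|complex.Im (f q) - y|)).
- apply: nearW => q; rewrite cabs_ge0 /=.
  apply: le_trans (cabs_le_ReIm _) _.
  by case: (f q) => a b.
- exact: cvg_cst.
- rewrite -[X in _ --> X](addr0 0); apply: cvgD.
    rewrite -[X in _ --> X](@normr0 R R); apply: cvg_norm.
    by rewrite -(subrr x); apply: cvgB => //; exact: cvg_cst.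
  rewrite -[X in _ --> X](@normr0 R R); apply: cvg_norm.
  by rewrite -(subrr y); apply: cvgB => //; exact: cvg_cst.
Qed.

Lemma cvg_cabs_le {T : Type} (F : set_system T) {FF : ProperFilter F}
    (f : T -> C) (l : C) (M : R) :
  f @ F --> l -> (\forall t \near F, cabs (f t) <= M) -> cabs l <= M.
Proof.
move=> /cvg_cabs fl fM; apply/ler_addgt0Pr => e e0.
have /cvgrPdist_lt/(_ e e0) fe := fl.
have [t [ft fte]] := filter_ex (filterI fM fe).
rewrite sub0r normrN ger0_norm ?cabs_ge0// in fte.
rewrite -[l](subKr (f t)); apply: le_trans (cabsD _ _) _.
by rewrite cabsN lerD// ltW.
Qed.

End ComplexLimits.

Section Pair.
Context {R : realType}.

Lemma ler_sum_subset (F : int -> R) (r1 r2 : seq int) :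
  uniq r1 -> uniq r2 -> {subset r1 <= r2} -> (forall n, 0 <= F n) ->
  \sum_(n <- r1) F n <= \sum_(n <- r2) F n.
Proof.
move=> u1 u2 r12 F0.
rewrite [leRHS](bigID (mem r1)) /= -[leLHS]addr0 lerD ?sumr_ge0//.
rewrite -[leRHS]big_filter le_eqVlt; apply/orP; left; apply/eqP.
apply: perm_big; apply: uniq_perm => //; first exact: filter_uniq.
move=> n; rewrite mem_filter; apply/idP/andP => [nr|[]//].
by split=> //; exact: r12.
Qed.

Lemma box_convE (a b : int -> R[i]) N k :
  box_conv a b N k = \sum_(n <- zbox N | (absz (k - n)%R <= N)%N) a n * b (k - n).
Proof.
rewrite /box_conv [RHS]big_mkcond /=; apply: eq_bigr => n _.
rewrite -big_filter; case: ifPn => kn.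
  rewrite (_ : [seq _ <- _ | _] = [:: k - n]) ?big_seq1//.
  apply: perm_small_eq => //; apply: uniq_perm => //.
    by rewrite filter_uniq// zbox_uniq.
  move=> m; rewrite mem_filter mem_zbox mem_seq1 -[X in X && _]/(n + m == k).
  have [->|mk] := eqVneq m (k - n); first by rewrite kn addrC subrK eqxx.
  by apply/negbTE/nandP; left; apply: contraNneq mk => <-; rewrite addrC addKr.
rewrite big_filter big1_seq// => m /andP[/eqP h]; rewrite mem_zbox.
by rewrite (_ : m = k - n) ?(negbTE kn)// -h addrC addKr.
Qed.

Definition decay_sum (N : nat) : R := \sum_(n <- zbox N) decay `|n|%N.

Lemma cabs_coef_a q n : cabs (coef_a q n : R[i]) <= 1.
Proof. exact: cabs_bump. Qed.

Lemma cabs_coef_b q n : cabs (coef_b q n : R[i]) = cabs (coef_a q n : R[i]).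
Proof. by rewrite cabsM cabs_root_pow mul1r. Qed.

Lemma cabs_coef_a_decay q n : (`|n| <= 2 ^ q)%N ->
  cabs (coef_a q n : R[i]) <= decay `|n|%N.
Proof. exact: cabs_bump_decay. Qed.

Lemma cyclic_conv_zbox q k :
  \sum_(n <- zbox (2 ^ q) | n != (2 ^ q)%N%:Z) coef_a q n * coef_b q (k - n) = 0 :> R[i].
Proof.
rewrite -[RHS](cyclic_conv0 q k) -(big_mkord xpredT (fun i => coef_a q (i%:Z - (2 ^ q)%N%:Z) *
    coef_b q (k - (i%:Z - (2 ^ q)%N%:Z)))) /zbox big_map.
rewrite -[(2 ^ q).*2.+1]addn1 iotaD big_cat /= [X in _ + X]big_cons big_nil add0n.
rewrite -addnn PoszD addrK eqxx /= addr0 addnn -mul2n -expnS /index_iota subn0.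
rewrite big_seq_cond [RHS]big_seq_cond; apply: eq_bigl => i.
rewrite andbT mem_iota add0n; apply/andP/idP => [[]//|iq]; split=> //.
by move: iq; rewrite expnS; lia.
Qed.

(** The cyclic convolution is 0; a finite section of the convolution on the
    integers differs from it by two tails of the decay. *)
Lemma cabs_box_conv_coef q N k : (N + `|k| < 2 ^ q)%N ->
  cabs (box_conv (coef_a q) (coef_b q) N k : R[i]) <=
    2 * (decay_sum (2 ^ q) - decay_sum N).
Proof.
move=> Nkq; set H := (2 ^ q)%N.
have NH : (N <= H)%N by rewrite /H; lia.
pose tail : R := decay_sum H - decay_sum N.
pose f n : R[i] := coef_a q n * coef_b q (k - n).
have tailE : tail = \sum_(n <- zbox H | ~~ (`|n| <= N)%N) decay `|n|%N.
  by rewrite /tail /decay_sum (zbox_split _ NH) addrC addKr.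
have -> : box_conv (coef_a q) (coef_b q) N k =
   - (\sum_(n <- zbox H | (n != H%:Z) && ~~ (`|n| <= N)%N) f n +
      \sum_(n <- zbox N | ~~ (absz (k - n)%R <= N)%N) f n).
  have /eqP := cyclic_conv_zbox q k; rewrite -/H (bigID (fun n => (`|n| <= N)%N)) /=.
  rewrite (eq_bigl (fun n => (`|n| <= N)%N)); last first.
    by move=> n; case: (leqP `|n| N) => nN; rewrite ?andbF ?andbT//; apply/eqP; lia.
  rewrite -zbox_restrict// (bigID (fun n => (absz (k - n)%R <= N)%N)) /= -box_convE.
  by rewrite -addrA addr_eq0 => /eqP ->; rewrite addrC.
rewrite cabsN; apply: le_trans (cabsD _ _) _; rewrite [leRHS]mulrC mulr_natr mulr2n -/tail.
apply: lerD.
  apply: le_trans (cabs_sum _ _ _) _; rewrite tailE.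
  rewrite big_mkcond [leRHS]big_mkcond /= big_seq [leRHS]big_seq; apply: ler_sum => n.
  rewrite mem_zbox => nH; case: ifPn => [/andP[_ ->]|_].
    rewrite cabsM cabs_coef_b -[leRHS]mulr1 ler_pM ?cabs_ge0 ?cabs_coef_a//.
    exact: cabs_coef_a_decay.
  by case: ifP => // _; exact: decay_ge0.
apply: le_trans (cabs_sum _ _ _) _.
apply: (@le_trans _ _ (\sum_(n <- zbox N | ~~ (absz (k - n)%R <= N)%N) decay (absz (k - n)%R))).
  rewrite big_seq_cond [leRHS]big_seq_cond; apply: ler_sum => n.
  rewrite mem_zbox => /andP[nN _].
  rewrite cabsM cabs_coef_b -[leRHS]mul1r ler_pM ?cabs_ge0 ?cabs_coef_a//.
  by apply: cabs_coef_a_decay; lia.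
rewrite -big_filter -(big_map (fun n => k - n) xpredT (fun m => decay `|m|%N)).
rewrite tailE -[leRHS]big_filter; apply: ler_sum_subset.
- rewrite map_inj_uniq ?filter_uniq ?zbox_uniq// => i j /addrI/oppr_inj; exact.
- by rewrite filter_uniq ?zbox_uniq.
- move=> m /mapP[n]; rewrite mem_filter mem_zbox => /andP[h1 h2] ->.
  rewrite mem_filter h1 mem_zbox /=; move: h1 h2 Nkq; rewrite -/H; lia.
- by move=> n; exact: decay_ge0.
Qed.

(** Limits of [coef_a] and [coef_b] along an ultrafilter, which exist as these
    coefficients are bounded.  The convolution vanishes in the limit by
    [cabs_box_conv_coef], since the tails of the decay do not depend on q. *)
Lemma annihilating_pair :
  exists a b : int -> R[i], [/\ a 0 = 1, b 0 = 1,
    forall n, cabs (a n) <= decay `|n|%N,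
    forall n, cabs (b n) <= decay `|n|%N &
    forall k, (fun N => cabs (box_conv a b N k)) @ \oo --> (0 : R)].
Proof.
have [U [UU NU]] := ultraFilterLemma (eventually_filter : ProperFilter \oo).
have qlarge m : \forall q \near U, (m < 2 ^ q)%N.
  apply: NU; exists m => // q /= mq; apply: leq_trans (ltn_expl m (leqnn 2)) _.
  by rewrite leq_exp2l.
have ex_a n : exists l : complexField R, coef_a q n @[q --> U] --> l.
  by apply: ultra_cvg => q; exact: cabs_coef_a.
have ex_b n : exists l : complexField R, coef_b q n @[q --> U] --> l.
  by apply: ultra_cvg => q; rewrite cabs_coef_b; exact: cabs_coef_a.
have [a aP] := choice ex_a; have [b bP] := choice ex_b.
have a1 q : coef_a q 0 = 1 :> R[i] by rewrite /coef_a root_pow0 bump1.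
have cst1 (f : nat -> complexField R) (l : complexField R) : (forall q, f q = 1) -> f @ U --> l -> l = 1.
  move=> f1 /cvg_cabs fl; apply/eqP; rewrite -subr_eq0 -cabs_eq0 -opprB cabsN.
  rewrite eq_le cabs_ge0 andbT.
  by apply: (cvgr_to_ge fl); apply: nearW => q; rewrite f1.
exists a, b; split.
- exact: cst1 (aP 0).
- by apply: cst1 (bP 0) => q; rewrite /coef_b mul0r root_pow0 mul1r a1.
- move=> n; apply: cvg_cabs_le (aP n) _.
  by apply: filterS (qlarge `|n|%N) => q /ltnW; exact: cabs_coef_a_decay.
- move=> n; apply: cvg_cabs_le (bP n) _.
  apply: filterS (qlarge `|n|%N) => q /ltnW; rewrite cabs_coef_b.
  exact: cabs_coef_a_decay.
move=> k.
have dsmono : {homo decay_sum : x y / (x <= y)%N >-> x <= y}.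
  by move=> x y xy; apply: ler_zbox => // n; exact: decay_ge0.
have dscvg : cvgn decay_sum.
  rewrite (_ : decay_sum = fun N => \sum_(n <- zbox N) decay `|n|%N * expR 0).
    apply: (@cvgn_decay_expR R (fun=> 0)) => //.
    by under eq_fun do rewrite !mul0r; exact: cvg_cst.
  by apply/funext => N; apply: eq_bigr => n _; rewrite expR0 mulr1.
pose l := limn decay_sum.
apply: (@squeeze_cvgr _ _ _ _ (fun=> 0) (fun N => 2 * (l - decay_sum N))).
- apply: nearW => N; rewrite cabs_ge0 /=.
  apply: (@cvg_cabs_le _ _ U _ (fun q => box_conv (coef_a q) (coef_b q) N k)).
    apply: (@cvg_sumr _ _ _ (complexField R)) => n.
    apply: (@cvg_sumr _ _ _ (complexField R)) => m.
    by apply: cvgM; [exact: aP|exact: bP].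
  apply: filterS (qlarge (N + `|k|)%N) => q /cabs_box_conv_coef/le_trans; apply.
  rewrite ler_pM2l// lerD2r; exact: nondecreasing_cvgn_le.
- exact: cvg_cst.
- rewrite [X in _ --> X](_ : 0 = 2 * (l - l)); last by rewrite subrr mulr0.
  by apply: cvgM; [exact: cvg_cst|apply: cvgB => //; exact: cvg_cst].
Qed.

End Pair.

(** * Integrals of complex functions *)

Section ComplexIntegral.
Context {d : measure_display} {T : measurableType d} {R : realType}.
Variable mu : {measure set T -> \bar R}.
Implicit Types f g : T -> R[i].

Definition L1norm f : \bar R := (\int[mu]_x (cabs (f x))%:E)%E.

Definition cintegrable f := complex_measurable f /\ (L1norm f < +oo)%E.

Definition cint f : R[i] :=
  (Rintegral mu setT (fun x => complex.Re (f x)) +i*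
   Rintegral mu setT (fun x => complex.Im (f x)))%C.

Lemma measurable_cabs_EFin f : complex_measurable f ->
  measurable_fun setT (fun x => (cabs (f x))%:E).
Proof. by move=> /measurable_cabs/measurable_EFinP. Qed.

Lemma integrable_cabs f : cintegrable f ->
  mu.-integrable setT (fun x => (cabs (f x))%:E).
Proof.
move=> [mf fi]; apply/integrableP; split; first exact: measurable_cabs_EFin.
rewrite (eq_integral (fun x => (cabs (f x))%:E))// => x _.
by rewrite /= ger0_norm// cabs_ge0.
Qed.

Lemma integrable_Re f : cintegrable f ->
  mu.-integrable setT (EFin \o (fun x => complex.Re (f x))).
Proof.
move=> fi; apply: le_integrable (integrable_cabs fi) => //.
  by apply/measurable_EFinP; case: fi => -[].
by move=> x _ /=; rewrite lee_fin [leRHS]ger0_norm ?cabs_ge0// cabs_Re.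
Qed.

Lemma integrable_Im f : cintegrable f ->
  mu.-integrable setT (EFin \o (fun x => complex.Im (f x))).
Proof.
move=> fi; apply: le_integrable (integrable_cabs fi) => //.
  by apply/measurable_EFinP; case: fi => -[].
by move=> x _ /=; rewrite lee_fin [leRHS]ger0_norm ?cabs_ge0// cabs_Im.
Qed.

Lemma cint_linear c f g : cintegrable f -> cintegrable g ->
  cint (fun x => c * f x + g x) = c * cint f + cint g.
Proof.
move=> fi gi.
have fR := integrable_Re fi; have fI := integrable_Im fi.
have gR := integrable_Re gi; have gI := integrable_Im gi.
have Z (h : T -> R) (k : R) : mu.-integrable setT (EFin \o h) ->
    mu.-integrable setT (EFin \o (fun x => k * h x)).
  move=> hi; rewrite (_ : _ \o _ = (fun x => k%:E * (h x)%:E)%E).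
    exact: integrableZl.
  by apply/funext => x /=; rewrite EFinM.
have D (h k : T -> R) : mu.-integrable setT (EFin \o h) ->
    mu.-integrable setT (EFin \o k) ->
    mu.-integrable setT (EFin \o (fun x => h x + k x)).
  move=> hi ki; rewrite (_ : _ \o _ = (fun x => (h x)%:E + (k x)%:E)%E).
    exact: integrableD.
  by apply/funext => x /=; rewrite EFinD.
case: c => a b; rewrite /cint.
rewrite [X in (Rintegral _ _ X +i* _)%C](_ : _ =
  fun x => (a * complex.Re (f x) + (- b) * complex.Im (f x)) + complex.Re (g x)); last first.
  by apply/funext => x; case: (f x) (g x) => u w [u' w'] /=; rewrite mulNr.
rewrite [X in (_ +i* Rintegral _ _ X)%C](_ : _ =
  fun x => (a * complex.Im (f x) + b * complex.Re (f x)) + complex.Im (g x)); last first.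
  by apply/funext => x; case: (f x) (g x) => u w [u' w'].
rewrite !RintegralD ?RintegralZl//; do ?[exact: Z|exact: D (Z _ _ _) (Z _ _ _)].
by rewrite mulNr.
Qed.

(** The constant 2 comes from treating the real and imaginary parts
    separately. *)
Lemma cabs_cint_le f : cintegrable f ->
  ((cabs (cint f))%:E <= 2%:E * L1norm f)%E.
Proof.
move=> fi; have L := integrable_cabs fi.
have -> : L1norm f = (Rintegral mu setT (fun x => cabs (f x)))%:E.
  by rewrite fineK// integrable_fin_num.
rewrite -EFinM lee_fin; apply: le_trans (cabs_le_ReIm _) _.
rewrite mulrDl mul1r lerD//=.
  apply: le_trans (le_normr_Rintegral _ (integrable_Re fi)) _ => //.
  apply: le_Rintegral => //; first exact/integrable_norm/integrable_Re.
  by move=> x _; exact: cabs_Re.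
apply: le_trans (le_normr_Rintegral _ (integrable_Im fi)) _ => //.
apply: le_Rintegral => //; first exact/integrable_norm/integrable_Im.
by move=> x _; exact: cabs_Im.
Qed.

Lemma cint_ae f g : complex_measurable f -> complex_measurable g ->
  (\forall x \ae mu, f x = g x) -> cint f = cint g.
Proof.
move=> [fR fI] [gR gI] fg; rewrite /cint /Rintegral.
congr (fine _ +i* fine _)%C; apply: ae_eq_integral => //.
- exact/measurable_EFinP.
- exact/measurable_EFinP.
- by apply: filterS fg => x -> _.
- exact/measurable_EFinP.
- exact/measurable_EFinP.
- by apply: filterS fg => x -> _.
Qed.

Lemma L1norm_le_ae f g : complex_measurable f -> complex_measurable g ->
  (\forall x \ae mu, cabs (f x) <= cabs (g x)) -> (L1norm f <= L1norm g)%E.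
Proof.
move=> mf mg fg; apply: ae_ge0_le_integral => //.
- by move=> x _; rewrite lee_fin cabs_ge0.
- exact: measurable_cabs_EFin.
- by move=> x _; rewrite lee_fin cabs_ge0.
- exact: measurable_cabs_EFin.
- by apply: filterS fg => x fgx _; rewrite lee_fin.
Qed.

Lemma L1normZ (c : R) f : complex_measurable f -> 0 <= c ->
  (L1norm (fun x => c%:C%C * f x)%R = c%:E * L1norm f)%E.
Proof.
move=> mf c0; rewrite /L1norm -ge0_integralZl//.
- by apply: eq_integral => x _; rewrite cabsM cabs_real ger0_norm// EFinM.
- exact: measurable_cabs_EFin.
- by move=> x _; rewrite lee_fin cabs_ge0.
Qed.

Lemma L1norm_Lpnorm f : L1norm f = Lpnorm mu 1 f.
Proof.
rewrite /Lpnorm Lnorm1; apply: eq_integral => x _ /=.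
by rewrite ger0_norm// cabs_ge0.
Qed.

Hypothesis mu1 : mu setT = 1%E.

Lemma Lpnorm_bounded (p : \bar R) f (c : R) : (1 <= p)%E ->
  complex_measurable f -> 0 <= c -> (\forall x \ae mu, cabs (f x) <= c) ->
  (Lpnorm mu p f <= c%:E)%E.
Proof.
move=> p1 mf c0 fc.
apply: (@le_trans _ _ (Lpnorm mu p (fun=> c%:C%C))).
  apply: le_Lpnorm => //.
  by apply: filterS fc => x; rewrite cabs_real ger0_norm.
rewrite /Lpnorm; case: p p1 => [p|_|//].
  rewrite lee_fin => p1; rewrite unlock /=.
  under eq_integral do rewrite cabs_real ger0_norm// ger0_norm//.
  rewrite integral_cst// mu1 mule1 poweR_EFin -powRrM divff ?powRr1//.
  by rewrite gt_eqF// (lt_le_trans ltr01).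
rewrite unlock /= mu1 lte01.
apply/ess_supP; apply: nearW => x /=.
by rewrite cabs_real ger0_norm// ger0_norm.
Qed.

Lemma L1norm_le_Lpnorm (p : \bar R) f : (1 <= p)%E -> complex_measurable f ->
  (L1norm f <= Lpnorm mu p f)%E.
Proof.
move=> p1 mf.
have [fy|] := eqVneq (Lpnorm mu p f) +oo%E; first by rewrite fy leey.
rewrite -ltey => ffin.
move: p1 ffin; case: p => [p| |//]; last first.
  move=> p1 ffin.
  have fc := Linfty_ae (conj mf ffin); rewrite L1norm_Lpnorm.
  rewrite -(fineK (x := Lpnorm mu +oo f)); last by rewrite ge0_fin_numE// Lpnorm_ge0.
  by apply: Lpnorm_bounded => //; rewrite fine_ge0// Lpnorm_ge0.
rewrite lee_fin le_eqVlt => /predU1P[<- _|p1 _]; first by rewrite L1norm_Lpnorm.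
pose q := (1 - p^-1)^-1.
have p0 : 0 < p by rewrite (lt_trans ltr01).
have q0 : 0 < q by rewrite invr_gt0 subr_gt0 invf_lt1.
have pq : p^-1 + q^-1 = 1 by rewrite invrK subrKC.
have := @hoelder _ _ _ mu (fun x => cabs (f x)) (cst 1) p q _ _ p0 q0 pq.
move=> /(_ (measurable_cabs mf) (measurable_cst _)).
rewrite (_ : EFin \o cst 1 = cst 1%E)// Lnorm_cst1 mu1.
rewrite poweR_EFin powR1 mule1 L1norm_Lpnorm /Lpnorm.
rewrite (_ : (_ \* _) = @cabs R \o f)//.
by apply/funext => x /=; rewrite mulr1.
Qed.

Lemma bounded_in_Lp (p : \bar R) f (c : R) : (1 <= p)%E ->
  complex_measurable f -> 0 <= c -> (\forall x \ae mu, cabs (f x) <= c) ->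
  in_Lp mu p f.
Proof.
move=> p1 mf c0 fc; split => //.
by rewrite (le_lt_trans (Lpnorm_bounded p1 mf c0 fc))// ltry.
Qed.

Variables (tau : T -> T).
Hypothesis tauP : measure_preserving mu tau.

Lemma L1norm_comp f : complex_measurable f -> L1norm (f \o tau) = L1norm f.
Proof.
move=> mf; have [mtau tauE] := tauP.
transitivity (\int[pushforward mu tau]_y (cabs (f y))%:E)%E.
  rewrite ge0_integral_pushforward//; first exact: measurable_cabs_EFin.
  by move=> y _; rewrite lee_fin cabs_ge0.
by apply: eq_measure_integral => A mA _; exact: tauE.
Qed.

Lemma cintegrable_comp f : cintegrable f -> cintegrable (f \o tau).
Proof.
move=> [mf fi]; split; first exact: complex_measurable_comp tauP.1 mf.
by rewrite L1norm_comp.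
Qed.

Lemma cint_comp f : cintegrable f -> cint (f \o tau) = cint f.
Proof.
move=> fi; have [mtau tauE] := tauP.
have H (h : T -> R) : measurable_fun setT h ->
    mu.-integrable setT (EFin \o (h \o tau)) ->
    Rintegral mu setT (h \o tau) = Rintegral mu setT h.
  move=> mh hi; rewrite /Rintegral; congr fine.
  transitivity (\int[pushforward mu tau]_y (h y)%:E)%E.
    by rewrite integral_pushforward//; exact/measurable_EFinP.
  by apply: eq_measure_integral => A mA _; exact: tauE.
have fti := cintegrable_comp fi.
rewrite /cint; congr (_ +i* _)%C.
- by apply: (H (fun x => complex.Re (f x))) (integrable_Re fti); case: fi => -[].
- by apply: (H (fun x => complex.Im (f x))) (integrable_Im fti); case: fi => -[].
Qed.

End ComplexIntegral.

(** * Weighted compositions with dense range *)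

(** The commutant maps the range of T into itself, and h stays away from it. *)
Lemma hyperinvariant_closure_range (R : realType) (X : normedModType R[i])
    (T : X -> X) (f h : X) (e : R) : linear T -> T f != 0 ->
  0 < e -> (forall g, e <= rnorm (h - T g)) ->
  exists M, nontrivial_hyperinvariant_subspace T M.
Proof.
move=> Tlin Tf0 e0 hT.
exists [set g | forall e : R, 0 < e -> exists f, rnorm (g - T f) < e]; split.
- split=> [|_ /posnumP[e1]|a x y xM yM e1 e1_gt0].
  + apply: closed_rnorm => g gM e1 e1_gt0.
    have e2 : 0 < e1 / 2 by rewrite divr_gt0.
    have [g1 g1M gg1] := gM _ e2; have [f1 g1f1] := g1M _ e2; exists f1.
    rewrite -(subrKA g1) [ltRHS](splitr e1); apply: le_lt_trans (rnormD _ _) _.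
    exact: ltrD.
  + by exists 0; rewrite (linear_at0 Tlin) subrr rnorm0.
  + have a0 : 0 < cabs a + 1 by rewrite ltr_wpDl ?cabs_ge0.
    have e2 : 0 < e1 / 2 by rewrite divr_gt0.
    have [x1 xx1] := xM _ (divr_gt0 e2 a0); have [y1 yy1] := yM _ e2.
    exists (a *: x1 + y1); rewrite Tlin opprD addrACA -scalerBr.
    rewrite [ltRHS](splitr e1); apply: le_lt_trans (rnormD _ _) _.
    apply: ler_ltD => //; rewrite rnormZ.
    rewrite ltr_pdivlMr// in xx1; apply: le_trans _ (ltW xx1).
    by rewrite mulrC ler_wpM2l ?rnorm_ge0// lerDl.
- move=> ME; have : [set g | forall e : R, 0 < e -> exists f, rnorm (g - T f) < e] (T f).
    by move=> e1 e1_gt0; exists f; rewrite subrr rnorm0.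
  by rewrite ME => /= /eqP; rewrite (negbTE Tf0).
- move=> ME; have : [set: X] h by [].
  by rewrite -ME => /(_ _ e0)[g]; rewrite ltNge hT.
- move=> S Sb ST _ [g gM <-] e1 e1_gt0; have [c c0 Sc] := bounded_rnorm Sb.
  have c1 : 0 < c + 1 by rewrite ltr_wpDl.
  have [f1 gf1] := gM _ (divr_gt0 e1_gt0 c1); exists (S f1).
  have -> : T (S f1) = S (T f1) by have := congr1 (fun k => k f1) ST.
  have -> : S g - S (T f1) = S (g - T f1).
    by rewrite addrC -scaleN1r -Sb.1 scaleN1r addrC.
  apply: le_lt_trans (Sc _) _; rewrite ltr_pdivlMr// in gf1.
  by apply: le_lt_trans _ gf1; rewrite mulrC ler_wpM2l ?rnorm_ge0// lerDl.
Qed.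

Section Koopman.
Context {d : measure_display} {T : measurableType d} {R : realType}.
Variable mu : {measure set T -> \bar R}.
Hypothesis mu1 : mu setT = 1%E.
Implicit Types f g : T -> R[i].

Lemma ae_false : ~ (\forall x \ae mu, False).
Proof.
move=> [N [mN N0 FN]]; have : (mu setT <= mu N)%E.
  by apply: le_measure; rewrite ?inE// => x _; exact: FN.
by rewrite mu1 N0 leNgt lte01.
Qed.

Definition ind (A : set T) : T -> R[i] := fun x => ((\1_A x : R)%:C)%C.

Lemma complex_measurable_real (f : T -> R) : measurable_fun setT f ->
  complex_measurable (fun x => (f x)%:C%C).
Proof. by move=> mf; split => //=; exact: measurable_cst. Qed.

Lemma complex_measurable_ind A : measurable A -> complex_measurable (ind A).
Proof. by move=> mA; apply: complex_measurable_real; exact: measurable_indic. Qed.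

Lemma indT A x : A x -> ind A x = 1.
Proof. by move=> Ax; rewrite /ind indicE mem_set. Qed.

Lemma indF A x : ~ A x -> ind A x = 0.
Proof. by move=> Ax; rewrite /ind indicE memNset. Qed.

Lemma cabs_ind_le1 A x : cabs (ind A x) <= 1.
Proof.
have [Ax|nAx] := pselect (A x); first by rewrite indT// cabs1.
by rewrite indF// cabs0.
Qed.

Lemma measurable_cabs_le f (c : R) : complex_measurable f ->
  measurable [set x | cabs (f x) <= c].
Proof.
move=> /measurable_cabs mf; rewrite -[X in measurable X]setTI.
exact: measurable_fun_le.
Qed.

(** Uniform bounds, at every point, are what allows series of functions on an orbit
    to be summed pointwise. *)
Lemma clip f (c : R) : complex_measurable f -> 0 <= c ->
  (\forall x \ae mu, cabs (f x) <= c) ->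
  exists g, [/\ complex_measurable g, forall x, cabs (g x) <= c &
    \forall x \ae mu, g x = f x].
Proof.
move=> mf c0 fc; pose A := [set x | cabs (f x) <= c].
exists (fun x => f x * ind A x); split.
- by apply: complex_measurableM => //; apply/complex_measurable_ind/measurable_cabs_le.
- move=> x; have [Ax|nAx] := pselect (A x); first by rewrite indT// mulr1.
  by rewrite indF// mulr0 cabs0.
- by apply: filterS fc => x Ax; rewrite indT// mulr1.
Qed.

Section iterates.
Variable tau : T -> T.
Hypothesis tauP : measure_preserving mu tau.

Lemma measure_preserving_iter n : measure_preserving mu (iter n tau).
Proof.
elim: n => [|n [mn En]]; first by split=> //; exact: measurable_id.
split; first exact: measurableT_comp tauP.1 mn.
move=> A mA; rewrite -[RHS]tauP.2// -[RHS]En//.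
by rewrite -[X in measurable X]setTI; exact: tauP.1.
Qed.

(** The complement of A has the measure of its preimage, which is null. *)
Lemma ae_comp_inv (A : set T) : measurable A ->
  (\forall x \ae mu, A (tau x)) -> \forall x \ae mu, A x.
Proof.
move=> mA [N [mN N0 AN]]; exists (~` A); split => //.
- exact: measurableC.
- rewrite -tauP.2; last exact: measurableC.
  apply/eqP; rewrite eq_le measure_ge0 andbT -N0; apply: le_measure; rewrite ?inE//.
  by rewrite -[X in measurable X]setTI; apply: tauP.1 => //; exact: measurableC.
Qed.

Variables (p : \bar R) (p1 : (1 <= p)%E) (v : T -> R[i]).
Hypothesis vL : in_Lp mu +oo v.
Hypothesis v0 : \forall x \ae mu, v x != 0.

Local Notation Lp := (Lp_space mu p1).
Local Notation W := (weighted_composition v tau : Lp -> Lp).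

Lemma rnormE (h : Lp) : (rnorm h)%:E = Lpnorm mu p (Lp_repr h).
Proof. by rewrite /rnorm Lp_normE /=; exact: (Lpnorm_fine (repr h)). Qed.

Lemma rnorm_ae (h : Lp) f : complex_measurable f ->
  (\forall x \ae mu, Lp_repr h x = f x) -> (rnorm h)%:E = Lpnorm mu p f.
Proof.
by move=> mf hf; rewrite rnormE; apply: ae_eq_Lpnorm => //; case: (Lp_repr_in_Lp h).
Qed.

Lemma Lp_reprB (h k : Lp) : \forall x \ae mu,
  Lp_repr (h - k) x = Lp_repr h x - Lp_repr k x.
Proof.
apply: filterS (Lp_reprZD (-1) k h) => x.
by rewrite scaleN1r mulN1r [- k + h]addrC [X in _ = X -> _]addrC => ->.
Qed.

Lemma Lp_repr0 : \forall x \ae mu, Lp_repr (0 : Lp) x = 0.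
Proof. by apply: filterS (Lp_reprB 0 0) => x; rewrite !subrr. Qed.

(** The image of the constant function 1 is v. *)
Lemma weighted_composition1_neq0 : W (Lp_class mu p1 (fun=> 1)) != 0.
Proof.
apply/negP => /eqP W0; apply: ae_false.
have L1 : in_Lp mu p (fun=> 1 : R[i]).
  apply: (@bounded_in_Lp _ _ _ _ mu1 _ _ 1) => //.
  by apply: nearW => x; rewrite cabs1.
have h1 := ae_preserving tauP (Lp_classE p1 L1).
have h2 := weighted_compositionE vL tauP (Lp_class mu p1 (fun=> 1)).
apply: filterS (filterI (filterI h1 h2) (filterI v0 Lp_repr0)) => x [[e1 e2] [vx e3]].
by move: e2; rewrite W0 e3 e1 mulr1 => /esym/eqP; rewrite (negbTE vx).
Qed.

Hypothesis dense : forall (h : Lp) (e : R), 0 < e -> exists k, rnorm (h - W k) < e.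

(** The product v g belongs to L^p, hence v (F_k o tau) approximates it for
    suitable F_k, and fast enough for F_k o tau to converge to g almost everywhere.
    The upper limit of the F_k is then the required function. *)
Lemma comp_surj1 g (c : R) : 0 <= c -> complex_measurable g ->
  (\forall x \ae mu, cabs (g x) <= c) ->
  exists2 G, complex_measurable G & \forall x \ae mu, G (tau x) = g x.
Proof.
move=> c0 mg gc.
have mvg : complex_measurable (fun x => v x * g x).
  by apply: complex_measurableM => //; case: vL.
have vgL : in_Lp mu p (fun x => v x * g x).
  pose C := fine (Lpnorm mu +oo v).
  have C0 : 0 <= C by rewrite fine_ge0// Lpnorm_ge0.
  apply: (@bounded_in_Lp _ _ _ _ mu1 _ _ (C * c)) => //; first exact: mulr_ge0.
  apply: filterS2 (Linfty_ae vL) gc => x vx gx.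
  by rewrite cabsM ler_pM// cabs_ge0.
have ek k : 0 < 1 / (2 ^ k.+1)%N%:R :> R by rewrite divr_gt0// ltr0n expn_gt0.
have [h hP] := choice (fun k => dense (Lp_class mu p1 (fun x => v x * g x)) (ek k)).
pose F k := Lp_repr (h k).
have mF k : complex_measurable (F k) by case: (Lp_repr_in_Lp (h k)).
pose D k x := v x * (g x - F k (tau x)).
have mD k : complex_measurable (D k).
  rewrite /D; apply: complex_measurableM; first by case: vL.
  rewrite (_ : (fun x => _) = g + (fun x => -1 * (F k \o tau) x)).
    apply: complex_measurableD => //; apply: complex_measurableM.
      exact: complex_measurable_cst.
    exact: complex_measurable_comp tauP.1 (mF k).
  apply/funext => x; rewrite -[RHS]/(g x + -1 * F k (tau x)).
  by rewrite mulN1r.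
have Dk k : (L1norm mu (D k) <= (1 / (2 ^ k.+1)%N%:R)%:E)%E.
  apply: le_trans (L1norm_le_Lpnorm mu1 p1 (mD k)) _.
  rewrite -(@rnorm_ae (Lp_class mu p1 (fun x => v x * g x) - W (h k)))//.
    by rewrite lee_fin ltW.
  apply: filterS (filterI (filterI (Lp_reprB (Lp_class mu p1 (fun x => v x * g x)) (W (h k)))
    (Lp_classE p1 vgL)) (weighted_compositionE vL tauP (h k))) => x [[e1 e2] e3].
  by rewrite e1 e2 e3 /D mulrBr.
have SD : (\int[mu]_x (\sum_(k <oo) (cabs (D k x))%:E) <= 1%:E)%E.
  rewrite integral_nneseries//; last 2 first.
  - by move=> k; exact: measurable_cabs_EFin.
  - by move=> k x _; rewrite lee_fin cabs_ge0.
  apply: le_trans (epsilon_trick0 xpredT ler01).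
  apply: lee_nneseries => // k _ ; first by move=> _; apply: integral_ge0 => x _; rewrite lee_fin cabs_ge0.
  exact: Dk.
have SDae : \forall x \ae mu, ((\sum_(k <oo) (cabs (D k x))%:E)%E \is a fin_num).
  have SD0 x : (0 <= \sum_(k <oo) (cabs (D k x))%:E)%E.
    by apply: nneseries_ge0 => k _ _; rewrite lee_fin cabs_ge0.
  have : mu.-integrable setT (fun x => \sum_(k <oo) (cabs (D k x))%:E)%E.
    apply/integrableP; split.
      apply: ge0_emeasurable_sum => // k.
        by move=> x _ _; rewrite lee_fin cabs_ge0.
      by move=> _; exact: measurable_cabs_EFin.
    under eq_integral do rewrite gee0_abs//.
    by apply: le_lt_trans SD _; rewrite ltry.
  by move=> fi; have := integrable_ae measurableT fi; apply: filterS => x /(_ I).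
have lim0 : \forall x \ae mu, (fun k => cabs (g x - F k (tau x))) @ \oo --> (0 : R).
  apply: filterS2 SDae v0 => x fx vx.
  have cv : cvgn (series (fun k => cabs (D k x))).
    apply: nondecreasing_is_cvgn.
      apply: nondecreasing_series => k _ _; exact: cabs_ge0.
    exists (fine (\sum_(k <oo) (cabs (D k x))%:E)%E) => _ [n _ <-].
    rewrite -lee_fin fineK// /series /= -sumEFin.
    by apply: nneseries_lim_ge => k _ _; rewrite lee_fin cabs_ge0.
  have D0 := cvg_series_cvg_0 cv.
  have E k : cabs (g x - F k (tau x)) = (cabs (v x))^-1 * cabs (D k x).
    by rewrite /D cabsM mulKf// cabs_eq0.
  rewrite (_ : (fun k => cabs (g x - F k (tau x))) =
    (fun k => (cabs (v x))^-1 * cabs (D k x))); last exact/funext.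
  rewrite [X in _ --> X](_ : 0 = (cabs (v x))^-1 * 0); last by rewrite mulr0.
  by apply: cvgM => //; exact: cvg_cst.
pose lsup (H : nat -> T -> R) y := fine (limn_esup (fun k => (H k y)%:E)).
have mlsup H : (forall k, measurable_fun setT (H k)) -> measurable_fun setT (lsup H).
  move=> mH; apply: (@measurableT_comp _ _ _ _ _ _ (@fine R)); first exact: fine_measurable.
  by apply: measurable_fun_limn_esup => k; exact/measurable_EFinP.
have lsupE H y (l : R) : (fun k => H k y) @ \oo --> l -> lsup H y = l.
  move=> Hl; rewrite /lsup (_ : limn_esup _ = l%:E)//.
  have := @cvg_limn_einf_sup _ (fun k => (H k y)%:E) l%:E.
  by move=> -[|_ ->//]; apply: cvg_EFin => //; exact: nearW.
exists (fun y => (lsup (fun k y => complex.Re (F k y)) y +i*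
                  lsup (fun k y => complex.Im (F k y)) y)%C).
  by split => /=; apply: mlsup => k; case: (mF k).
apply: filterS lim0 => x gx.
have toz (u : nat -> R) (l : R) :
    (forall k, `|l - u k| <= cabs (g x - F k (tau x))) -> u @ \oo --> l.
  move=> ul; apply/cvgrPdist_le => e e0.
  have /cvgrPdist_le/(_ e e0) := gx; apply: filterS => k.
  by rewrite sub0r normrN ger0_norm ?cabs_ge0//; exact: le_trans.
rewrite (lsupE (fun k y => complex.Re (F k y)) _ (complex.Re (g x))); last first.
  by apply: toz => k; apply: le_trans (cabs_Re _); rewrite raddfB.
rewrite (lsupE (fun k y => complex.Im (F k y)) _ (complex.Im (g x))); last first.
  by apply: toz => k; apply: le_trans (cabs_Im _); rewrite raddfB.
by case: (g x).
Qed.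

Lemma comp_surj n g (c : R) : 0 <= c -> complex_measurable g ->
  (\forall x \ae mu, cabs (g x) <= c) ->
  exists G, [/\ complex_measurable G, forall x, cabs (G x) <= c &
    \forall x \ae mu, G (iter n tau x) = g x].
Proof.
move=> c0; elim: n g => [|n IH] g mg gc; first exact: clip.
have [G1 mG1 G1g] := comp_surj1 c0 mg gc.
have G1c : \forall x \ae mu, cabs (G1 x) <= c.
  apply: (ae_comp_inv (measurable_cabs_le c mG1)).
  by apply: filterS2 G1g gc => x /= ->.
have [G [mG Gc GG1]] := IH _ mG1 G1c; exists G; split => //.
apply: filterS2 (ae_preserving tauP GG1) G1g => x e1 e2.
by rewrite iterSr e1 e2.
Qed.

End iterates.
End Koopman.

(** * Series and functionals *)

Section BoxSeries.
Context {R : realType}.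

(** Adding the partial sums of the dominating series makes the partial sums
    monotone. *)
Lemma real_box_series (f : int -> R) (al : nat -> R) :
  (forall n, `|f n| <= al `|n|%N) ->
  cvgn (fun N => \sum_(n <- zbox N) al `|n|%N) ->
  exists2 s : R, (fun N => \sum_(n <- zbox N) f n) @ \oo --> s &
    forall N, `|s - \sum_(n <- zbox N) f n| <=
      limn (fun N => \sum_(n <- zbox N) al `|n|%N) - \sum_(n <- zbox N) al `|n|%N.
Proof.
move=> fal; set A := fun N => \sum_(n <- zbox N) al `|n|%N => Acvg.
have al0 n : 0 <= al n by apply: le_trans (fal n%:Z).
have Amono : {homo A : x y / (x <= y)%N >-> x <= y}.
  by move=> x y xy; apply: ler_zbox.
have Ale N : A N <= limn A by exact: nondecreasing_cvgn_le.
pose S N := \sum_(n <- zbox N) f n.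
have S_le N N' : (N <= N')%N -> `|S N' - S N| <= A N' - A N.
  move=> NN; rewrite /S /A (zbox_split f NN) (zbox_split (fun n => al `|n|%N) NN).
  rewrite addrAC subrr add0r addrAC subrr add0r.
  by apply: le_trans (ler_norm_sum _ _ _) _; apply: ler_sum => n _; exact: fal.
have SAcvg : cvgn (fun N => S N + A N).
  apply: nondecreasing_is_cvgn.
    move=> N N' NN; have := S_le _ _ NN.
    by rewrite ler_norml => /andP[h _]; rewrite -subr_ge0; lra.
  exists (limn A + limn A) => _ [N _ <-]; apply: lerD => //.
  apply: le_trans (ler_norm _) _; apply: le_trans (Ale N).
  by apply: le_trans (ler_norm_sum _ _ _) _; apply: ler_sum => n _; exact: fal.
have Scvg : cvgn S.
  rewrite (_ : S = (fun N => (S N + A N) - A N)); first exact: is_cvgB.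
  by apply/funext => N; rewrite addrK.
exists (limn S) => // N.
apply: (@cvgr_to_le _ \oo _ _ (fun N' => `|S N' - S N|)).
  by apply: cvg_norm; apply: cvgB => //; exact: cvg_cst.
exists N => // N' /= NN; apply: le_trans (S_le _ _ NN) _.
by rewrite lerD2r.
Qed.

Lemma box_series (f : int -> R[i]) (al : nat -> R) :
  (forall n, cabs (f n) <= al `|n|%N) ->
  cvgn (fun N => \sum_(n <- zbox N) al `|n|%N) ->
  exists s : R[i], [/\
    (fun N => \sum_(n <- zbox N) complex.Re (f n)) @ \oo --> complex.Re s,
    (fun N => \sum_(n <- zbox N) complex.Im (f n)) @ \oo --> complex.Im s &
    forall N, cabs (s - \sum_(n <- zbox N) f n) <=
      2 * (limn (fun N => \sum_(n <- zbox N) al `|n|%N) - \sum_(n <- zbox N) al `|n|%N)].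
Proof.
move=> fal Acvg.
have [x fx xle] := real_box_series (fun n => le_trans (cabs_Re (f n)) (fal n)) Acvg.
have [y fy yle] := real_box_series (fun n => le_trans (cabs_Im (f n)) (fal n)) Acvg.
exists (x +i* y)%C; split => // N.
apply: le_trans (cabs_le_ReIm _) _; rewrite mulrDl mul1r; apply: lerD.
  by rewrite raddfB raddf_sum; exact: xle.
by rewrite raddfB raddf_sum; exact: yle.
Qed.

End BoxSeries.

Section Functional.
Context {d : measure_display} {T : measurableType d} {R : realType}.
Variable mu : {measure set T -> \bar R}.
Hypothesis mu1 : mu setT = 1%E.
Variables (p : \bar R) (p1 : (1 <= p)%E) (tau : T -> T).
Hypothesis tauP : measure_preserving mu tau.
Local Notation Lp := (Lp_space mu p1).
Variables (m : T -> R[i]) (c : R).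
Hypotheses (mm : complex_measurable m) (c0 : 0 <= c).
Hypothesis mc : \forall x \ae mu, cabs (m x) <= c.

Definition pairing (h : Lp) : R[i] := cint mu (fun x => m x * Lp_repr h (tau x)).

Lemma pairing_cintegrable (h : Lp) :
  cintegrable mu (fun x => m x * Lp_repr h (tau x)) /\
  (L1norm mu (fun x => m x * Lp_repr h (tau x))%R <= (c * rnorm h)%:E)%E.
Proof.
have [mh hfin] := Lp_repr_in_Lp h.
have mht := complex_measurable_comp tauP.1 mh.
have mf : complex_measurable (fun x => m x * Lp_repr h (tau x)).
  exact: complex_measurableM.
have le1 : (L1norm mu (fun x => m x * Lp_repr h (tau x))%R <= (c * rnorm h)%:E)%E.
  apply: (@le_trans _ _ (L1norm mu (fun x => (c%:C)%C * (Lp_repr h \o tau) x)%R)).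
    apply: L1norm_le_ae => //.
      by apply: complex_measurableM => //; exact: complex_measurable_cst.
    apply: filterS mc => x mx; rewrite !cabsM cabs_real ger0_norm//.
    by rewrite ler_wpM2r// cabs_ge0.
  rewrite L1normZ// EFinM lee_wpmul2l// (L1norm_comp tauP mh).
  by rewrite rnormE L1norm_le_Lpnorm.
by split => //; split => //; apply: le_lt_trans le1 _; rewrite ltry.
Qed.

Lemma pairing_linear : linear (pairing : Lp -> R[i]^o).
Proof.
move=> k f g; rewrite /pairing.
have [fi _] := pairing_cintegrable f; have [gi _] := pairing_cintegrable g.
have [[hm _] _] := pairing_cintegrable (k *: f + g).
transitivity (k * pairing f + pairing g) => //; rewrite -cint_linear//.
apply: cint_ae => //.
  apply: complex_measurableD gi.1 => //; apply: complex_measurableM fi.1.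
  exact: complex_measurable_cst.
apply: filterS (ae_preserving tauP (Lp_reprZD k f g)) => x ->.
by rewrite mulrDr mulrCA.
Qed.

Lemma pairing_le (h : Lp) : cabs (pairing h) <= 2 * c * rnorm h.
Proof.
have [hi le1] := pairing_cintegrable h.
rewrite -lee_fin; apply: le_trans (cabs_cint_le hi) _.
by rewrite -mulrA EFinM lee_wpmul2l// lee_fin.
Qed.

End Functional.

(** * Orbits through a recurrence set *)

Lemma complex_measurableV {d : measure_display} {T : measurableType d}
    {R : realType} (f : T -> R[i]) : complex_measurable f ->
  complex_measurable (fun x => (f x)^-1).
Proof.
move=> mf; have [mR mI] := mf.
have mN : measurable_fun setT (fun x => (cabs (f x) ^+ 2)^-1).
  rewrite (_ : (fun x => _) = (@powR R)^~ (-1) \o (fun x => cabs (f x) ^+ 2)).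
    apply: (measurableT_comp (measurable_powR _)).
    by apply: measurable_funX; exact: measurable_cabs.
  by apply/funext => x; rewrite /= powR_inv1// sqr_ge0.
have cabs2 z : cabs z ^+ 2 = complex.Re z ^+ 2 + complex.Im z ^+ 2 :> R.
  by case: z => a b; rewrite /cabs /= sqr_sqrtr// addr_ge0 ?sqr_ge0.
split.
  rewrite (_ : (fun x => _) = (fun x => complex.Re (f x) * (cabs (f x) ^+ 2)^-1)).
    exact: measurable_funM.
  by apply/funext => x; rewrite cabs2; case: (f x).
rewrite (_ : (fun x => _) = (fun x => - complex.Im (f x) * (cabs (f x) ^+ 2)^-1)).
  by apply: measurable_funM => //; exact: measurableT_comp.
by apply/funext => x; rewrite cabs2; case: (f x) => a b /=; rewrite mulNr.
Qed.

Section MeasureUpToNull.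
Context {d : measure_display} {T : measurableType d} {R : realType}.
Variable mu : {measure set T -> \bar R}.

Lemma measure_le_setU (A B : set T) : measurable A -> measurable B ->
  (mu (A `|` B) <= mu A + mu B)%E.
Proof. exact: measureU2. Qed.

Lemma measure_le_bigcup (F : nat -> set T) : (forall n, measurable (F n)) ->
  (mu (\bigcup_n F n) <= \sum_(n <oo) mu (F n))%E.
Proof.
move=> mF; apply: measure_sigma_subadditive => //; exact: bigcup_measurable.
Qed.

Lemma measure_le_null (A B M : set T) : measurable A -> measurable B ->
  measurable M -> mu M = 0%E -> (forall x, ~ M x -> A x -> B x) ->
  (mu A <= mu B)%E.
Proof.
move=> mA mB mM M0 AB; apply: (@le_trans _ _ (mu (B `|` M))).
  apply: le_measure; rewrite ?inE//; first exact: measurableU.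
  by move=> x Ax; have [Mx|Mx] := pselect (M x); [right|left; exact: AB].
by apply: le_trans (measure_le_setU mB mM) _; rewrite M0 adde0.
Qed.

End MeasureUpToNull.

Section Recurrence.
Context {d : measure_display} {T : measurableType d} {R : realType}.
Variable mu : {measure set T -> \bar R}.
Hypothesis mu1 : mu setT = 1%E.
Variables (p : \bar R) (p1 : (1 <= p)%E) (tau : T -> T) (v : T -> R[i]).
Hypothesis tauP : measure_preserving mu tau.
Hypothesis vL : in_Lp mu +oo v.
Hypothesis v0 : \forall x \ae mu, v x != 0.
Variable kappa : R.
Hypothesis kappa0 : 0 < kappa.

Definition cocycle n (x : T) : R[i] :=
  \prod_(k < n) (v (iter k tau x) / kappa%:C%C).

Lemma cocycle0 x : cocycle 0 x = 1.
Proof. by rewrite /cocycle big_ord0. Qed.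

Lemma cocycleSr n x : cocycle n.+1 x = cocycle n x * (v (iter n tau x) / kappa%:C%C).
Proof. by rewrite /cocycle big_ord_recr. Qed.

Lemma cocycleS n x : cocycle n.+1 x = v x / kappa%:C%C * cocycle n (tau x).
Proof.
rewrite /cocycle big_ord_recl /=; congr (_ * _).
by apply: eq_bigr => i _; rewrite /bump /= add0n -iterS iterSr.
Qed.

Let kappaC : kappa%:C%C != 0 :> R[i].
Proof. by rewrite -cabs_eq0 cabs_real normr_eq0 gt_eqF. Qed.

Lemma complex_measurable_cocycle n : complex_measurable (cocycle n).
Proof.
elim: n => [|n IH].
  rewrite (_ : cocycle 0 = fun=> 1); first exact: complex_measurable_cst.
  by apply/funext => x; rewrite cocycle0.
rewrite (_ : cocycle n.+1 = fun x => cocycle n x * ((v \o iter n tau) x * (kappa%:C%C)^-1)).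
  apply: complex_measurableM => //; apply: complex_measurableM; last exact: complex_measurable_cst.
  by apply: complex_measurable_comp; [exact: (measure_preserving_iter tauP n).1|case: vL].
by apply/funext => x; rewrite cocycleSr.
Qed.

Variable r : nat -> R.

Definition bad n : set T :=
  [set x | ~ (expR (- r n) <= cabs (cocycle n x) <= expR (r n))].

Lemma measurable_bad n : measurable (bad n).
Proof.
have mc := measurable_cabs (complex_measurable_cocycle n).
rewrite (_ : bad n = ~` ([set x | expR (- r n) <= cabs (cocycle n x)] `&`
                         [set x | cabs (cocycle n x) <= expR (r n)])).
  apply: measurableC; apply: measurableI; rewrite -[X in measurable X]setTI.
    exact: measurable_fun_le.
  exact: measurable_fun_le.
apply/seteqP; split=> x /= h.
  by move=> [h1 h2]; apply: h; rewrite h1.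
by move=> /andP.
Qed.

Hypothesis dense : forall (h : Lp_space mu p1) (e : R), 0 < e ->
  exists k, rnorm (h - weighted_composition v tau k) < e.
Hypothesis bad_small : (\sum_(n <oo) mu (bad n) <= (4^-1)%:E)%E.
Hypothesis returns : forall N, exists I : nat -> set T,
  (forall k, measurable (I k)) /\
  \forall x \ae mu, exists k, I k x /\
    forall n, (0 < n <= N)%N -> ~ I k (iter n tau x).

(** The points that are not bad have measure at least 3 / 4.  As for the past, the
    indicator function of bad n is of the form G o tau^n, so that there is a set
    bad' n of the same measure, the preimage of which under tau^n is bad n; to avoid
    all the sets bad' n costs at most another 1 / 4.  One of the countably many sets
    I k then meets the remaining half of the space in a set of positive measure. *)
Lemma exists_good_set N : exists E : set T,
  [/\ measurable E, (0 < mu E)%E, forall x n, E x -> ~ bad n x,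
    (\forall x \ae mu, forall n, E (iter n tau x) -> ~ bad n x) &
    forall x n, E x -> (0 < n <= N)%N -> ~ E (iter n tau x)].
Proof.
have mI n (A : set T) : measurable A -> measurable (iter n tau @^-1` A).
  by move=> mA; rewrite -[X in measurable X]setTI; apply: (measure_preserving_iter tauP n).1.
have hG n : exists G : T -> R[i], [/\ complex_measurable G, forall x, cabs (G x) <= 1 &
    \forall x \ae mu, G (iter n tau x) = ind (bad n) x].
  apply: (comp_surj mu1 tauP vL v0 dense) => //.
    exact/complex_measurable_ind/measurable_bad.
  by apply: nearW => x; exact: cabs_ind_le1.
have [G GP] := choice hG.
pose bad' n := [set x | 2^-1 <= complex.Re (G n x)].
have mbad' n : measurable (bad' n).
  rewrite -[X in measurable X]setTI; apply: measurable_fun_le => //.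
  by case: (GP n) => -[].
have bad'P n : \forall x \ae mu, bad' n (iter n tau x) <-> bad n x.
  case: (GP n) => _ _; apply: filterS => x; rewrite /bad' /= => ->.
  have [bx|nbx] := pselect (bad n x); split=> //.
  - by move=> _; rewrite indT//=; lra.
  - by rewrite indF//=; lra.
have mubad' n : mu (bad' n) = mu (bad n).
  rewrite -(measure_preserving_iter tauP n).2//.
  have [M [mM M0 hM]] := bad'P n.
  have hM' x : ~ M x -> (bad' n (iter n tau x) <-> bad n x).
    by move=> nM; apply: contrapT => h; apply: nM; apply: hM.
  apply/eqP; rewrite eq_le; apply/andP; split; apply: (measure_le_null _ _ mM M0) => //.
  - exact: mI.
  - exact: measurable_bad.
  - by move=> x /hM'[h _]; exact: h.
  - exact: measurable_bad.
  - exact: mI.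
  - by move=> x /hM'[_ h]; exact: h.
pose E0 := ~` ((\bigcup_n bad n) `|` (\bigcup_n bad' n)).
have mB : measurable ((\bigcup_n bad n) `|` (\bigcup_n bad' n)).
  apply: measurableU; apply: bigcup_measurable => n _ //.
  exact: measurable_bad.
have mE0 : measurable E0 by exact: measurableC.
have E0pos : (0 < mu E0)%E.
  have half : (mu ((\bigcup_n bad n) `|` (\bigcup_n bad' n)) <= (2^-1)%:E)%E.
    apply: le_trans (measure_le_setU _ _ _) _.
    - by apply: bigcup_measurable => n _; exact: measurable_bad.
    - exact: bigcup_measurable.
    rewrite (_ : 2^-1 = 4^-1 + 4^-1 :> R); last by field.
    rewrite EFinD; apply: leeD.
      by apply: le_trans (measure_le_bigcup _ _) bad_small => n; exact: measurable_bad.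
    apply: le_trans (measure_le_bigcup _ _) _ => //.
    by apply: le_trans bad_small; rewrite (eq_eseriesr (fun n _ => mubad' n)).
  have [//|E00] := ltP 0%E (mu E0).
  have : (mu setT <= (2^-1)%:E)%E.
    rewrite -(setUv ((\bigcup_n bad n) `|` (\bigcup_n bad' n))).
    apply: le_trans (measure_le_setU _ mB mE0) _.
    by rewrite -[leRHS]adde0; apply: leeD.
  by rewrite mu1 lee_fin leNgt invf_lt1// ltr1n.
have [I [mIk Icov]] := returns N.
pose F k := E0 `&` I k `&`
  [set x | forall n, (0 < n <= N)%N -> ~ I k (iter n tau x)].
have mF k : measurable (F k).
  apply: measurableI; first exact: measurableI.
  rewrite (_ : [set x | _] = \bigcap_n (if (0 < n <= N)%N
    then iter n tau @^-1` (~` I k) else setT)).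
    apply: bigcapT_measurable => n; case: ifP => // _.
    by apply: mI; exact: measurableC.
  apply/seteqP; split=> [x h n _|x h n nN]; last by have := h n Logic.I; rewrite nN.
  by case: ifPn => // nN; exact: h.
have [k Fk] : exists k, (0 < mu (F k))%E.
  apply: contrapT => /forallNP F0.
  have F0' k : mu (F k) = 0%E.
    by apply/eqP; rewrite eq_le measure_ge0 andbT leNgt; apply/negP; exact: F0.
  have [M [mM M0 hM]] := Icov.
  have : (mu E0 <= mu (\bigcup_k F k))%E.
    apply: (measure_le_null _ _ mM M0) => //; first exact: bigcup_measurable.
    move=> x nMx E0x.
    have [k [Ikx Ikn]] : exists k, I k x /\ forall n, (0 < n <= N)%N -> ~ I k (iter n tau x).
      by apply: contrapT => h; apply: nMx; apply: hM.
    by exists k => //; split=> // n /= nN; exact: Ikn.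
  apply/negP; rewrite -ltNge; apply: le_lt_trans E0pos.
  apply: le_trans (measure_le_bigcup _ _) _ => //.
  by rewrite eseries0// => n _ _; exact: F0'.
exists (F k); split => //.
- by move=> x n [[E0x _] _] bx; apply: E0x; left; exists n.
- have := ae_foralln bad'P; apply: filterS => x h n [[E0x _] _] bx.
  by apply: E0x; right; exists n => //; apply/h.
- by move=> x n [_ h] nN [[_ Ik] _]; exact: (h n nN).
Qed.

Hypothesis r0 : forall n, 0 <= r n.
Hypothesis rlim : (fun n => r n * (ln n%:R) ^+ 2 / n%:R) @ \oo --> (0 : R).

Local Notation Lp := (Lp_space mu p1).
Local Notation W := (weighted_composition v tau : Lp -> Lp).

Section GoodSet.
Variables (N0 : nat) (E : set T).
Hypotheses (mE : measurable E) (Epos : (0 < mu E)%E).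
Hypothesis Egood : forall x n, E x -> ~ bad n x.
Hypothesis Egood' : \forall x \ae mu, forall n, E (iter n tau x) -> ~ bad n x.
Hypothesis Eret : forall x n, E x -> (0 < n <= N0)%N -> ~ E (iter n tau x).

Let notbad n x : ~ bad n x -> expR (- r n) <= cabs (cocycle n x) <= expR (r n).
Proof. by move=> h; apply: contrapT. Qed.

Let iterP n := measure_preserving_iter tauP n.

Let cocycle_inv_le n x : ~ bad n x -> cabs (cocycle n x)^-1 <= expR (r n).
Proof.
move=> /notbad/andP[h _]; rewrite cabsV -[leRHS]invrK -expRN lef_pV2 ?posrE ?expR_gt0//.
exact: lt_le_trans (expR_gt0 _) h.
Qed.

Let cocycle_neq0 n x : ~ bad n x -> cocycle n x != 0.
Proof.
by move=> /notbad/andP[h _]; rewrite -cabs_gt0 (lt_le_trans (expR_gt0 _) h).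
Qed.

Let fwd n x : R[i] := cocycle n x * ind E (iter n tau x).
Let bwd n x : R[i] := ind E x * (cocycle n x)^-1.

Let mindE n : complex_measurable (fun x => ind E (iter n tau x) : R[i]).
Proof.
exact: complex_measurable_comp (iterP n).1 (complex_measurable_ind mE).
Qed.

Let mcocycleV n : complex_measurable (fun x => (cocycle n x)^-1).
Proof. exact/complex_measurableV/complex_measurable_cocycle. Qed.

(** The n-th function of the orbit of the indicator function of E.  For negative n
    the orbit runs backwards in time, and the function is only known after
    composition with a power of tau. *)
Definition orbit_function (n : int) (X : T -> R[i]) : Prop :=
  match n with
  | Posz k => \forall x \ae mu, X x = cocycle k x * ind E (iter k tau x)
  | Negz k => \forall x \ae mu, X (iter k.+1 tau x) = ind E x * (cocycle k.+1 x)^-1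
  end.

Lemma orbit_exists (n : int) : exists X : T -> R[i],
  [/\ complex_measurable X, forall x, cabs (X x) <= expR (r `|n|%N) &
   orbit_function n X].
Proof.
case: n => k.
  have mf : complex_measurable (fwd k).
    by apply: complex_measurableM; [exact: complex_measurable_cocycle|exact: mindE].
  apply: (clip mf (expR_ge0 _)).
  apply: filterS Egood' => x h; rewrite /fwd.
  have [Ex|nEx] := pselect (E (iter k tau x)).
    by rewrite indT// mulr1; have /notbad/andP[] := h _ Ex.
  by rewrite indF// mulr0 cabs0 expR_ge0.
have mb : complex_measurable (bwd k.+1).
  apply: complex_measurableM; first exact: complex_measurable_ind.
  exact: mcocycleV.
apply: (comp_surj mu1 tauP vL v0 dense k.+1 (expR_ge0 _) mb).
apply: nearW => x; rewrite /bwd; have [Ex|nEx] := pselect (E x).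
  by rewrite indT// mul1r cocycle_inv_le//; exact: Egood.
by rewrite indF// mul0r cabs0 expR_ge0.
Qed.

(** For n >= 0 the n-th functional integrates h o tau^n over E against the cocycle;
    for negative n it is the indicator function of E, instead of h, that is composed
    with a power of tau. *)
Definition functional_mult (n : int) : T -> R[i] :=
  match n with
  | Posz k => fun x => ind E x * cocycle k x
  | Negz k => fun x => ind E (iter k.+1 tau x) * (cocycle k.+1 x)^-1
  end.

Definition functional_shift (n : int) : nat :=
  if n is Posz k then k else 0%N.

Definition functional (n : int) : Lp -> R[i] :=
  pairing (p1 := p1) (iter (functional_shift n) tau) (functional_mult n).

Lemma complex_measurable_functional_mult n : complex_measurable (functional_mult n).
Proof.
case: n => k; apply: complex_measurableM.
- exact: complex_measurable_ind.
- exact: complex_measurable_cocycle.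
- exact: (mindE k.+1).
- exact: mcocycleV.
Qed.

Lemma functional_mult_le n :
  \forall x \ae mu, cabs (functional_mult n x) <= expR (r `|n|%N).
Proof.
case: n => k.
  apply: nearW => x /=; have [Ex|nEx] := pselect (E x).
    by rewrite indT// mul1r; have /notbad/andP[] := @Egood x k Ex.
  by rewrite indF// mul0r cabs0 expR_ge0.
apply: filterS Egood' => x h.
rewrite -[functional_mult _ _]/(ind E (iter k.+1 tau x) * (cocycle k.+1 x)^-1).
have [Ex|nEx] := pselect (E (iter k.+1 tau x)).
  by rewrite indT// mul1r cocycle_inv_le//; exact: h.
by rewrite indF// mul0r cabs0 expR_ge0.
Qed.

Lemma functional_linear n : linear (functional n : Lp -> R[i]^o).
Proof.
exact: (pairing_linear mu1 (iterP _) (complex_measurable_functional_mult n)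
  (expR_ge0 _) (functional_mult_le n)).
Qed.

Lemma functional_le n h : cabs (functional n h) <= 2 * expR (r `|n|%N) * rnorm h.
Proof.
exact: (pairing_le mu1 (iterP _) (complex_measurable_functional_mult n)
  (expR_ge0 _) (functional_mult_le n)).
Qed.

Lemma cintZ c (f : T -> R[i]) : cintegrable mu f -> cint mu (fun x => c * f x) = c * cint mu f.
Proof.
move=> fi; have := cint_linear (c - 1) fi fi; rewrite mulrBl mul1r subrK => <-.
by congr cint; apply/funext => x; rewrite mulrBl mul1r subrK.
Qed.

(** For n < 0 both sides are compared after a composition with tau, which does not
    change the integral. *)
Lemma functional_step n h :
  functional n (W h) = kappa%:C%C * functional (n + 1) h.
Proof.
have Wh := weighted_compositionE vL tauP h.
have [mWh _] := Lp_repr_in_Lp (W h); have [mh _] := Lp_repr_in_Lp h.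
have fint n' (h' : Lp) : cintegrable mu (fun x => functional_mult n' x *
    Lp_repr h' (iter (functional_shift n') tau x)).
  by have [] := pairing_cintegrable mu1 (iterP (functional_shift n'))
    (complex_measurable_functional_mult n') (expR_ge0 _) (functional_mult_le n') h'.
case: n => k.
  rewrite (_ : k%:Z + 1 = k.+1%:Z); last by rewrite -addn1 PoszD.
  rewrite /functional /pairing -cintZ; last exact: fint.
  apply: cint_ae.
  - by case: (fint k (W h)).
  - apply: complex_measurableM; first exact: complex_measurable_cst.
    by case: (fint k.+1 h).
  - apply: filterS (ae_preserving (iterP k) Wh) => x /= ->.
    by rewrite cocycleSr; field.
pose g x : R[i] := ind E (iter k tau x) * (cocycle k x)^-1 * Lp_repr h x.
have gE : functional (Negz k + 1) h = cint mu g.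
  case: k @g => [|k] g.
    rewrite /functional /pairing; congr cint; apply/funext => x.
    by rewrite /g /= !cocycle0 invr1.
  by rewrite (_ : Negz k.+1 + 1 = Negz k)//; lia.
have gi : cintegrable mu g.
  case: k @g gE => [|k] g gE.
    have := fint 0%:Z h; congr cintegrable; apply/funext => x.
    by rewrite /g /= !cocycle0 invr1.
  exact: (fint (Negz k) h).
rewrite gE -(cint_comp tauP gi) -cintZ; last exact: cintegrable_comp.
rewrite /functional /pairing; apply: cint_ae.
- by case: (fint (Negz k) (W h)).
- apply: complex_measurableM; first exact: complex_measurable_cst.
  by case: (cintegrable_comp tauP gi).
- apply: filterS2 Wh v0 => x Wx vx.
  rewrite -[functional_mult _ _]/(ind E (iter k.+1 tau x) * (cocycle k.+1 x)^-1).
  rewrite -[iter (functional_shift (Negz k)) tau x]/x Wx /g /= -iterSr /= cocycleS invfM.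
  move: (cocycle k (tau x))^-1 => ci.
  by field; rewrite vx kappaC.
Qed.

Section Orbit.
Variable X : int -> T -> R[i].
Hypothesis mX : forall n, complex_measurable (X n).
Hypothesis X_le : forall n x, cabs (X n x) <= expR (r `|n|%N).
Hypothesis XE : forall n, orbit_function n (X n).

Let orbit n : Lp := Lp_class mu p1 (X n).

Let XL n : in_Lp mu p (X n).
Proof.
by apply: (bounded_in_Lp mu1 p1 (mX n) (expR_ge0 (r `|n|%N))); exact: nearW.
Qed.

Let orbitE n : \forall x \ae mu, Lp_repr (orbit n) x = X n x.
Proof. exact: Lp_classE. Qed.

Lemma Lp_reprZ (c : R[i]) (h : Lp) : \forall x \ae mu, Lp_repr (c *: h) x = c * Lp_repr h x.
Proof.
apply: filterS2 (Lp_reprZD c h 0) (@Lp_repr0 _ _ _ mu p p1) => x.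
by rewrite addr0 => -> ->; rewrite addr0.
Qed.

Lemma rnorm_orbit n : rnorm (orbit n) <= expR (r `|n|%N).
Proof.
rewrite -lee_fin (rnorm_ae (mX n) (orbitE n)).
by apply: (Lpnorm_bounded mu1 p1 (mX n) (expR_ge0 _)); exact: nearW.
Qed.

(** A measurable set is null as soon as its preimage under tau^k is. *)
Lemma ae_eq_iter k (f g : T -> R[i]) : complex_measurable f -> complex_measurable g ->
  (\forall x \ae mu, f (iter k tau x) = g (iter k tau x)) ->
  \forall x \ae mu, f x = g x.
Proof.
move=> mf mg fg.
have mfg : complex_measurable (fun x => f x + -1 * g x).
  by apply: complex_measurableD => //; apply: complex_measurableM.
have := @ae_comp_inv _ _ _ mu _ (iterP k) _ (measurable_cabs_le 0 mfg).
move=> H; apply: filterS (H _) => [x /=|].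
  move=> h; apply/eqP; rewrite -subr_eq0 -cabs_eq0 -mulN1r.
  by rewrite eq_le h cabs_ge0.
by apply: filterS fg => x /= ->; rewrite mulN1r subrr cabs0.
Qed.

Lemma orbit_step n : W (orbit n) = kappa%:C%C *: orbit (n + 1).
Proof.
suff core : \forall x \ae mu, v x * X n (tau x) = kappa%:C%C * X (n + 1) x.
  apply/Lp_eqP.
  apply: filterS (filterI (filterI (weighted_compositionE vL tauP (orbit n))
     (ae_preserving tauP (orbitE n))) (filterI core (filterI (Lp_reprZ kappa%:C%C (orbit (n + 1)))
     (orbitE (n + 1))))) => x [[e1 e2] [e3 [e4 e5]]].
  by rewrite e1 e2 e3 e4 e5.
case: n => k.
  rewrite (_ : k%:Z + 1 = k.+1%:Z); last by rewrite -addn1 PoszD.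
  apply: filterS2 (ae_preserving tauP (XE k%:Z)) (XE k.+1%:Z) => x -> ->.
  rewrite cocycleS iterSr.
  by field.
have X1 : \forall x \ae mu, X (Negz k + 1) (iter k tau x) = ind E x * (cocycle k x)^-1.
  case: k => [|k].
    by apply: filterS (XE 0%:Z) => x /= ->; rewrite cocycle0 mulrC invr1.
  by rewrite (_ : Negz k.+1 + 1 = Negz k); [exact: (XE (Negz k))|lia].
apply: (@ae_eq_iter k).
- apply: complex_measurableM; first by case: vL.
  exact: complex_measurable_comp tauP.1 (mX _).
- by apply: complex_measurableM; first exact: complex_measurable_cst.
apply: filterS2 X1 (XE (Negz k)) => x -> /= ->; rewrite cocycleSr.
have [Ex|nEx] := pselect (E x); last by rewrite indF// !mul0r !mulr0.
have := cocycle_neq0 (@Egood x k.+1 Ex); rewrite cocycleSr mulf_eq0 negb_or.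
move=> /andP[c0]; rewrite mulf_eq0 negb_or => /andP[vx _].
by field; rewrite c0 vx kappaC.
Qed.

Lemma functional0E h : functional 0 h = cint mu (fun x => ind E x * Lp_repr h x).
Proof.
rewrite /functional /pairing; congr cint; apply/funext => x /=.
by rewrite cocycle0 mulr1.
Qed.

Let mEX n : complex_measurable (fun x => ind E x * X n x).
Proof. by apply: complex_measurableM => //; exact: complex_measurable_ind. Qed.

Lemma functional0_orbit n :
  functional 0 (orbit n) = cint mu (fun x => ind E x * X n x).
Proof.
rewrite functional0E; apply: cint_ae => //.
  apply: complex_measurableM; first exact: complex_measurable_ind.
  by case: (Lp_repr_in_Lp (orbit n)).
by apply: filterS (orbitE n) => x ->.
Qed.

Let gam := fine (mu E).

Let muEfin : mu E \is a fin_num.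
Proof.
rewrite ge0_fin_numE ?measure_ge0//; apply: (@le_lt_trans _ _ (mu setT)).
  by apply: le_measure; rewrite ?inE.
by rewrite mu1 ltry.
Qed.

Let L1ind : L1norm mu (ind E : T -> R[i]) = gam%:E.
Proof.
rewrite fineK// -[E in RHS](setIT E) -integral_indic//.
apply: eq_integral => x _; congr EFin.
by rewrite /ind cabs_real ger0_norm.
Qed.

Lemma functional0_orbit_le n :
  cabs (functional 0 (orbit n)) <= 2 * gam * expR (r `|n|%N).
Proof.
have h : (L1norm mu (fun x => ind E x * X n x)%R <= (gam * expR (r `|n|%N))%:E)%E.
  rewrite mulrC EFinM -L1ind -(L1normZ mu (complex_measurable_ind mE) (expR_ge0 _)).
  apply: L1norm_le_ae => //.
    apply: complex_measurableM; last exact: complex_measurable_ind.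
    exact: complex_measurable_cst.
  apply: nearW => x; rewrite !cabsM cabs_real ger0_norm ?expR_ge0// mulrC.
  by rewrite ler_wpM2r ?cabs_ge0.
rewrite functional0_orbit -lee_fin.
apply: le_trans (cabs_cint_le _) _.
  by split => //; apply: le_lt_trans h _; rewrite ltry.
by rewrite -mulrA EFinM lee_wpmul2l.
Qed.

Lemma functional0_orbit_ret n : (0 < `|n|)%N -> (`|n| <= N0)%N ->
  functional 0 (orbit n) = 0.
Proof.
move=> n0 nN; rewrite functional0_orbit.
have m0 : complex_measurable ((fun=> 0) : T -> R[i]) by exact: complex_measurable_cst.
rewrite (@cint_ae _ _ _ mu _ (fun=> 0))//.
  rewrite /cint /Rintegral /= integral0_eq//.
case: n n0 nN => k k0 kN.
  apply: filterS (XE k%:Z) => x ->.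
  have [Ex|nEx] := pselect (E x); last by rewrite indF// mul0r.
  by rewrite (indF (Eret Ex _)) ?mulr0//; apply/andP.
apply: (@ae_eq_iter k.+1) => //.
apply: filterS (XE (Negz k)) => x ->.
have [Ex|nEx] := pselect (E x); last by rewrite (indF nEx) mul0r mulr0.
by rewrite (indF (Eret Ex _)) ?mul0r//; apply/andP.
Qed.

Lemma functional0_orbit0 : cabs (functional 0 (orbit 0)) = gam.
Proof.
rewrite functional0_orbit (@cint_ae _ _ _ mu _ (ind E))//; last 2 first.
- exact: complex_measurable_ind.
- apply: filterS (XE 0%:Z) => x -> /=; rewrite cocycle0 mul1r.
  have [Ex|nEx] := pselect (E x); first by rewrite indT// mulr1.
  by rewrite indF// mul0r.
have -> : cint mu (ind E) = gam%:C%C :> R[i].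
  rewrite /cint /Rintegral /= [X in (_ +i* fine X)%C]integral0_eq//.
  by rewrite integral_indic// setIT.
by rewrite cabs_real ger0_norm// fine_ge0.
Qed.

Lemma Lp_repr_sum (s : seq int) (a : int -> R[i]) : \forall x \ae mu,
  Lp_repr (\sum_(n <- s) a n *: orbit n) x = \sum_(n <- s) a n * X n x.
Proof.
elim: s => [|n s IH].
  by rewrite big_nil; apply: filterS (@Lp_repr0 _ _ _ mu p p1) => x ->; rewrite big_nil.
rewrite big_cons.
apply: filterS2 (filterI IH (orbitE n)) (Lp_reprZD (a n) (orbit n)
  (\sum_(j <- s) a j *: orbit j)) => x [e1 e2] ->.
by rewrite big_cons e1 e2.
Qed.

(** The series converges absolutely at every point, and its remainders are bounded
    by the tails of the dominating series; the limit in L^p norm is the class of the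
    pointwise sum. *)
Lemma orbit_series (a : int -> R[i]) (al : nat -> R) :
  (forall n, cabs (a n) * expR (r `|n|%N) <= al `|n|%N) ->
  cvgn (fun N => \sum_(n <- zbox N) al `|n|%N) ->
  exists w : Lp, (fun N => rnorm (w - \sum_(n <- zbox N) a n *: orbit n)) @ \oo --> (0 : R).
Proof.
move=> aal Acvg; set A := fun N => \sum_(n <- zbox N) al `|n|%N in Acvg.
have al0 n : 0 <= al n.
  by apply: le_trans (aal n%:Z); rewrite mulr_ge0 ?cabs_ge0 ?expR_ge0.
have Amono : {homo A : x y / (x <= y)%N >-> x <= y}.
  by move=> x y xy; apply: ler_zbox.
have Ale N : A N <= limn A by exact: nondecreasing_cvgn_le.
have aX n x : cabs (a n * X n x) <= al `|n|%N.
  by rewrite cabsM; apply: le_trans (aal n); rewrite ler_wpM2l ?cabs_ge0.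
have [S SP] := choice (fun x => box_series (fun n => aX n x) Acvg).
have mS : complex_measurable S.
  split.
    apply: (@measurable_fun_cvg _ _ _ _ (fun N x => \sum_(n <- zbox N) complex.Re (a n * X n x))).
      move=> N; apply: measurable_sum => n.
      by case: (complex_measurableM (complex_measurable_cst T (a n)) (mX n)).
    by move=> x _; case: (SP x).
  apply: (@measurable_fun_cvg _ _ _ _ (fun N x => \sum_(n <- zbox N) complex.Im (a n * X n x))).
    move=> N; apply: measurable_sum => n.
    by case: (complex_measurableM (complex_measurable_cst T (a n)) (mX n)).
  by move=> x _; case: (SP x).
have l0 : 0 <= limn A by apply: le_trans (Ale 0%N); exact: sumr_ge0.
have SL : in_Lp mu p S.
  apply: (bounded_in_Lp mu1 p1 mS (c := 2 * limn A + limn A)).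
    by rewrite addr_ge0// mulr_ge0.
  apply: nearW => x; case: (SP x) => _ _ /(_ 0%N) h.
  rewrite -[S x](subrK (\sum_(n <- zbox 0) a n * X n x)).
  apply: le_trans (cabsD _ _) _; apply: lerD.
    apply: le_trans h _; rewrite ler_pM2l// gerBl; exact: sumr_ge0.
  rewrite zbox0; apply: le_trans (aX 0 x) _; apply: le_trans _ (Ale 0%N).
  by rewrite /A zbox0.
exists (Lp_class mu p1 S).
apply: (@squeeze_cvgr _ _ _ _ (fun=> 0) (fun N => 2 * (limn A - A N))).
- apply: nearW => N; rewrite rnorm_ge0 /=.
  have mD : complex_measurable (fun x => S x + -1 * \sum_(n <- zbox N) a n * X n x).
    apply: complex_measurableD => //; apply: complex_measurableM.
      exact: complex_measurable_cst.
    elim: (zbox N) => [|n s IH].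
      by under eq_fun do rewrite big_nil; exact: complex_measurable_cst.
    under eq_fun do rewrite big_cons.
    apply: complex_measurableD => //.
    by apply: complex_measurableM; first exact: complex_measurable_cst.
  rewrite -lee_fin (rnorm_ae mD); last first.
    apply: filterS (filterI (Lp_reprB (Lp_class mu p1 S) (\sum_(n <- zbox N) a n *: orbit n))
      (filterI (Lp_classE p1 SL) (Lp_repr_sum (zbox N) a))) => x [-> [-> ->]].
    by rewrite mulN1r.
  apply: (Lpnorm_bounded mu1 p1 mD).
    by rewrite mulr_ge0// subr_ge0.
  by apply: nearW => x; rewrite mulN1r; case: (SP x) => _ _ /(_ N).
- exact: cvg_cst.
- rewrite [X in _ --> X](_ : 0 = 2 * (limn A - limn A)); last by rewrite subrr mulr0.
  by apply: cvgM; [exact: cvg_cst|apply: cvgB => //; exact: cvg_cst].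
Qed.

End Orbit.

End GoodSet.

(** The set E is chosen after N0, which only depends on the series of the
    weights. *)
Lemma hyperinvariant_of_dense_range :
  exists M, nontrivial_hyperinvariant_subspace W M.
Proof.
pose al n := decay n * expR (r n).
have al0 n : 0 <= al n by rewrite mulr_ge0 ?decay_ge0 ?expR_ge0.
have Acvg : cvgn (fun N => \sum_(n <- zbox N) al `|n|%N) by exact: cvgn_decay_expR.
set A := fun N => \sum_(n <- zbox N) al `|n|%N in Acvg.
have Amono : {homo A : x y / (x <= y)%N >-> x <= y}.
  by move=> x y xy; apply: ler_zbox.
have Ale N : A N <= limn A by exact: nondecreasing_cvgn_le.
have [a [b [a0 b0 aal bal ab0]]] := @annihilating_pair R.
have [N0 tail] : exists N0, limn A - A N0 <= 4^-1.
  have /cvgrPdist_le/(_ 4^-1) := Acvg; rewrite invr_gt0 => /(_ (ltr0n _ 4))[N0 _ h].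
  by exists N0; apply: le_trans (h N0 (leqnn _)); exact: ler_norm.
have [E [mE Epos Egood Egood' Eret]] := exists_good_set N0.
have [X XP] := choice (orbit_exists mE Egood Egood').
have mX n : complex_measurable (X n) by case: (XP n).
have X_le n x : cabs (X n x) <= expR (r `|n|%N) by case: (XP n).
have XE n : orbit_function E n (X n) by case: (XP n).
have aal' (s : int -> R[i]) : (forall n, cabs (s n) <= decay `|n|%N) ->
    forall n, cabs (s n) * expR (r `|n|%N) <= al `|n|%N.
  by move=> h n; rewrite ler_wpM2r ?expR_ge0.
have [w wlim] := orbit_series mX X_le (aal' a aal) Acvg.
have muEfin : mu E \is a fin_num.
  rewrite ge0_fin_numE ?measure_ge0//; apply: (@le_lt_trans _ _ (mu setT)).
    by apply: le_measure; rewrite ?inE.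
  by rewrite mu1 ltry.
apply: (@hyperinvariant_of_returning_orbits R Lp W kappa%:C%C
  (fun n => Lp_class mu p1 (X n)) (functional E) a b (fun n => expR (r n)) al 2
  (fine (mu E)) w N0) => //.
- exact: functional_linear mE Egood Egood'.
- by move=> n; have := orbit_step Epos Egood mX X_le XE n.
- exact: functional_step mE Epos Egood Egood'.
- exact: rnorm_orbit mX X_le.
- exact: functional_le mE Egood Egood'.
- exact: aal'.
- exact: aal'.
- by move=> N _; apply: le_trans tail; rewrite lerD2r; exact: Ale.
- by rewrite fine_gt0// Epos /= -ge0_fin_numE ?measure_ge0.
- by have := functional0_orbit0 mE mX X_le XE.
- by move=> n n0 nN; have := functional0_orbit_ret mE Eret mX X_le XE n0 nN.
- by move=> n; have := functional0_orbit_le mE mX X_le n.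
Qed.

End Recurrence.

(** The dichotomy on the range of the operator: either its closure is a proper
    subspace, or [hyperinvariant_of_dense_range] applies. *)
Theorem hyperinvariant_weighted_composition {d : measure_display}
    {T : measurableType d} {R : realType} (mu : {measure set T -> \bar R})
    (p : \bar R) (p1 : (1 <= p)%E) (tau : T -> T) (v : T -> R[i])
    (kappa : R) (r : nat -> R) :
  mu setT = 1%E -> measure_preserving mu tau -> in_Lp mu +oo v ->
  (\forall x \ae mu, v x != 0) -> 0 < kappa -> (forall n, 0 <= r n) ->
  (fun n => r n * (ln n%:R) ^+ 2 / n%:R) @ \oo --> (0 : R) ->
  (\sum_(n <oo) mu (bad tau v kappa r n) <= (4^-1)%:E)%E ->
  (forall N, exists I : nat -> set T, (forall k, measurable (I k)) /\
    \forall x \ae mu, exists k, I k x /\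
      forall n, (0 < n <= N)%N -> ~ I k (iter n tau x)) ->
  exists M : set (Lp_space mu p1),
    nontrivial_hyperinvariant_subspace (weighted_composition v tau) M.
Proof.
move=> mu1 tauP vL v0 kappa0 r0 rlim bad_small returns.
have [dense|] := pselect (forall (h : Lp_space mu p1) (e : R), 0 < e ->
  exists k, rnorm (h - weighted_composition v tau k) < e).
  exact: hyperinvariant_of_dense_range bad_small returns r0 rlim.
move=> /existsNP[h] /existsNP[e] /not_implyP[e0] /forallNP hT.
apply: (@hyperinvariant_closure_range R (Lp_space mu p1) (weighted_composition v tau)
  (Lp_class mu p1 (fun=> 1)) h e) => //.
- by case: (weighted_composition_bounded p1 vL tauP).
- exact: weighted_composition1_neq0.
- by move=> g; rewrite leNgt; apply/negP; exact: hT.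
Qed.

(** * Averages of logarithms along uniformly distributed points *)

Section Koksma.
Context {R : realType}.

(** The indicators I k stand for the nested conditions k eta <= g, so that eta times
    the number of those that hold is g rounded down to a multiple of eta. *)
Lemma layer_cake (eta g : R) (I : nat -> bool) K : 0 <= eta -> 0 <= g ->
  (forall k, I k -> k%:R * eta <= g) -> (forall k, ~~ I k -> g <= k%:R * eta) ->
  g <= K%:R * eta ->
  eta * \sum_(1 <= k < K.+1) (I k)%:R <= g <= eta * \sum_(1 <= k < K.+1) (I k)%:R + eta.
Proof.
move=> eta0 g0 Ilow Iup gK.
pose c m : R := \sum_(1 <= k < m.+1) (I k)%:R.
have cS m : c m.+1 = c m + (I m.+1)%:R by rewrite /c big_nat_recr.
have c0 : c 0%N = 0 by rewrite /c big_geq.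
have cle m : c m <= m%:R.
  elim: m => [|m IH]; first by rewrite c0.
  by rewrite cS -[m.+1]addn1 natrD lerD//; case: (I _).
have low m : eta * c m <= g.
  elim: m => [|m IH]; first by rewrite c0 mulr0.
  case: (boolP (I m.+1)) => Im.
    by apply: le_trans (Ilow _ Im); rewrite mulrC ler_wpM2r.
  by rewrite cS (negbTE Im) addr0.
have up m : c m = m%:R \/ g <= eta * c m + eta.
  elim: m => [|m [IH|IH]]; first by left.
    case: (boolP (I m.+1)) => Im.
      by left; rewrite cS Im IH -[m.+1]addn1 natrD.
    right; rewrite cS (negbTE Im) addr0 IH; apply: le_trans (Iup _ Im) _.
    by rewrite -[m.+1]addn1 natrD; lra.
  right; apply: le_trans IH _; rewrite lerD2r ler_wpM2l// cS lerDl.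
  by case: (I _).
rewrite -/(c K) low /=; have [->|//] := up K.
by apply: le_trans gK _; rewrite mulrC lerDl.
Qed.

(** A Riemann sum of exp (- x), the integral of which over the positive half-line
    is 1. *)
Lemma geometric_riemann (eta : R) K : 0 <= eta -> eta <= 1 ->
  `|eta * \sum_(1 <= k < K.+1) expR (- (k%:R * eta)) - 1| <= eta + expR (- (K%:R * eta)).
Proof.
move=> eta0 eta1.
have h1 : eta <= expR eta - 1 by have := expR_ge1Dx eta; lra.
have h2 : (1 - eta) * (expR eta - 1) <= eta.
  have := expR_ge1Dx (- eta); have := expRxMexpNx_1 eta.
  have e0 := expR_gt0 eta; have e1 := expR_gt0 (- eta); nra.
pose q m := expR (- (m%:R * eta)).
have qS m : q m = q m.+1 * expR eta.
  by rewrite /q -expRD; congr expR; rewrite -[m.+1]addn1 natrD; lra.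
have q0 m : 0 < q m by exact: expR_gt0.
have S m : (1 - eta) * (1 - q m) <= eta * \sum_(1 <= k < m.+1) q k <= 1 - q m.
  elim: m => [|m /andP[l u]].
    by rewrite big_geq// /q mul0r oppr0 expR0 subrr !mulr0 lexx.
  rewrite big_nat_recr//= mulrDr.
  have := q0 m.+1; have := qS m => qm qm0.
  by apply/andP; split; rewrite qm in l u; nra.
have /andP[l u] := S K; have := q0 K; rewrite -/(q K) => qK.
rewrite ler_norml; apply/andP; split; first nra.
by lra.
Qed.

(** The s n are the distances of points to a singularity; the indicator J k n says
    that s n lies in the interval of length l exp (- k eta) next to the singularity.
    The hypotheses leave open on which side of the singularity the points lie. *)
Section OneSided.
Variables (N : nat) (s : nat -> R) (l D delta eta : R) (K : nat).
Variable J : nat -> nat -> bool.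
Hypotheses (N0 : (0 < N)%N) (l0 : 0 < l) (l1 : l <= 1) (delta0 : 0 < delta).
Hypotheses (eta0 : 0 < eta) (eta1 : eta <= 1) (D0 : 0 <= D).
Hypothesis Kdelta : - ln delta <= K%:R * eta.
Hypothesis s_ge : forall n, (1 <= n <= N)%N -> J 0 n -> delta <= s n <= l.
Hypothesis J_mono : forall k n, J k n -> J 0 n.
Hypothesis Jlow : forall k n, J k n -> s n <= l * expR (- (k%:R * eta)).
Hypothesis Jup : forall k n, J 0 n -> ~~ J k n -> l * expR (- (k%:R * eta)) <= s n.
Hypothesis Jcount : forall k,
  `|(\sum_(1 <= n < N.+1) (J k n)%:R) / N%:R - l * expR (- (k%:R * eta))| <= D.

(** By [layer_cake], the average of ln l - ln (s n) is, up to eta, eta times a sum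
    over k of the frequencies of the intervals J k.  These frequencies are l exp (- k
    eta) up to D, and K levels suffice because the points stay delta away from the
    singularity. *)
Lemma one_sided_log_average :
  `|(\sum_(1 <= n < N.+1) (J 0 n)%:R * ln (s n)) / N%:R - (l * ln l - l)| <=
  K%:R * eta * D + 2 * eta + delta + `|ln l| * D.
Proof.
have NR : (0 : R) < N%:R by rewrite ltr0n.
pose g n := ln l - ln (s n).
have lexp k : ln (l * expR (- (k%:R * eta))) = ln l - k%:R * eta.
  by rewrite lnM ?posrE ?expR_gt0// expRK.
have gb n : (1 <= n <= N)%N -> J 0 n ->
    eta * \sum_(1 <= k < K.+1) (J k n)%:R <= g n <= eta * \sum_(1 <= k < K.+1) (J k n)%:R + eta.
  move=> nN J0; have /andP[ds sl] := s_ge nN J0.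
  have s0 : 0 < s n by apply: lt_le_trans ds.
  apply: (@layer_cake eta (g n) (J^~ n) K).
  - exact: ltW.
  - by rewrite subr_ge0 ler_ln ?posrE.
  - move=> k /Jlow h; have : ln (s n) <= ln (l * expR (- (k%:R * eta))).
      by rewrite ler_ln ?posrE// mulr_gt0// expR_gt0.
    by rewrite lexp /g; lra.
  - move=> k /(Jup J0) h; have : ln (l * expR (- (k%:R * eta))) <= ln (s n).
      by rewrite ler_ln ?posrE// mulr_gt0// expR_gt0.
    by rewrite lexp /g; lra.
  - have : ln delta <= ln (s n) by rewrite ler_ln ?posrE.
    have : ln l <= 0 by exact: ln_le0.
    move: Kdelta; rewrite /g; set x := K%:R * eta; lra.
pose P := \sum_(1 <= n < N.+1) (J 0 n)%:R : R.
pose G := \sum_(1 <= n < N.+1) (J 0 n)%:R * g n.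
pose S := \sum_(1 <= n < N.+1) eta * \sum_(1 <= k < K.+1) (J k n)%:R : R.
have GS : S <= G <= S + N%:R * eta.
  have gb' n : (1 <= n < N.+1)%N -> eta * \sum_(1 <= k < K.+1) (J k n)%:R <=
      (J 0 n)%:R * g n <= eta * \sum_(1 <= k < K.+1) (J k n)%:R + eta.
    move=> nN; case: (boolP (J 0 n)) => J0; first by rewrite mul1r gb.
    rewrite big1 ?mulr0 ?mul0r ?lexx ?add0r ?ltW// => k _.
    by case: (boolP (J k n)) => // /J_mono; rewrite (negbTE J0).
  apply/andP; split; first by rewrite /S /G big_nat [leRHS]big_nat; apply: ler_sum => n /gb'/andP[].
  have -> : N%:R * eta = \sum_(1 <= n < N.+1) eta.
    by rewrite sumr_const_nat subn1 /= mulr_natl.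
  rewrite /S -big_split /= /G [leLHS]big_nat [leRHS]big_nat.
  by apply: ler_sum => n /gb'/andP[].
have SD : `|S / N%:R - l| <= K%:R * eta * D + eta + delta.
  have SE : S / N%:R = eta * \sum_(1 <= k < K.+1) ((\sum_(1 <= n < N.+1) (J k n)%:R) / N%:R).
    rewrite /S -mulr_sumr -mulrA; congr (_ * _).
    by rewrite exchange_big /= mulr_suml.
  pose E := eta * \sum_(1 <= k < K.+1) expR (- (k%:R * eta)).
  have d1 : `|S / N%:R - l * E| <= K%:R * eta * D.
    rewrite SE /E mulrCA -mulrBr normrM gtr0_norm// mulr_sumr -sumrB.
    rewrite [leRHS](_ : _ = eta * (K%:R * D)); last by ring.
    rewrite ler_pM2l//; apply: le_trans (ler_norm_sum _ _ _) _.
    apply: (@le_trans _ _ (\sum_(1 <= k < K.+1) D)).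
      by apply: ler_sum => k _; exact: Jcount.
    by rewrite sumr_const_nat subn1 /= mulr_natl.
  have d2 : `|l * E - l| <= eta + delta.
    rewrite -{2}[l]mulr1 -mulrBr normrM gtr0_norm//.
    have h := geometric_riemann K (ltW eta0) eta1; rewrite -/E in h.
    have eK : expR (- (K%:R * eta)) <= delta.
      by rewrite -[leRHS]lnK ?posrE// ler_expR lerNl.
    apply: (@le_trans _ _ (1 * (eta + expR (- (K%:R * eta))))).
      by apply: ler_pM => //; exact: ltW.
    by rewrite mul1r lerD2l.
  rewrite -[S / _ - l](subrKA (l * E)); apply: le_trans (ler_normD _ _) _.
  by rewrite -addrA lerD.
have Gl : `|G / N%:R - l| <= K%:R * eta * D + 2 * eta + delta.
  have GS' : S / N%:R <= G / N%:R <= S / N%:R + eta.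
    have /andP[h1 h2] := GS; rewrite ler_pM2r ?invr_gt0// h1 /=.
    by rewrite ler_pdivrMr// mulrDl divfK ?gt_eqF// [eta * _]mulrC.
  have /andP[h1 h2] := GS'; move: SD; rewrite !ler_norml => /andP[h3 h4].
  by apply/andP; split; lra.
have PD : `|P / N%:R - l| <= D.
  by have := Jcount 0; rewrite mul0r oppr0 expR0 mulr1.
have -> : (\sum_(1 <= n < N.+1) (J 0 n)%:R * ln (s n)) / N%:R - (l * ln l - l) =
    ln l * (P / N%:R - l) - (G / N%:R - l).
  have -> : \sum_(1 <= n < N.+1) (J 0 n)%:R * ln (s n) = ln l * P - G.
    rewrite /P /G mulr_sumr -sumrB; apply: eq_bigr => n _.
    by rewrite /g; ring.
  by rewrite mulrBl; lra.
apply: le_trans (ler_normB _ _) _; rewrite addrC lerD// normrM.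
by rewrite ler_wpM2l.
Qed.

End OneSided.

(** The integral of ln |t - y| over t between 0 and 1. *)
Definition log_mean (y : R) : R :=
  ((1 - y) * ln (1 - y) - (1 - y)) + (y * ln y - y).

Lemma count_in_sum N (a b : R) (t : nat -> R) :
  (count_in N `[a, b[%classic t)%:R = \sum_(1 <= n < N.+1) (a <= t n < b)%R%:R :> R.
Proof.
rewrite /count_in natr_sum; apply: eq_bigr => n _; congr (_%:R).
by rewrite mem_setE in_itv.
Qed.

(** [one_sided_log_average] to the right and to the left of y, with eta = 1 / N.  It
    is an inequality of Koksma type: |ln delta| is the variation of the logarithm at
    distance delta from its singularity. *)
Lemma koksma_log (N : nat) (t : nat -> R) (y D delta : R) :
  (0 < N)%N -> 0 <= y <= 1 -> 0 <= D -> 0 < delta -> delta <= 1 ->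
  (forall n, (1 <= n <= N)%N -> 0 <= t n < 1 /\ delta <= `|t n - y|) ->
  (forall a b, 0 <= a -> a < b -> b <= 1 ->
    `|(count_in N `[a, b[%classic t)%:R / N%:R - (b - a)| <= D) ->
  `|\sum_(1 <= n < N.+1) ln `|t n - y| - N%:R * log_mean y| <=
    N%:R * ((2 * (1 - ln delta) + `|ln (1 - y)| + `|ln y|) * D + 2 * delta) + 4.
Proof.
move=> N0 /andP[y0 y1] D0 delta0 delta1 tP tD.
have NR : (0 : R) < N%:R by rewrite ltr0n.
have N1 : (1 : R) <= N%:R by rewrite ler1n.
pose eta : R := N%:R^-1.
have eta0 : 0 < eta by rewrite invr_gt0.
have eta1 : eta <= 1 by rewrite invf_le1.
have Neta : N%:R * eta = 1 by rewrite divff// gt_eqF.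
have ld : 0 <= - ln delta by rewrite oppr_ge0 ln_le0.
pose K := (Num.truncn (N%:R * - ln delta)).+1.
have x0 : 0 <= N%:R * - ln delta by rewrite mulr_ge0// ltW.
have /andP[K1 K2] := truncn_itv x0.
have Kdelta : - ln delta <= K%:R * eta.
  by rewrite ler_pdivlMr// mulrC ltW.
have Kup : K%:R * eta <= 1 - ln delta.
  rewrite ler_pdivrMr// /K -natr1; move: K1 N1.
  set x := (Num.truncn _)%:R; set z := ln delta; set M := N%:R; lra.
set side := K%:R * eta * D + 2 * eta + delta.
have sideN : N%:R * side <= N%:R * ((1 - ln delta) * D + delta) + 2.
  rewrite /side; have -> : N%:R * (K%:R * eta * D + 2 * eta + delta) =
    N%:R * (K%:R * eta * D + delta) + 2 * (N%:R * eta) by ring.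
  by rewrite Neta mulr1 lerD2r ler_pM2l// lerD2r ler_wpM2r.
have side0 : 0 <= side.
  rewrite /side; apply: addr_ge0; last exact: ltW.
  by apply: addr_ge0; rewrite !mulr_ge0// ltW.
have e1 k : 0 < expR (- (k%:R * eta)) by exact: expR_gt0.
have e2 k : expR (- (k%:R * eta)) <= 1.
  by rewrite expR_le1 oppr_le0 mulr_ge0// ltW.
have right : `|(\sum_(1 <= n < N.+1) (y <= t n)%R%:R * ln (t n - y)) / N%:R -
    ((1 - y) * ln (1 - y) - (1 - y))| <= side + `|ln (1 - y)| * D.
  have [yE|yN1] := eqVneq y 1.
    rewrite big_nat big1 ?mul0r; last first.
      move=> n nN; have [/andP[_ tn1] _] := tP n nN.
      by rewrite yE leNgt tn1 mul0r.
    by rewrite yE subrr mul0r !subr0 normr0 addr_ge0 ?mulr_ge0.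
  have l0 : 0 < 1 - y by rewrite subr_gt0 lt_neqAle yN1.
  pose J k n := (y <= t n < y + (1 - y) * expR (- (k%:R * eta)))%R.
  have b k : (1 - y) * expR (- (k%:R * eta)) <= 1 - y.
    by rewrite ger_pMr.
  have J0 n : (1 <= n <= N)%N -> J 0 n = (y <= t n)%R.
    move=> nN; have [/andP[_ tn1] _] := tP n nN.
    by rewrite /J mul0r oppr0 expR0 mulr1 subrKC tn1 andbT.
  have -> : \sum_(1 <= n < N.+1) (y <= t n)%R%:R * ln (t n - y) =
      \sum_(1 <= n < N.+1) (J 0 n)%:R * ln (t n - y).
    by rewrite big_nat [RHS]big_nat; apply: eq_bigr => n nN; rewrite J0.
  apply: (@one_sided_log_average N (fun n => t n - y) (1 - y) D delta eta K J) => //.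
  - by rewrite gerBl.
  - move=> n nN; rewrite J0// => ytn; have [/andP[_ tn1] dt] := tP n nN.
    by move: dt; rewrite ger0_norm ?subr_ge0// => -> /=; rewrite lerD2r ltW.
  - move=> k n /andP[h1 h2]; rewrite /J h1 /= mul0r oppr0 expR0 mulr1.
    by apply: lt_le_trans h2 _; rewrite lerD2l.
  - by move=> k n /andP[_ /ltW]; rewrite lerBlDl.
  - move=> k n /andP[h1 _]; rewrite /J h1 /= -leNgt => h.
    by rewrite lerBrDl.
  - move=> k; have := tD y (y + (1 - y) * expR (- (k%:R * eta))) y0.
    rewrite count_in_sum addrAC subrr add0r; apply.
      by rewrite ltrDl mulr_gt0.
    by rewrite -lerBrDl.
have left : `|(\sum_(1 <= n < N.+1) (t n < y)%R%:R * ln (y - t n)) / N%:R -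
    (y * ln y - y)| <= side + `|ln y| * D.
  have [yE|yN0] := eqVneq y 0.
    rewrite big_nat big1 ?mul0r; last first.
      move=> n nN; have [/andP[tn0 _] _] := tP n nN.
      by rewrite yE ltNge tn0 mul0r.
    by rewrite yE mul0r !subr0 normr0 addr_ge0 ?mulr_ge0.
  have l0 : 0 < y by rewrite lt_neqAle eq_sym yN0.
  pose J k n := (y - y * expR (- (k%:R * eta)) <= t n < y)%R.
  have b k : y * expR (- (k%:R * eta)) <= y by rewrite ger_pMr.
  have J0 n : (1 <= n <= N)%N -> J 0 n = (t n < y)%R.
    move=> nN; have [/andP[tn0 _] _] := tP n nN.
    by rewrite /J mul0r oppr0 expR0 mulr1 subrr tn0.
  have -> : \sum_(1 <= n < N.+1) (t n < y)%R%:R * ln (y - t n) =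
      \sum_(1 <= n < N.+1) (J 0 n)%:R * ln (y - t n).
    by rewrite big_nat [RHS]big_nat; apply: eq_bigr => n nN; rewrite J0.
  apply: (@one_sided_log_average N (fun n => y - t n) y D delta eta K J) => //.
  - move=> n nN; rewrite J0// => ytn; have [/andP[tn0 _] dt] := tP n nN.
    have h : 0 <= y - t n by rewrite subr_ge0 ltW.
    by move: dt; rewrite distrC ger0_norm// => -> /=; rewrite gerBl.
  - move=> k n /andP[h1 h2]; rewrite /J h2 andbT mul0r oppr0 expR0 mulr1 subrr.
    by apply: le_trans h1; rewrite subr_ge0.
  - by move=> k n /andP[h _]; rewrite lerBlDr -lerBlDl.
  - move=> k n /andP[_ h2]; rewrite /J h2 andbT -ltNge => /ltW h.
    by rewrite lerBrDr -lerBrDl.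
  - move=> k; have := tD (y - y * expR (- (k%:R * eta))) y.
    rewrite count_in_sum subKr; apply=> //.
      by rewrite subr_ge0.
    by rewrite gtrBl mulr_gt0.
have -> : \sum_(1 <= n < N.+1) ln `|t n - y| =
    \sum_(1 <= n < N.+1) (y <= t n)%R%:R * ln (t n - y) +
    \sum_(1 <= n < N.+1) (t n < y)%R%:R * ln (y - t n).
  rewrite -big_split /=; apply: eq_bigr => n _.
  case: (leP y (t n)) => ytn; first by rewrite mul1r mul0r addr0 ger0_norm ?subr_ge0.
  by rewrite mul0r mul1r add0r distrC ger0_norm ?subr_ge0 ?ltW.
set A := \sum_(_ <= _ < _) _ in right *; set B := \sum_(_ <= _ < _) _ in left *.
have scale (x m e : R) : `|x / N%:R - m| <= e -> `|x - N%:R * m| <= N%:R * e.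
  move=> h; have -> : x - N%:R * m = N%:R * (x / N%:R - m).
    by rewrite mulrBr [_ * (x / _)]mulrC divfK// gt_eqF.
  by rewrite normrM gtr0_norm// ler_pM2l.
have hA := scale _ _ _ right; have hB := scale _ _ _ left.
have -> : A + B - N%:R * log_mean y =
  (A - N%:R * ((1 - y) * ln (1 - y) - (1 - y))) + (B - N%:R * (y * ln y - y)).
  by rewrite /log_mean; ring.
apply: le_trans (ler_normD _ _) _; apply: le_trans (lerD hA hB) _.
rewrite !(mulrDr N%:R side); lra.
Qed.

End Koksma.

Section LogAsymptotics.
Context {R : realType}.

Lemma cvg_ln_nat : (fun n => ln n%:R : R) @ \oo --> +oo.
Proof.
apply/cvgryPge => A; near=> n.
have h : expR A <= n%:R by near: n; exact: nbhs_infty_ger.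
by rewrite -(expRK A) ler_ln ?posrE ?expR_gt0// (lt_le_trans (expR_gt0 _) h).
Unshelve. all: by end_near. Qed.

Lemma cvg_powR_ln (eps : R) : 0 < eps -> (fun n => (ln n%:R `^ eps)^-1 : R) @ \oo --> (0 : R).
Proof.
move=> eps0; have lny : forall A : R, \forall n \near \oo, A <= ln n%:R by apply/cvgryPge; exact: cvg_ln_nat.
rewrite gtr0_cvgV0.
  apply/cvgryPge => A; near=> n.
  have h : `|A| `^ eps^-1 <= ln n%:R by near: n; exact: lny.
  apply: (le_trans (ler_norm A)).
  have -> : `|A| = (`|A| `^ eps^-1) `^ eps by rewrite -powRrM mulVf ?powRr1// gt_eqF.
  have lnn : 0 <= ln n%:R :> R by rewrite (le_trans _ h)// powR_ge0.
  by apply: ge0_ler_powR => //; rewrite ?nnegrE ?powR_ge0 ?ltW.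
near=> n; apply: powR_gt0; apply: (@lt_le_trans _ _ 1) => //.
by near: n; exact: lny.
Unshelve. all: by end_near. Qed.

(** The dominant term is D_n ln^3 n. *)
Lemma radius_cvg (D : nat -> R) (a b c eps : R) : 0 < eps ->
  0 <= a -> 0 <= b -> 0 <= c -> (forall n, 0 <= D n) ->
  (exists K, \forall n \near \oo, D n <= K * (ln n%:R `^ (3 + eps))^-1) ->
  (fun n => (n%:R * ((a + b * ln n%:R) * D n) + c) * ln n%:R ^+ 2 / n%:R) @ \oo --> (0 : R).
Proof.
move=> eps0 a0 b0 c0 D0 [K DK].
have lny : forall A : R, \forall n \near \oo, A <= ln n%:R by apply/cvgryPge; exact: cvg_ln_nat.
pose g n : R := (a + b) * K * (ln n%:R `^ eps)^-1 + c * 6 * (ln n%:R `^ 1)^-1.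
apply: (@squeeze_cvgr _ _ _ _ (fun=> 0) g); last 2 first.
- exact: cvg_cst.
- rewrite (_ : 0 = (a + b) * K * 0 + c * 6 * 0 :> R); last by rewrite !mulr0 addr0.
  by apply: cvgD; apply: cvgMr; exact: cvg_powR_ln.
near=> n.
have n1 : (1 : R) <= n%:R by rewrite ler1n; near: n; exact: nbhs_infty_gt.
have x1 : 1 <= ln n%:R :> R by near: n; exact: lny.
have Dn : D n <= K * (ln n%:R `^ (3 + eps))^-1 by near: n.
rewrite /g; set x := ln n%:R in x1 Dn *.
have nE : n%:R = expR x by rewrite /x lnK// posrE (lt_le_trans ltr01).
have x0 : 0 < x by exact: lt_le_trans x1.
have n0 : (0 : R) < n%:R by exact: lt_le_trans n1.
apply/andP; split.
  rewrite divr_ge0// mulr_ge0 ?sqr_ge0// addr_ge0// mulr_ge0// mulr_ge0//.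
  by rewrite addr_ge0// mulr_ge0// ltW.
have -> : (n%:R * ((a + b * x) * D n) + c) * x ^+ 2 / n%:R =
    (a + b * x) * x ^+ 2 * D n + c * (x ^+ 2 / n%:R).
  by field; rewrite gt_eqF.
have powD : x `^ (3 + eps) = x ^+ 3 * x `^ eps.
  by rewrite powRD ?(gt_eqF x0) ?implybT// powR_mulrn// ltW.
apply: lerD.
  have e0 : 0 < x `^ eps by exact: powR_gt0.
  apply: (@le_trans _ _ ((a + b) * (x ^+ 3 * D n))).
    rewrite mulrA ler_wpM2r//.
    have -> : (a + b) * x ^+ 3 = ((a + b) * x) * x ^+ 2 by ring.
    by rewrite ler_wpM2r ?sqr_ge0// mulrDl lerD2r ler_peMr.
  rewrite -mulrA ler_wpM2l ?addr_ge0//.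
  by have := Dn; rewrite powD invfM mulrCA -ler_pdivlMl ?invr_gt0 ?exprn_gt0//.
rewrite -mulrA ler_wpM2l// (powRr1 (ltW x0)).
rewrite ler_pdivrMr// mulrAC ler_pdivlMr// -exprSr mulrC -ler_pdivrMr//.
have := expR_ge1Dxn 2 (ltW x0); rewrite -nE => h.
by apply: le_trans h; rewrite lerDr.
Unshelve. all: by end_near. Qed.

Lemma sum_inverse_squares m : \sum_(n < m) (n%:R^-1) ^+ 2 <= 2 :> R.
Proof.
suff h k : \sum_(n < k.+2) (n%:R^-1) ^+ 2 <= 2 - k.+1%:R^-1 :> R.
  case: m => [|[|m]].
  - by rewrite big_ord0.
  - by rewrite big_ord1 invr0 expr0n.
  - by apply: le_trans (h m) _; rewrite gerBl invr_ge0.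
elim: k => [|k IH].
  by rewrite big_ord_recr big_ord1 /= invr0 expr0n add0r invr1 expr1n; lra.
rewrite big_ord_recr /=; apply: le_trans (lerD IH (lexx _)) _.
have u0 : (0 : R) < k.+1%:R by rewrite ltr0n.
have -> : k.+2%:R = k.+1%:R + 1 :> R by rewrite natr1.
set u := k.+1%:R in u0 *.
have w0 : 0 < u + 1 by lra.
rewrite -subr_ge0 (_ : _ - _ = (u * (u + 1) ^+ 2)^-1); last by field; rewrite !gt_eqF.
by rewrite invr_ge0 mulr_ge0 ?sqr_ge0// ltW.
Qed.

End LogAsymptotics.

Section LogBirkhoff.
Context {R : realType} {I : eqType}.
Variable L : seq (I * R * R).

(** The function ln |v| is, up to a constant, the sum over the list L; its average
    is estimated term by term by [koksma_log]. *)
Lemma log_birkhoff (N : nat) (t : nat -> I -> R) (D delta : R) :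
  (0 < N)%N -> 0 <= D -> 0 < delta -> delta <= 1 -> N%:R * delta <= 1 ->
  (forall n i, (1 <= n <= N)%N -> 0 <= t n i < 1) ->
  {in L, forall q, [/\ 0 <= q.1.2 <= 1, 0 < q.2 &
     forall n, (1 <= n <= N)%N -> delta <= `|t n q.1.1 - q.1.2|]} ->
  (forall i a b, 0 <= a -> a < b -> b <= 1 ->
    `|(count_in N `[a, b[%classic (t^~ i))%:R / N%:R - (b - a)| <= D) ->
  `|\sum_(1 <= n < N.+1) \sum_(q <- L) q.2 * ln `|t n q.1.1 - q.1.2| -
     N%:R * \sum_(q <- L) q.2 * log_mean q.1.2| <=
  (\sum_(q <- L) q.2) *
   (N%:R * ((2 * (1 - ln delta) + \sum_(q <- L) (`|ln (1 - q.1.2)| + `|ln q.1.2|)) * D) + 6).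
Proof.
move=> N0 D0 delta0 delta1 Ndelta t01 LP tD.
set W := \sum_(q <- L) (`|ln (1 - _)| + _).
set B := N%:R * _ + 6.
rewrite exchange_big /= mulr_sumr -sumrB mulr_suml.
apply: le_trans (ler_norm_sum _ _ _) _.
rewrite big_seq [leRHS]big_seq; apply: ler_sum => q qL.
have [y01 s0 far] := LP q qL.
rewrite -mulr_sumr mulrCA -mulrBr normrM gtr0_norm// ler_pM2l//.
apply: le_trans (@koksma_log R N (t^~ q.1.1) q.1.2 D delta N0 y01 D0 delta0 delta1 _ _) _.
- by move=> n nN; split; [exact: t01|exact: far].
- by move=> a b; exact: tD.
have qW : `|ln (1 - q.1.2)| + `|ln q.1.2| <= W.
  by rewrite /W (big_rem q)//= lerDl sumr_ge0// => i _; rewrite addr_ge0.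
have NR : (0 : R) <= N%:R by [].
rewrite mulrDr -addrA /B lerD//.
  by rewrite ler_wpM2l// ler_wpM2r// -addrA lerD2l.
by move: Ndelta; lra.
Qed.
End LogBirkhoff.

(** * Generalized polynomials and discrepancy *)

Section Weights.
Context {R : realType}.

(** Whichever determination of the power is used, its modulus is the power of the
    modulus. *)
Lemma real_power_abs (t s w : R) : 0 < s -> real_power t s w -> `|w| = `|t| `^ s.
Proof.
move=> s0 [[t0 ->]|[t0 [m [n [on sE wt]]]]].
  by rewrite (ger0_norm t0) ger0_norm ?powR_ge0.
have n0 : (0 < n)%N by case: (n) on.
have nR : n%:R != 0 :> R by rewrite pnatr_eq0 -lt0n.
rewrite sE powRrM powR_mulrn// -normrX -wt normrX -powR_mulrn//.
by rewrite -powRrM divff// powRr1.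
Qed.

Lemma generalized_polynomial_abs (u : unit_interval R -> R[i]) :
  generalized_polynomial u -> exists (c : R) (L : seq (R * R)), [/\ 0 < c,
    {in L, forall q, 0 <= q.1 <= 1 /\ 0 < q.2} &
    forall t, cabs (u t) = c * \prod_(q <- L) `|I01val t - q.1| `^ q.2].
Proof.
move=> [l [s [C [y [sigma [s0 C0 sigmaP uP]]]]]].
exists (cabs C), [seq (I01val (y j), s j) | j <- enum 'I_l.+1]; split.
- by rewrite cabs_gt0.
- by move=> q /mapP[j _ ->]/=; rewrite I01val_ge0 I01val_le1.
- move=> t; have [w [wP ->]] := uP t; rewrite cabsM cabs_prod; congr (_ * _).
  rewrite big_map big_enum/=; apply: eq_bigr => j _.
  rewrite cabs_real (real_power_abs (s0 j) (wP j)).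
  by case: (sigmaP j) => ->; rewrite ?normr_id.
Qed.

(** The factors |x_i - y| ^ s of all the coordinates, in one list of triples
    (i, y, s). *)
Lemma product_weight_abs d (v_ : 'I_d -> unit_interval R -> R[i]) :
  (forall i, generalized_polynomial (v_ i)) ->
  exists (c : R) (L : seq ('I_d * R * R)), [/\ 0 < c,
    {in L, forall q, 0 <= q.1.2 <= 1 /\ 0 < q.2} &
    forall x : cube R d, cabs (\prod_(i < d) v_ i (cube_coord x i)) =
      c * \prod_(q <- L) `|I01val (cube_coord x q.1.1) - q.1.2| `^ q.2].
Proof.
move=> vP; have [c /choice[L cL]] := choice (fun i => generalized_polynomial_abs (vP i)).
exists (\prod_(i < d) c i),
  (flatten [seq [seq (i, q.1, q.2) | q <- L i] | i <- enum 'I_d]); split.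
- by apply: prodr_gt0 => i _; case: (cL i).
- by move=> q /flatten_mapP[i _ /mapP[q' q'L ->]]/=; case: (cL i) => _ /(_ _ q'L).
- move=> x; rewrite cabs_prod big_flatten/= big_map big_enum/= -big_split/=.
  apply: eq_bigr => i _; rewrite big_map/=.
  by case: (cL i) => _ _ ->.
Qed.

End Weights.

Section DiscrepancyBounds.
Context {R : realType}.
Implicit Types (w : nat -> R) (N : nat).

Lemma interval_discrepancy_le1 N w (a b : R) : 0 <= a -> a < b -> b <= 1 ->
  `|(count_in N `[a, b[%classic w)%:R / N%:R - (b - a)| <= 1.
Proof.
move=> a0 ab b1.
have c0 : 0 <= (count_in N `[a, b[%classic w)%:R / N%:R :> R by rewrite divr_ge0.
have c1 : (count_in N `[a, b[%classic w)%:R / N%:R <= 1 :> R.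
  case: N c0 => [|N] _; first by rewrite invr0 mulr0.
  rewrite ler_pdivrMr ?ltr0n// mul1r ler_nat /count_in.
  apply: (@leq_trans (\sum_(1 <= n < N.+2) 1)%N); last first.
    by rewrite sum_nat_const_nat muln1 subn1.
  by apply: leq_sum => n _; case: (_ \in _).
by rewrite ler_norml; apply/andP; split; lra.
Qed.

Lemma seq_discrepancy_ge N w (a b : R) : 0 <= a -> a < b -> b <= 1 ->
  `|(count_in N `[a, b[%classic w)%:R / N%:R - (b - a)| <= seq_discrepancy N w.
Proof.
move=> a0 ab b1; apply: ub_le_sup; last by exists a, b.
by exists 1 => _ [a' [b' [a'0 ab' b'1 ->]]]; exact: interval_discrepancy_le1.
Qed.

Lemma seq_discrepancy_le1 N w : seq_discrepancy N w <= 1.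
Proof.
apply: ge_sup => [|_ [a [b [a0 ab b1 ->]]]]; last exact: interval_discrepancy_le1.
by eexists; exists 0, 1; split; [| exact: ltr01 | |reflexivity].
Qed.

(** Discrepancies are bounded, so that the suprema defining them are upper
    bounds. *)
Lemma discrepancy_le1 (f : unit_interval R -> unit_interval R) N : discrepancy f N <= 1.
Proof.
apply: ge_sup => [|_ [y _ <-]]; last exact: seq_discrepancy_le1.
exists (seq_discrepancy N (fun n => I01val (iter n f point))), point => //=.
Qed.

Lemma interval_discrepancy_le d (tau_ : 'I_d -> unit_interval R -> unit_interval R)
    N i y (a b : R) : I01val y < 1 -> 0 <= a -> a < b -> b <= 1 ->
  `|(count_in N `[a, b[%classic (fun n => I01val (iter n (tau_ i) y)))%:R / N%:R - (b - a)|
  <= sup [set discrepancy (tau_ i) N | i in [set: 'I_d]].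
Proof.
move=> y1 a0 ab b1; apply: le_trans (seq_discrepancy_ge N _ a0 ab b1) _.
apply: (@le_trans _ _ (discrepancy (tau_ i) N)).
  apply: ub_le_sup; last by exists y.
  by exists 1 => _ [z _ <-]; exact: seq_discrepancy_le1.
apply: ub_le_sup; last by exists i.
by exists 1 => _ [j _ <-]; exact: discrepancy_le1.
Qed.

(** A sequence that takes the value y at all multiples of n visits each interval
    that starts at y with frequency at least 1 / n, and these intervals can be chosen
    shorter than 1 / (2 n). *)
Lemma uniformly_distributed_aperiodic (D : nat -> R) (w : nat -> R) (y : R) n :
  D @ \oo --> (0 : R) -> 0 <= y < 1 -> (0 < n)%N ->
  (forall N a b, 0 <= a -> a < b -> b <= 1 ->
    `|(count_in N `[a, b[%classic w)%:R / N%:R - (b - a)| <= D N) ->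
  ~ (forall M, w (M * n)%N = y).
Proof.
move=> D0 /andP[y0 y1] n0 wD wy.
have nR : (0 : R) < n%:R by rewrite ltr0n.
pose beta : R := Num.min (1 - y) ((2 * n%:R)^-1).
have beta0 : 0 < beta by rewrite lt_min subr_gt0 y1 invr_gt0 mulr_gt0.
have beta1 : y + beta <= 1 by rewrite -lerBrDl ge_min lexx.
have beta2 : beta <= (2 * n%:R)^-1 by rewrite ge_min lexx orbT.
have count M : (M <= count_in (M * n) `[y, (y + beta)%R[%classic w)%N.
  elim: M => [//|M IH]; rewrite /count_in.
  rewrite (@big_cat_nat _ _ _ (M * n).+1)//=; last by rewrite ltnS leq_pmul2r.
  rewrite [X in (_ + X)%N]big_nat_recr/=; last by rewrite ltn_pmul2r.
  rewrite wy mem_set/=; last by rewrite in_itv/= lexx ltrDl beta0.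
  by rewrite addnA addn1 ltnS (leq_trans IH)// leq_addr.
have h2 : 0 < (2 * n%:R)^-1 :> R by rewrite invr_gt0 mulr_gt0.
have [M0 _ DM] := (cvgr_lt _ D0 _ h2).
have := wD (M0.+1 * n)%N y (y + beta) y0; rewrite ltrDl => /(_ beta0 beta1).
rewrite [y + beta - y]addrAC subrr add0r.
have := DM (M0.+1 * n)%N; rewrite /= => /(_ _) DN.
have {}DN : D (M0.+1 * n)%N < (2 * n%:R)^-1.
  by apply: DN; rewrite (leq_trans (leqnSn _))// leq_pmulr.
have cR : (n%:R)^-1 <= (count_in (M0.+1 * n) `[y, (y + beta)%R[%classic w)%:R / (M0.+1 * n)%:R :> R.
  rewrite ler_pdivlMr ?ltr0n ?muln_gt0// natrM mulrC mulfK ?gt_eqF//.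
  by rewrite ler_nat.
move=> /ler_normlP[_ h].
have hn : (n%:R)^-1 = (2 * n%:R)^-1 + (2 * n%:R)^-1 :> R by field; rewrite gt_eqF.
move: cR h DN beta2; rewrite hn.
set A := (_ / _); set B := (2 * _)^-1; set E := D _; lra.
Qed.

End DiscrepancyBounds.

(** * Dynamics on the cube *)

Section CubeCoordinates.
Context {R : realType} {d : nat}.
Local Notation mu := (cube_measure R d).

Lemma measurable_cube_coord (i : 'I_d) :
  measurable_fun setT (fun x : cube R d => cube_coord x i).
Proof.
move=> _ B mB; rewrite setTI; apply: sub_caratheodory.
apply: sub_sigma_algebra.
by rewrite /= -[X in measurable X]setTI; exact: (measurable_tnth i).
Qed.

Lemma measurable_coord_preimage (i : 'I_d) (B : set (unit_interval R)) :
  measurable B -> measurable [set x : cube R d | B (cube_coord x i)].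
Proof. by move=> mB; rewrite -[X in measurable X]setTI; exact: measurable_cube_coord. Qed.

Lemma cube_measure_setT : mu setT = 1%E.
Proof.
have := @cube_measureE R d (fun=> setT) (fun=> measurableT).
rewrite big1 => [<-|i _]; last exact: probability_setT.
by congr (cube_measure R d _); apply/seteqP; split.
Qed.

(** All the other factors of the box are full. *)
Lemma cube_measure_coord (i : 'I_d) (B : set (unit_interval R)) : measurable B ->
  mu [set x : cube R d | B (cube_coord x i)] = interval_measure B.
Proof.
move=> mB; have := @cube_measureE R d (fun j => if j == i then B else setT).
rewrite (bigD1 i)//= eqxx big1 ?mule1; last first.
  by move=> j /negbTE ->; exact: probability_setT.
move=> <-; last by move=> j; case: ifP.
congr (cube_measure R d _); apply/seteqP; split => x /= h.
  by move=> j; case: eqP => [->|].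
by have := h i; rewrite eqxx.
Qed.

Lemma measurable_near (y delta : R) :
  measurable [set t : unit_interval R | `|I01val t - y| < delta].
Proof.
rewrite [X in measurable X](_ : _ = setT `&` @I01val R @^-1` ball y delta).
  by apply: measurable_I01val => //; exact: measurable_ball.
by apply/seteqP; split => [t/=|t/= []]; rewrite /ball/= distrC.
Qed.

Lemma interval_measure_near (y delta : R) : 0 <= delta ->
  (interval_measure [set t : unit_interval R | (`|I01val t - y| < delta)%R] <= (2 * delta)%:E)%E.
Proof.
move=> delta0; rewrite mulr_natl -(lebesgue_measure_ball y delta0) /interval_measure.
apply: le_measure; rewrite ?inE.
- by apply: measurable_image_I01val; exact: measurable_near.
- exact: measurable_ball.
- by move=> _ [t /= h <-]; rewrite /ball/= distrC.
Qed.

Lemma measurable_at (y : R) : measurable [set t : unit_interval R | I01val t = y].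
Proof.
rewrite [X in measurable X](_ : _ = setT `&` @I01val R @^-1` [set y]).
  by apply: measurable_I01val => //; exact: measurable_set1.
by apply/seteqP; split => [t/=|t/= []].
Qed.

Lemma interval_measure_at (y : R) :
  interval_measure [set t : unit_interval R | I01val t = y] = 0%E.
Proof.
apply/eqP; rewrite eq_le measure_ge0 andbT -(lebesgue_measure_set1 y).
apply: le_measure; rewrite ?inE.
- by apply: measurable_image_I01val; exact: measurable_at.
- exact: measurable_set1.
- by move=> _ [t /= h <-].
Qed.

Lemma ae_coord_neq (i : 'I_d) (y : R) : \forall x \ae mu, I01val (cube_coord x i) <> y.
Proof.
exists [set x : cube R d | I01val (cube_coord x i) = y]; split.
- exact: (measurable_coord_preimage i (measurable_at y)).
- by rewrite (cube_measure_coord i (measurable_at y)) interval_measure_at.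
- by move=> x /= /contrapT.
Qed.

End CubeCoordinates.

Section AlmostEverywhereList.
Context {d : measure_display} {T : measurableType d} {R : realType}.
Variable mu : {measure set T -> \bar R}.

Lemma ae_all_seq (I : eqType) (s : seq I) (P : I -> T -> Prop) :
  (forall i, \forall x \ae mu, P i x) -> \forall x \ae mu, {in s, forall i, P i x}.
Proof.
move=> aeP; elim: s => [|i s IH]; first exact: aeW.
apply: filterS2 (aeP i) IH => x Pi Ps j; rewrite inE => /predU1P[->//|]; exact: Ps.
Qed.

Lemma measure_bigsetU_le (I : Type) (s : seq I) (A : I -> set T) (e : R) :
  (forall i, measurable (A i)) -> (forall i, mu (A i) <= e%:E)%E ->
  (mu (\big[setU/set0]_(i <- s) A i) <= ((size s)%:R * e)%:E)%E.
Proof.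
move=> mA Ae; elim: s => [|i s IH]; first by rewrite big_nil measure0 mul0r.
have mU : measurable (\big[setU/set0]_(i <- s) A i) by exact: bigsetU_measurable.
rewrite big_cons; apply: le_trans (measure_le_setU mu (mA i) mU) _.
by rewrite /= -natr1 mulrDl mul1r addrC EFinD leeD.
Qed.

End AlmostEverywhereList.

Section CubeDynamics.
Context {R : realType} {d : nat}.
Local Notation mu := (cube_measure R d).
Variables (tau_ : 'I_d -> unit_interval R -> unit_interval R).
Variable tau : cube R d -> cube R d.
Hypothesis tau_prod : forall x i, cube_coord (tau x) i = tau_ i (cube_coord x i).
Hypothesis tauP : measure_preserving mu tau.
Variable D : nat -> R.
Hypothesis D_ge0 : forall n, 0 <= D n.
Hypothesis tauD : forall N i y (a b : R), I01val y < 1 -> 0 <= a -> a < b -> b <= 1 ->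
  `|(count_in N `[a, b[%classic (fun n => I01val (iter n (tau_ i) y)))%:R / N%:R - (b - a)|
  <= D N.

Lemma iter_coord k x i : cube_coord (iter k tau x) i = iter k (tau_ i) (cube_coord x i).
Proof. by elim: k => //= k <-. Qed.

Lemma ae_orbit_lt1 : \forall x \ae mu, forall k i, I01val (cube_coord (iter k tau x) i) < 1.
Proof.
apply: ae_foralln => k.
apply: (@ae_preserving _ _ _ mu (iter k tau)
  (fun x => forall i, I01val (cube_coord x i) < 1)).
  exact: measure_preserving_iter.
have := @ae_all_seq _ _ _ mu _ (enum 'I_d) (fun i x => I01val (cube_coord x i) <> 1)
  (fun i => ae_coord_neq i 1).
apply: filterS => x h i; rewrite lt_neqAle I01val_le1 andbT.
by apply/eqP/h; rewrite mem_enum.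
Qed.

(** The half-open intervals from q.2 / q.1 to (q.2 + 1) / q.1, for q.1 > 0: countably
    many sets that separate a point from finitely many others. *)
Definition cell (q : nat * nat) : set R := [set t | q.2%:R <= q.1%:R * t < q.2%:R + 1].

Lemma measurable_cell q : measurable (cell q).
Proof.
rewrite (_ : cell q = setT `&` ( *%R q.1%:R) @^-1` `[q.2%:R, q.2%:R + 1[%classic).
  have mM : measurable_fun [set: R] ( *%R q.1%:R : R -> R).
    by apply: measurable_funM => //; exact: measurable_id.
  by apply: mM => //; exact: measurable_itv.
by apply/seteqP; split => [t|t []]; rewrite /cell /= in_itv.
Qed.

Lemma separating_cell (t : R) (s : nat -> R) N : 0 <= t ->
  (forall j, (0 < j <= N)%N -> s j != t) ->
  exists q, cell q t /\ forall j, (0 < j <= N)%N -> ~ cell q (s j).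
Proof.
move=> t0 st.
have [m mP] : exists m : nat, forall j, (0 < j <= N)%N -> 1 <= m%:R * `|s j - t|.
  elim: N st => [|N IH] st; first by exists 0%N; case.
  have [|m mP] := IH; first by move=> j /andP[j0 jN]; apply: st; rewrite j0 (leq_trans jN).
  have sN : 0 < `|s N.+1 - t| by rewrite normr_gt0 subr_eq0 st// ltnSn.
  exists (maxn m (Num.truncn (`|s N.+1 - t|^-1)).+1) => j /andP[j0].
  rewrite leq_eqVlt => /predU1P[->|jN].
    rewrite -ler_pdivrMr// div1r; apply: le_trans (ltW (truncnS_gt _)) _.
    by rewrite ler_nat leq_maxr.
  apply: le_trans (mP j _) _; first by rewrite j0.
  by rewrite ler_wpM2r// ler_nat leq_maxl.
have mt0 : 0 <= m%:R * t by rewrite mulr_ge0.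
have /andP[a1 a2] := truncn_itv mt0.
rewrite -natr1 in a2.
exists (m, Num.truncn (m%:R * t)); split; first by rewrite /cell /= a1 a2.
move=> j /mP; rewrite /cell /= => mj /andP[b1 b2].
have : `|m%:R * (s j - t)| < 1.
  rewrite mulrBr ltr_norml; move: a1 a2 b1 b2.
  by set A := _%:R; lra.
by rewrite normrM ger0_norm// ltNge mj.
Qed.

(** A coordinate of the orbit of x does not return to its initial value, by
    [uniformly_distributed_aperiodic], so a small cell containing it contains none of
    its next N values. *)
Lemma coordinate_cells (i : 'I_d) N : D @ \oo --> (0 : R) ->
  exists I : nat -> set (cube R d), (forall k, measurable (I k)) /\
    \forall x \ae mu, exists k, I k x /\
      forall n, (0 < n <= N)%N -> ~ I k (iter n tau x).
Proof.
move=> D0.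
exists (fun k => [set x | cell (odflt (0, 0)%N (unpickle k)) (I01val (cube_coord x i))]); split.
  move=> k; apply: (measurable_coord_preimage i (B := @I01val R @^-1` cell _)).
  by rewrite -[X in measurable X]setTI; apply: measurable_I01val => //; exact: measurable_cell.
apply: filterS ae_orbit_lt1 => x lt1.
set y := cube_coord x i.
have y1 : I01val y < 1 by exact: (lt1 0%N i).
have aperiodic j : (0 < j <= N)%N -> I01val (iter j (tau_ i) y) != I01val y.
  move=> /andP[j0 _]; apply/eqP => /I01val_inj jy.
  have yI : 0 <= I01val y < 1 by rewrite I01val_ge0.
  apply: (uniformly_distributed_aperiodic (w := fun n => I01val (iter n (tau_ i) y)) D0 yI j0).
    by move=> M a b; exact: tauD.
  by move=> M; congr I01val; elim: M => // M IH; rewrite mulSn iterD IH.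
have [q [qy qs]] := separating_cell (I01val_ge0 y) aperiodic.
exists (pickle q); rewrite /= pickleK/=; split => // n nN.
by rewrite iter_coord; exact: qs.
Qed.

Variables (v : cube R d -> R[i]) (c : R) (L : seq ('I_d * R * R)).
Hypothesis c0 : 0 < c.
Hypothesis LP : {in L, forall q, 0 <= q.1.2 <= 1 /\ 0 < q.2}.
Hypothesis vE : forall x, cabs (v x) =
  c * \prod_(q <- L) `|I01val (cube_coord x q.1.1) - q.1.2| `^ q.2.

Let S : R := \sum_(q <- L) q.2.
Let W : R := \sum_(q <- L) (`|ln (1 - q.1.2)| + `|ln q.1.2|).
Let m : R := \sum_(q <- L) q.2 * log_mean q.1.2.
Let kappa : R := c * expR m.
(* The constant makes the measures of the bad sets sum up to at most 1 / 4, as the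
   sum of 1 / n ^ 2 is at most 2. *)
Let e0 : R := (16 * (size L).+1%:R)^-1.
Let delta (n : nat) : R := e0 * (n%:R^-1) ^+ 3.
Let r (n : nat) : R := S * (n%:R * ((2 * (1 - ln (delta n)) + W) * D n) + 6).

Let S_ge0 : 0 <= S.
Proof. by rewrite /S big_seq sumr_ge0// => q /LP[_ /ltW]. Qed.

Let W_ge0 : 0 <= W.
Proof. by rewrite sumr_ge0// => q _; rewrite addr_ge0. Qed.

Let kappa_gt0 : 0 < kappa.
Proof. by rewrite mulr_gt0// expR_gt0. Qed.

Let e0_gt0 : 0 < e0.
Proof. by rewrite invr_gt0 mulr_gt0. Qed.

Let e0_le1 : e0 <= 1.
Proof. by rewrite invf_le1 ?mulr_gt0// -natrM ler1n. Qed.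

Let inv_ge0 (n : nat) : 0 <= n%:R^-1 :> R. Proof. by rewrite invr_ge0. Qed.

Let inv_le1 (n : nat) : n%:R^-1 <= 1 :> R.
Proof.
by case: n => [|n]; rewrite ?invr0// invf_le1 ?ltr0n// ler1n.
Qed.

Let delta_le1 n : delta n <= 1.
Proof. by rewrite /delta mulr_ile1 ?exprn_ge0 ?exprn_ile1// ltW. Qed.

Let delta_ge0 n : 0 <= delta n.
Proof. by rewrite mulr_ge0 ?exprn_ge0// ltW. Qed.

Let r_ge0 n : 0 <= r n.
Proof.
rewrite mulr_ge0// addr_ge0// !mulr_ge0// addr_ge0// mulr_ge0// subr_ge0.
by apply: le_trans (ln_le0 _) _.
Qed.

Let r_cvg (eps : R) : 0 < eps ->
  (exists K, \forall n \near \oo, D n <= K * (ln n%:R `^ (3 + eps))^-1) ->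
  (fun n => r n * (ln n%:R) ^+ 2 / n%:R) @ \oo --> (0 : R).
Proof.
move=> eps0 DK.
have ln_e0 : ln e0 <= 0 by exact: ln_le0.
have := @radius_cvg R D (S * (2 - 2 * ln e0 + W)) (S * 6) (S * 6) eps eps0 _ _ _ D_ge0 DK.
rewrite (_ : (fun n => _ ) = (fun n => r n * (ln n%:R) ^+ 2 / n%:R)).
  by apply; rewrite mulr_ge0//; move: ln_e0 W_ge0; lra.
apply/funext => n; case: n => [|n]; first by rewrite invr0 !mulr0.
congr (_ * _ / _); rewrite /r /delta lnM ?posrE ?exprn_gt0 ?invr_gt0 ?ltr0n//.
rewrite lnXn ?invr_gt0 ?ltr0n// lnV ?posrE ?ltr0n//.
by rewrite -mulr_natl; ring.
Qed.

Let close (n : nat) : set (cube R d) :=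
  \big[setU/set0]_(q <- L) [set x : cube R d | `|I01val (cube_coord x q.1.1) - q.1.2| < delta n].

Let measurable_close_factor n (q : 'I_d * R * R) :
  measurable [set x : cube R d | `|I01val (cube_coord x q.1.1) - q.1.2| < delta n].
Proof. exact: (measurable_coord_preimage q.1.1 (measurable_near q.1.2 (delta n))). Qed.

Let measurable_close n : measurable (close n).
Proof. by apply: bigsetU_measurable => q _; exact: measurable_close_factor. Qed.

Let measure_close n : (mu (close n) <= ((size L)%:R * (2 * delta n))%:E)%E.
Proof.
apply: measure_bigsetU_le => q; first exact: measurable_close_factor.
have := interval_measure_near q.1.2 (delta_ge0 n).
by rewrite -(cube_measure_coord q.1.1 (measurable_near q.1.2 (delta n))).
Qed.

Let far_orbit N x : (0 < N)%N ->
  (forall k i, I01val (cube_coord (iter k tau x) i) < 1) ->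
  (forall n, (1 <= n <= N)%N -> ~ close N (iter n tau x)) ->
  ~ bad tau v kappa r N (tau x).
Proof.
move=> N0 lt1 far; apply; rewrite /=.
pose t n i := I01val (cube_coord (iter n tau x) i).
have dN : 0 < delta N by rewrite mulr_gt0// exprn_gt0// invr_gt0 ltr0n.
have farL q n : q \in L -> (1 <= n <= N)%N -> delta N <= `|t n q.1.1 - q.1.2|.
  move=> qL nN; rewrite leNgt; apply/negP => h; apply: (far n nN).
  by rewrite /close -bigcup_seq; exists q.
have vk n : (1 <= n <= N)%N -> cabs (v (iter n tau x) / kappa%:C%C) =
    expR (\sum_(q <- L) q.2 * ln `|t n q.1.1 - q.1.2| - m).
  move=> nN; rewrite cabsM cabsV cabs_real gtr0_norm// vE /kappa invfM mulrACA divff ?gt_eqF//.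
  rewrite mul1r expRD expRN; congr (_ * _).
  rewrite expR_sum big_seq [RHS]big_seq; apply: eq_bigr => q qL.
  by rewrite /powR gt_eqF// (lt_le_trans dN)// farL.
have -> : cabs (cocycle tau v kappa N (tau x)) =
    expR (\sum_(1 <= n < N.+1) \sum_(q <- L) q.2 * ln `|t n q.1.1 - q.1.2| - N%:R * m).
  rewrite /cocycle cabs_prod -(big_mkord xpredT (fun k => cabs (v (iter k tau (tau x)) / kappa%:C%C))).
  have -> : N%:R * m = \sum_(1 <= n < N.+1) m by rewrite sumr_const_nat subn1 mulr_natl.
  rewrite -sumrB expR_sum big_add1/= big_nat [RHS]big_nat; apply: eq_bigr => k kN.
  by rewrite -iterSr vk.
rewrite !ler_expR -ler_norml /m.
apply: (@log_birkhoff R _ L N t (D N) (delta N)) => //.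
- apply: (@le_trans _ _ (N%:R * N%:R^-1)); last by rewrite divff// pnatr_eq0 -lt0n.
  rewrite ler_wpM2l// /delta exprS mulrCA ler_piMr//.
  by rewrite mulr_ile1 ?exprn_ge0 ?exprn_ile1// ltW.
- by move=> n i _; rewrite lt1 I01val_ge0.
- by move=> q qL; have [] := LP qL; split => // n; exact: farL.
- move=> i a b a0 ab b1; rewrite (_ : t^~ i = fun n => I01val (iter n (tau_ i) (cube_coord x i))).
    by apply: tauD => //; exact: (lt1 0%N).
  by apply/funext => n; rewrite /t iter_coord.
Qed.

Hypothesis vL : in_Lp mu +oo v.

(* The bad set is measured after a composition with tau, in order that the orbit
   starts at time 1, as in the definition of the discrepancy. *)
Let measure_bad N : (mu (bad tau v kappa r N) <= (8^-1 * (N%:R^-1) ^+ 2)%:E)%E.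
Proof.
have mB : measurable (bad tau v kappa r N) by apply: (measurable_bad tauP vL).
have [N0|N0] := posnP N.
  rewrite N0 (_ : bad _ _ _ _ _ = set0) ?measure0 ?lee_fin ?mulr_ge0 ?sqr_ge0//.
  rewrite -subset0 => x; apply; rewrite cocycle0 cabs1.
  by rewrite expR_le1 oppr_le0 r_ge0 -{1}expR0 ler_expR r_ge0.
rewrite -(tauP.2 _ mB).
have [M [mM M0 MP]] := ae_orbit_lt1.
pose A n := iter n tau @^-1` close N.
have mA n : measurable (A n).
  by rewrite -[X in measurable X]setTI; apply: (measure_preserving_iter tauP n).1.
have muA n : (mu (A n) <= ((size L)%:R * (2 * delta N))%:E)%E.
  rewrite /A (measure_preserving_iter tauP n).2; [exact: measure_close|exact: measurable_close].
have mU : measurable (\big[setU/set0]_(n <- iota 1 N) A n) by exact: bigsetU_measurable.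
apply: (@le_trans _ _ (mu (\big[setU/set0]_(n <- iota 1 N) A n))).
  apply: (measure_le_null _ mU mM M0).
    by rewrite -[X in measurable X]setTI; exact: tauP.1.
  move=> x Mx xbad; apply: contrapT => xU.
  apply: (far_orbit N0 _ _ xbad); first by apply: contrapT => h; apply: Mx; exact: MP.
  move=> n nN h; apply: xU; rewrite -bigcup_seq; exists n => //=.
  by rewrite mem_iota add1n ltnS.
apply: le_trans (measure_bigsetU_le _ mA muA) _; rewrite size_iota lee_fin.
have NR : N%:R * (N%:R^-1) ^+ 3 = (N%:R^-1) ^+ 2 :> R.
  by rewrite exprS mulrA divff ?mul1r// pnatr_eq0 -lt0n.
have -> : N%:R * ((size L)%:R * (2 * delta N)) = (size L)%:R * (2 * e0) * (N%:R * (N%:R^-1) ^+ 3).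
  by rewrite /delta; ring.
rewrite NR ler_wpM2r ?sqr_ge0// /e0 -natr1.
have J0 : (0 : R) <= (size L)%:R by [].
rewrite mulrA ler_pdivrMr; last by rewrite mulr_gt0// ltr_wpDl.
by move: J0; set J := _%:R; lra.
Qed.

Let bad_series : (\sum_(n <oo) mu (bad tau v kappa r n) <= (4^-1)%:E)%E.
Proof.
apply: lime_le; first by apply: is_cvg_nneseries => n _ _; exact: measure_ge0.
apply: nearW => n; rewrite big_mkord.
apply: (@le_trans _ _ (\sum_(i < n) (8^-1 * (i%:R^-1) ^+ 2)%:E)%E).
  by apply: lee_sum => i _; exact: measure_bad.
rewrite sumEFin lee_fin -mulr_sumr.
by have := @sum_inverse_squares R n; lra.
Qed.

Let v_neq0 : \forall x \ae mu, v x != 0.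
Proof.
have := @ae_all_seq _ _ _ mu _ L (fun q x => I01val (cube_coord x q.1.1) <> q.1.2)
  (fun q => ae_coord_neq q.1.1 q.1.2).
apply: filterS => x xL; rewrite -cabs_gt0 vE mulr_gt0// big_seq prodr_gt0// => q qL.
by rewrite powR_gt0// normr_gt0 subr_eq0; apply/eqP/xL.
Qed.

(** [hyperinvariant_weighted_composition] for the cocycle of v, with the bounds r on
    the growth that were obtained from the discrepancy. *)
Lemma hyperinvariant_cube (p : \bar R) (p1 : (1 <= p)%E) (i : 'I_d) (eps : R) :
  0 < eps ->
  (exists K, \forall n \near \oo, D n <= K * (ln n%:R `^ (3 + eps))^-1) ->
  exists M : set (Lp_space mu p1),
    nontrivial_hyperinvariant_subspace (weighted_composition v tau) M.
Proof.
move=> eps0 DK.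
have D0 : D @ \oo --> (0 : R).
  have [K hK] := DK.
  apply: (@squeeze_cvgr _ _ _ _ (fun=> 0) (fun n => K * (ln n%:R `^ (3 + eps))^-1)).
  - by apply: filterS hK => n h; rewrite D_ge0.
  - exact: cvg_cst.
  - rewrite -(mulr0 K); apply: cvgMr; apply: cvg_powR_ln; lra.
have mu1 := @cube_measure_setT R d.
have h := hyperinvariant_weighted_composition p1 mu1 tauP vL v_neq0 kappa_gt0 r_ge0
  (r_cvg eps0 DK) bad_series.
by apply: h => N; exact: coordinate_cells.
Qed.

End CubeDynamics.

Theorem mainTheorem3 (R : realType) (d : nat) (d_gt0 : (0 < d)%N)
    (p : \bar R) (p_ge1 : (1 <= p)%E)
    (v_ : 'I_d -> unit_interval R -> R[i]) (v : cube R d -> R[i])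
    (v_Linfty : in_Lp (cube_measure R d) +oo%E v)
    (v_prod : forall x, v x = \prod_(i < d) v_ i (cube_coord x i))
    (v_genpoly : forall i, generalized_polynomial (v_ i))
    (tau_ : 'I_d -> unit_interval R -> unit_interval R)
    (tau : cube R d -> cube R d)
    (tau_bij : bijective tau)
    (tau_ergodic : ergodic (cube_measure R d) tau)
    (tau_prod : forall x i, cube_coord (tau x) i = tau_ i (cube_coord x i))
    (eps : R) (eps_gt0 : 0 < eps)
    (tau_discrepancy :
       (fun n : nat =>
          sup [set discrepancy (tau_ i) n | i in [set: 'I_d]] : R^o)
       =O_\oo (fun n : nat => (ln n%:R `^ (3 + eps))^-1 : R^o)) :
  exists M : set (Lp_space (cube_measure R d) p_ge1),
    nontrivial_hyperinvariant_subspace (weighted_composition v tau) M.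
Proof.
pose D n : R := `|sup [set discrepancy (tau_ i) n | i in [set: 'I_d]]|.
have [c [L [c0 LP cL]]] := product_weight_abs v_genpoly.
have tauD N i y (a b : R) : I01val y < 1 -> 0 <= a -> a < b -> b <= 1 ->
    `|(count_in N `[a, b[%classic (fun n => I01val (iter n (tau_ i) y)))%:R / N%:R - (b - a)|
    <= D N.
  move=> y1 a0 ab b1; apply: le_trans (ler_norm _).
  exact: interval_discrepancy_le.
have DK : exists K, \forall n \near \oo, D n <= K * (ln n%:R `^ (3 + eps))^-1.
  have [K [_ hK]] := (eqOP _ _ _).1 tau_discrepancy.
  have {}hK := hK (K + 1) (ltr_pwDr ltr01 (lexx K)).
  exists (K + 1); apply: filterS hK => n; rewrite /D /=.
  by rewrite [X in _ * X]ger0_norm// invr_ge0 powR_ge0.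
have vE x : cabs (v x) = c * \prod_(q <- L) `|I01val (cube_coord x q.1.1) - q.1.2| `^ q.2.
  by rewrite v_prod.
apply: (hyperinvariant_cube tau_prod tau_ergodic.1 _ tauD c0 LP vE v_Linfty p_ge1
  (Ordinal d_gt0) eps_gt0 DK).
by move=> n; exact: normr_ge0.
Qed.
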